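(* Let $q\geq 5$ be an odd prime power, $A=\mathbb{F}_q[T]$, $F=\mathbb{F}_q(T)$, and fix positive integers $c_1,c_2$. Let $\mathcal{C}$ be the set of pairs $w=(g_1,g_2)\in A^2$ with $g_2\neq 0$, and for an integer $X>0$ let $\mathcal{C}(X)=\{(g_1,g_2)\in\mathcal{C} : \deg g_1< c_1X,\ \deg g_2<c_2X\}$ (equivalently $|w|<q^X$, where $|w|=\max\{|g_1|^{1/c_1},|g_2|^{1/c_2}\}$, $|f|=q^{\deg f}$). Let $\mathcal{T}\subseteq\mathcal{C}$ be the set of $w$ such that the $T$-adic Galois representation $\hat\rho_{\phi^w,(T)}:\operatorname{Gal}(F^{\mathrm{sep}}/F)\to\operatorname{GL}_2(A_{(T)})$ attached to the rank $2$ Drinfeld module $\phi^w$ is surjective, and $\mathcal{T}(X)=\mathcal{T}\cap\mathcal{C}(X)$. Then \[\liminf_{X\to\infty}\frac{\#\mathcal{T}(X)}{\#\mathcal{C}(X)}>0,\] i.e. there is a positive density of rank $2$ Drinfeld modules over $A$ whose $T$-adic Galois representation is surjective.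
   Context: For $w=(g_1,g_2)\in A^2$ with $g_2\ne0$, $\phi^w:A\to F\{\tau\}$ is the Drinfeld module of rank $2$ determined by $\phi^w_T=T+g_1\tau+g_2\tau^2$, where $F\{\tau\}$ is the twisted polynomial ring with $\tau c=c^q\tau$; $\phi^w_a(x)$ denotes the associated $\mathbb{F}_q$-linear polynomial. For a nonzero ideal $\mathfrak a=(a)$ of $A$, $\phi[\mathfrak a]$ is the set of roots of $\phi_a(x)$ in $F^{\mathrm{sep}}$, an $A$-module (via $b\ast\alpha=\phi_b(\alpha)$) isomorphic to $(A/\mathfrak a)^2$. With $\mathfrak p=(T)$, $A_{\mathfrak p}=\mathbb{F}_q[[T]]$ is the completion of $A$ at $\mathfrak p$, the Tate module $T_{\mathfrak p}(\phi)=\varprojlim_n\phi[\mathfrak p^n]$ is free of rank $2$ over $A_{\mathfrak p}$, and $\hat\rho_{\phi,\mathfrak p}$ is the action of $\operatorname{Gal}(F^{\mathrm{sep}}/F)$ on it with respect to an $A_{\mathfrak p}$-basis. *)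

(* Defs.v *)
From HB Require Import structures.
From mathcomp Require Import all_boot all_order all_algebra all_solvable.
From mathcomp Require Import all_field.
From mathcomp Require Import finmap.
From mathcomp Require Import all_classical all_reals all_analysis.

Set Implicit Arguments.
Unset Strict Implicit.
Unset Printing Implicit Defensive.

Import Order.TTheory GRing.Theory Num.Theory.
Local Open Scope ring_scope.
Local Open Scope classical_set_scope.

(* Skew polynomials K{tau} with tau c = s(c) tau. The element                 *)
(* \sum_i c_i tau^i is represented by the polynomial \sum_i c_i 'X^i.         *)
Record skewpoly (K : fieldType) (s : {rmorphism K -> K}) : Type :=
  SkewPoly { skew_poly : {poly K} }.

Section SkewPoly.
Variables (K : fieldType) (s : {rmorphism K -> K}).
Implicit Types (p q r : {poly K}) (c d : K).

Definition skew_mul p q : {poly K} :=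
  \sum_(i < size p) p`_i *: (iter i (map_poly s) q * 'X^i).

Let sh i q := iter i (map_poly s) q.

Let shD i : {morph sh i : p q / p + q}.
Proof. by move=> p q; elim: i => //= i ->; rewrite rmorphD. Qed.
Let sh0 i : sh i 0 = 0.
Proof. by elim: i => //= i ->; rewrite rmorph0. Qed.
Let sh1 i : sh i 1 = 1.
Proof. by elim: i => //= i ->; rewrite rmorph1. Qed.
Let shM i : {morph sh i : p q / p * q}.
Proof. by move=> p q; elim: i => //= i ->; rewrite rmorphM. Qed.
Let shC i c : sh i c%:P = (iter i s c)%:P.
Proof. by elim: i => //= i ->; rewrite map_polyC. Qed.
Let shX i n : sh i 'X^n = 'X^n.
Proof. by elim: i => //= i ->; rewrite map_polyXn. Qed.
Let sh_sum i n (F : 'I_n -> {poly K}) :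
  sh i (\sum_(k < n) F k) = \sum_(k < n) sh i (F k).
Proof. exact: (big_morph _ (shD i) (sh0 i)). Qed.

Let skew_mulE n p q : (size p <= n)%N ->
  skew_mul p q = \sum_(i < n) p`_i *: (sh i q * 'X^i).
Proof.
move=> le_pn; rewrite /skew_mul.
rewrite (big_ord_widen n (fun i => p`_i *: (sh i q * 'X^i))) //.
rewrite big_mkcond; apply: eq_bigr => i _ /=.
by case: ltnP => // ?; rewrite nth_default // scale0r.
Qed.

Fact skew_mulDl : left_distributive skew_mul +%R.
Proof.
move=> p q r; pose n := maxn (size p) (size q).
rewrite (@skew_mulE n (p + q)) ?size_polyD //.
rewrite (@skew_mulE n p) ?leq_maxl // (@skew_mulE n q) ?leq_maxr //.
by rewrite -big_split /=; apply: eq_bigr => i _; rewrite coefD scalerDl.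
Qed.

Fact skew_mulDr : right_distributive skew_mul +%R.
Proof.
move=> p q r; rewrite /skew_mul -big_split /=; apply: eq_bigr => i _.
by rewrite -/(sh _ _) shD mulrDl scalerDr.
Qed.

Let skew_mul0l q : skew_mul 0 q = 0.
Proof. by rewrite /skew_mul size_poly0 big_ord0. Qed.
Let skew_mul0r q : skew_mul q 0 = 0.
Proof.
by rewrite /skew_mul big1 // => i _; rewrite -/(sh _ _) sh0 mul0r scaler0.
Qed.

Let skew_mul_suml n (F : 'I_n -> {poly K}) r :
  skew_mul (\sum_(k < n) F k) r = \sum_(k < n) skew_mul (F k) r.
Proof.
exact: (big_morph (skew_mul^~ r) (fun p q => skew_mulDl p q r) (skew_mul0l r)).
Qed.
Let skew_mul_sumr n (F : 'I_n -> {poly K}) p :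
  skew_mul p (\sum_(k < n) F k) = \sum_(k < n) skew_mul p (F k).
Proof.
exact: (big_morph (skew_mul p) (skew_mulDr p) (skew_mul0r p)).
Qed.

Let skew_mulX c n q : skew_mul (c *: 'X^n) q = c *: (sh n q * 'X^n).
Proof.
rewrite (@skew_mulE n.+1).
  2: by rewrite (leq_trans (size_scale_leq _ _)) ?size_polyXn.
rewrite (bigD1 (Ordinal (ltnSn n))) //= coefZ coefXn eqxx mulr1.
rewrite big1 ?addr0 // => i; rewrite -val_eqE /= => /negbTE ne.
by rewrite coefZ coefXn ne mulr0 scale0r.
Qed.

Fact skew_mul1l : left_id (1 : {poly K}) skew_mul.
Proof.
by move=> q; have := skew_mulX 1 0 q; rewrite !scale1r expr0 mulr1.
Qed.

Fact skew_mul1r : right_id (1 : {poly K}) skew_mul.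
Proof.
move=> p; rewrite /skew_mul -[in RHS](coefK p) poly_def.
by apply: eq_bigr => i _; rewrite -/(sh _ _) sh1 mul1r.
Qed.

Let skew_mulA_mono c i d j r :
  skew_mul (c *: 'X^i) (skew_mul (d *: 'X^j) r) =
  skew_mul (skew_mul (c *: 'X^i) (d *: 'X^j)) r.
Proof.
rewrite !skew_mulX.
have -> : c *: (sh i (d *: 'X^j) * 'X^i) = (c * iter i s d) *: 'X^(i + j).
  by rewrite -!mul_polyC shM shC shX polyCM -!mulrA -exprD addnC.
rewrite skew_mulX -!mul_polyC !shM shC shX polyCM /sh iterD -!mulrA.
by rewrite -exprD addnC.
Qed.

Fact skew_mulA : associative skew_mul.
Proof.
move=> p q r; rewrite -[p]coefK poly_def skew_mul_suml.
rewrite [X in _ = skew_mul X _]skew_mul_suml [RHS]skew_mul_suml.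
apply: eq_bigr => i _; rewrite -[q]coefK poly_def.
rewrite [X in skew_mul _ X = _]skew_mul_suml [LHS]skew_mul_sumr.
rewrite [X in _ = skew_mul X _]skew_mul_sumr [RHS]skew_mul_suml.
by apply: eq_bigr => j _; apply: skew_mulA_mono.
Qed.

Local Notation S := (skewpoly s).
Implicit Types f g h : S.

HB.instance Definition _ := [isNew for @skew_poly K s].
HB.instance Definition _ := [Choice of S by <:].

Definition skp_zero : S := SkewPoly s 0.
Definition skp_opp f : S := SkewPoly s (- skew_poly f).
Definition skp_add f g : S := SkewPoly s (skew_poly f + skew_poly g).
Definition skp_one : S := SkewPoly s 1.
Definition skp_mul f g : S :=
  SkewPoly s (skew_mul (skew_poly f) (skew_poly g)).

Fact skp_addA : associative skp_add.
Proof. by move=> f g h; apply: val_inj; apply: addrA. Qed.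
Fact skp_addC : commutative skp_add.
Proof. by move=> f g; apply: val_inj; apply: addrC. Qed.
Fact skp_add0 : left_id skp_zero skp_add.
Proof. by move=> f; apply: val_inj; apply: add0r. Qed.
Fact skp_addN : left_inverse skp_zero skp_opp skp_add.
Proof. by move=> f; apply: val_inj; apply: addNr. Qed.
HB.instance Definition _ :=
  GRing.isZmodule.Build S skp_addA skp_addC skp_add0 skp_addN.

Fact skp_mulA : associative skp_mul.
Proof. by move=> f g h; apply: val_inj; apply: skew_mulA. Qed.
Fact skp_mul1l : left_id skp_one skp_mul.
Proof. by move=> f; apply: val_inj; apply: skew_mul1l. Qed.
Fact skp_mul1r : right_id skp_one skp_mul.
Proof. by move=> f; apply: val_inj; apply: skew_mul1r. Qed.
Fact skp_mulDl : left_distributive skp_mul skp_add.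
Proof. by move=> f g h; apply: val_inj; apply: skew_mulDl. Qed.
Fact skp_mulDr : right_distributive skp_mul skp_add.
Proof. by move=> f g h; apply: val_inj; apply: skew_mulDr. Qed.
Fact skp_one_neq0 : skp_one != 0.
Proof. by rewrite -val_eqE; apply: oner_neq0. Qed.
HB.instance Definition _ := GRing.Zmodule_isNzRing.Build S
  skp_mulA skp_mul1l skp_mul1r skp_mulDl skp_mulDr skp_one_neq0.

Definition skewC c : S := SkewPoly s c%:P.
Definition tau : S := SkewPoly s 'X.

Let skew_mulC c q : skew_mul c%:P q = c *: q.
Proof. by have := skew_mulX c 0 q; rewrite expr0 alg_polyC mulr1. Qed.

Fact skewC_is_zmod_morphism : zmod_morphism skewC.
Proof. by move=> c d; apply: val_inj; apply: polyCB. Qed.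
Fact skewC_is_monoid_morphism : monoid_morphism skewC.
Proof.
split=> // c d; apply: val_inj => /=.
by rewrite skew_mulC polyCM mul_polyC.
Qed.
HB.instance Definition _ :=
  GRing.isZmodMorphism.Build K S skewC skewC_is_zmod_morphism.
HB.instance Definition _ :=
  GRing.isMonoidMorphism.Build K S skewC skewC_is_monoid_morphism.

Lemma skewC_comm c d : GRing.comm (skewC c) (skewC d).
Proof. by rewrite /GRing.comm -!rmorphM mulrC. Qed.

Lemma tauC c : tau * skewC c = skewC (s c) * tau.
Proof.
apply: val_inj => /=; rewrite skew_mulC -[X in skew_mul X _]scale1r.
by rewrite (skew_mulX 1 1) /= map_polyC /= scale1r mul_polyC.
Qed.

End SkewPoly.

Record pseries (R : Type) : Type := PSeries { pscoef : nat -> R }.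

Section PSeries.
Variable R : comNzRingType.
Implicit Types a b c : pseries R.

HB.instance Definition _ := gen_eqMixin (pseries R).
HB.instance Definition _ := gen_choiceMixin (pseries R).

Lemma pseriesP a b : (forall n, pscoef a n = pscoef b n) -> a = b.
Proof. by case: a b => a [b] /= /funext ->. Qed.

Definition ps_zero : pseries R := PSeries (fun=> 0).
Definition ps_opp a : pseries R := PSeries (fun n => - pscoef a n).
Definition ps_add a b : pseries R := PSeries (fun n => pscoef a n + pscoef b n).
Definition ps_one : pseries R := PSeries (fun n => (n == 0%N)%:R).
Definition ps_mul a b : pseries R :=
  PSeries (fun n => \sum_(i < n.+1) pscoef a i * pscoef b (n - i)).

Fact ps_addA : associative ps_add.
Proof. by move=> a b c; apply: pseriesP => n /=; rewrite addrA. Qed.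
Fact ps_addC : commutative ps_add.
Proof. by move=> a b; apply: pseriesP => n /=; rewrite addrC. Qed.
Fact ps_add0 : left_id ps_zero ps_add.
Proof. by move=> a; apply: pseriesP => n /=; rewrite add0r. Qed.
Fact ps_addN : left_inverse ps_zero ps_opp ps_add.
Proof. by move=> a; apply: pseriesP => n /=; rewrite addNr. Qed.

HB.instance Definition _ :=
  GRing.isZmodule.Build (pseries R) ps_addA ps_addC ps_add0 ps_addN.

(* Reduction modulo T^n. *)
Definition ps_trunc n a : {poly R} := \poly_(i < n) pscoef a i.

Let coef_mul_trunc m n a b : (m < n)%N ->
  pscoef (ps_mul a b) m = (ps_trunc n a * ps_trunc n b)`_m.
Proof.
move=> lt_mn; rewrite coefM; apply: eq_bigr => i _; rewrite !coef_poly.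
rewrite (leq_ltn_trans _ lt_mn) ?(leq_ltn_trans (leq_subr _ _) lt_mn) //.
by rewrite -ltnS.
Qed.

Fact ps_mulA : associative ps_mul.
Proof.
move=> a b c; apply: pseriesP => n.
pose P := ps_trunc n.+1.
transitivity (P a * P b * P c)`_n.
  rewrite -mulrA coefM; apply: eq_bigr => i _.
  rewrite (@coef_mul_trunc _ n.+1) ?ltnS ?leq_subr //.
  by rewrite coef_poly ltn_ord.
rewrite coefM; apply: eq_bigr => i _; rewrite (@coef_mul_trunc _ n.+1) //.
by rewrite [in LHS]coef_poly ltnS leq_subr.
Qed.
Fact ps_mulC : commutative ps_mul.
Proof.
move=> a b; apply: pseriesP => n.
by rewrite !(@coef_mul_trunc _ n.+1) // mulrC.
Qed.
Fact ps_mul1 : left_id ps_one ps_mul.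
Proof.
move=> a; apply: pseriesP => n /=; rewrite big_ord_recl /= mul1r subn0.
by rewrite big1 ?addr0 // => i _; rewrite mul0r.
Qed.
Fact ps_mulDl : left_distributive ps_mul ps_add.
Proof.
move=> a b c; apply: pseriesP => n /=; rewrite -big_split /=.
by apply: eq_bigr => i _; rewrite mulrDl.
Qed.
Fact ps_one_neq0 : ps_one != 0.
Proof.
by apply/eqP => /(congr1 (fun a => pscoef a 0)) /eqP; rewrite oner_eq0.
Qed.

HB.instance Definition _ := GRing.Zmodule_isComNzRing.Build (pseries R)
  ps_mulA ps_mulC ps_mul1 ps_mulDl ps_one_neq0.

Definition ps_unit : {pred pseries R} := fun a => `[< exists b, b * a = 1 >].
Definition ps_inv a : pseries R :=
  if pselect (exists b, b * a = 1) is left ex then projT1 (cid ex) else a.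

Fact ps_mulV : {in ps_unit, left_inverse 1 ps_inv *%R}.
Proof.
move=> a /asboolP ex; rewrite /ps_inv; case: pselect => // ex'.
exact: projT2 (cid ex').
Qed.
Fact ps_unitP a b : b * a = 1 -> ps_unit a.
Proof. by move=> ba1; apply/asboolP; exists b. Qed.
Fact ps_inv_out : {in [predC ps_unit], ps_inv =1 id}.
Proof. by move=> a /asboolPn nex; rewrite /ps_inv; case: pselect. Qed.

HB.instance Definition _ := GRing.ComNzRing_hasMulInverse.Build (pseries R)
  ps_mulV ps_unitP ps_inv_out.

End PSeries.

Section SeparableClosure.
Variables (K L : fieldType) (iota : {rmorphism K -> L}).

Definition separably_closed : Prop :=
  forall p : {poly L}, separable_poly p -> (1 < size p)%N -> exists x, root p x.

Definition separable_algebraic : Prop :=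
  forall x : L,
    exists2 p : {poly K}, separable_poly p & root (map_poly iota p) x.

Definition separable_closure : Prop := separable_algebraic /\ separably_closed.

Definition in_galois_group (sigma : {rmorphism L -> L}) : Prop :=
  bijective sigma /\ forall x, sigma (iota x) = iota x.

End SeparableClosure.

(* K is an A-field via gamma; below it is F = Frac(A) with the inclusion.     *)
Section Drinfeld.
Variables (Fq : finFieldType) (K : fieldType).
Variable gamma : {rmorphism {poly Fq} -> K}.
Local Notation q := #|Fq|.
Local Notation A := {poly Fq}.

Definition frobq of {rmorphism A -> K} := fun x : K => x ^+ q.
Local Notation frob := (frobq gamma).

Fact pchar_natq : [pchar K].-nat q.
Proof.
have [p pr_p pcharFp] := finPcharP Fq.
have pK : p \in [pchar K].
  rewrite inE pr_p -(rmorph_nat gamma) -(rmorph_nat polyC).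
  by rewrite pcharf0 // !rmorph0 eqxx.
rewrite (eq_pnat _ (pcharf_eq pK)) -cardsT.
exact: abelem_pgroup (fin_ring_pchar_abelem pcharFp).
Qed.

Fact frobq_is_zmod_morphism : zmod_morphism frob.
Proof.
by move=> x y; rewrite /frobq exprDn_pchar ?exprNn_pchar ?pchar_natq.
Qed.
Fact frobq_is_monoid_morphism : monoid_morphism frob.
Proof. by split=> [|x y]; rewrite /frobq ?expr1n ?exprMn. Qed.

HB.instance Definition _ :=
  GRing.isZmodMorphism.Build K K frob frobq_is_zmod_morphism.
HB.instance Definition _ :=
  GRing.isMonoidMorphism.Build K K frob frobq_is_monoid_morphism.

Definition twisted : nzRingType := skewpoly frob.

Definition phi_T (w : A * A) : twisted :=
  skewC frob (gamma 'X) + skewC frob (gamma w.1) * tau frob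
    + skewC frob (gamma w.2) * tau frob ^+ 2.

Fact phi_T_comm (w : A * A) :
  commr_rmorph (skewC frob \o gamma \o polyC) (phi_T w).
Proof.
move=> c; rewrite /=; set d := skewC _ _.
have dC x : GRing.comm d (skewC frob x) by apply: skewC_comm.
have dtau : GRing.comm d (tau frob).
  rewrite /GRing.comm /d tauC; congr (skewC _ _ * _).
  by rewrite /= /frobq -(rmorphXn gamma) -(rmorphXn polyC) expf_card.
apply: commr_sym; apply: commrD; first apply: commrD => //.
  exact: commrM.
by apply: commrM => //; apply: commrX.
Qed.

(* The ring homomorphism phi^w : A -> K{tau} sending T to phi_T. *)
Definition drinfeld (w : A * A) : {rmorphism A -> twisted} :=
  horner_morph (phi_T_comm w).

(* The F_q-linear polynomial \sum_i c_i x^(q^i) of \sum_i c_i tau^i. *)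
Definition linearized (f : twisted) : {poly K} :=
  \sum_(i < size (skew_poly f)) (skew_poly f)`_i *: 'X^(q ^ i).

Section Torsion.
Variables (Fsep : fieldType) (iota : {rmorphism K -> Fsep}) (w : A * A).

Definition phi_eval (a : A) (x : Fsep) : Fsep :=
  (map_poly iota (linearized (drinfeld w a))).[x].

Definition torsion (a : A) : set Fsep :=
  [set x | root (map_poly iota (linearized (drinfeld w a))) x].

(* The inverse limit of the phi[T^n], with transition maps phi_T. *)
Definition tate : set (nat -> Fsep) :=
  [set x | (forall n, torsion 'X^n (x n)) /\
           (forall n, phi_eval 'X (x n.+1) = x n)].

(* F_q[[T]] acts on phi[T^n] through its quotient A/(T^n). *)
Definition tate_scale (a : pseries Fq) (x : nat -> Fsep) : nat -> Fsep :=
  fun n => phi_eval (ps_trunc n a) (x n).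

Definition tate_comb (a : 'cV[pseries Fq]_2) (e : 'I_2 -> nat -> Fsep) :
    nat -> Fsep :=
  fun n => \sum_(i < 2) tate_scale (a i 0) (e i) n.

Definition tate_basis (e : 'I_2 -> nat -> Fsep) : Prop :=
  (forall i, tate (e i)) /\
  (forall x, tate x -> exists! a : 'cV[pseries Fq]_2, x = tate_comb a e).

(* M is the matrix of sigma acting on the Tate module in the basis e. *)
Definition rho_matrix (e : 'I_2 -> nat -> Fsep)
    (sigma : {rmorphism Fsep -> Fsep}) (M : 'M[pseries Fq]_2) : Prop :=
  forall j, (fun n => sigma (e j n)) = tate_comb (col j M) e.

Definition rho_surjective : Prop :=
  exists2 e, tate_basis e &
    forall M : 'M[pseries Fq]_2, M \in unitmx ->
      exists2 sigma, in_galois_group iota sigma & rho_matrix e sigma M.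

End Torsion.

End Drinfeld.

Section Density.
Variable Fq : finFieldType.
Local Notation A := {poly Fq}.

Definition pairs : set (A * A) := [set w | w.2 != 0].

(* deg g < n is size g <= n, with deg 0 = -oo. *)
Definition pairs_below (c1 c2 X : nat) : set (A * A) :=
  pairs `&` [set w : A * A | (size w.1 <= c1 * X)%N /\ (size w.2 <= c2 * X)%N].

Definition surjective_pairs (Fsep : fieldType)
    (iota : {rmorphism {fraction A} -> Fsep}) : set (A * A) :=
  pairs `&` [set w | rho_surjective (@tofrac A) iota w].

Lemma finite_pairs_below c1 c2 X : finite_set (pairs_below c1 c2 X).
Proof.
pose P n : set A := [set g | (size g <= n)%N].
have finP n : finite_set (P n).
  apply: (@sub_finite_set _ _ [set rVpoly v | v in [set: 'rV[Fq]_n]]).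
    by move=> g /= gn; exists (poly_rV g) => //; rewrite poly_rV_K.
  exact/finite_image/finite_finset.
apply: (sub_finite_set _ (finite_setX (finP (c1 * X)%N) (finP (c2 * X)%N))).
by move=> w [_].
Qed.

End Density.

Arguments pairs_below : clear implicits.

(* Main.v *)
From Pilot Require Import Defs.
From HB Require Import structures.
From mathcomp Require Import all_boot all_order all_algebra all_solvable all_field.
From mathcomp Require Import finmap.
From mathcomp Require Import all_classical all_reals all_analysis.
From mathcomp Require Import ring.
(* Again, because MathComp-Analysis has another [pseries]. *)
Import Pilot.Defs.

Set Implicit Arguments.
Unset Strict Implicit.
Unset Printing Implicit Defensive.

Import Order.TTheory GRing.Theory Num.Theory.
Local Open Scope ring_scope.
Local Open Scope classical_set_scope.

(**
Write [D x = T x + g1 x^q + g2 x^(q^2)] for the operator of [phi_T].  Density is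
obtained from one residue class: fix [c] different from [0] and [1], and let
[g1 = (T - c) (1 + T (T - 1) h1)],
[g2 = (T - 1) (T - c) (1 + T (T - 1) (T - c) h2)] with [h1], [h2] arbitrary.

At [T = 1] the module degenerates: over [k[[r]]], [T = 1 + r^(q-1)], with [k] the
algebraic closure of [F_q], [D^n] factors as [F o E] where the kernel of [E] is
generated by an integral torsion point [f1], and [E x = z] with [z] of order [-1]
is a reversed Eisenstein equation.  Its roots [x + b f1] are therefore conjugate
over a field containing [f1], which gives all transvections fixing [f1].
At [T = 0] the reduction is ordinary: [D^n = F o E] with the kernel of [E] totally
ramified (Eisenstein) and all roots of [F] in [k[[T]]], which gives elements with
every determinant.  At [T = c] the equation [T + g1 X + g2 X^(q+1) = 0] is of
Eisenstein type, so the line spanned by [f1] is not Galois stable; a conjugate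
[f2] of [f1] completes it to a basis, and the transvections fixing [f1] or [f2]
generate [SL_2].

No extension of valuations is needed: a maximal isomorphism between a subfield of
[k((r))] and a subfield of the separable closure carries irreducibility over
[k((r))] to the Galois side.
*)


(** * Partial isomorphisms between fields *)

(** Each local argument yields Galois elements whose action is known on one finite level of the
    torsion only, so their matrices are known only modulo a power of [T]. The image is therefore
    handled as a closed subgroup of [GL_2]: closedness turns approximations into exact
    transvections, and because [F_q[[T]]] is a local ring the elementary matrices give all of [SL_2]
    without a separate argument modulo [T]. The residue field [k] is algebraically closed so that
    every additive equation with nonzero linear coefficient is solvable modulo the uniformizer;
    Hensel's lemma then solves over [k[[r]]] everything except one equation, which is of Eisenstein
    type. The degenerate place is an analogue of a Tate curve, with [z] in the role of the period.
    The chain of factorizations [D_i = F_i o E_i] replaces analytic uniformization, and the same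
    construction serves the ordinary place, because it only asks that [g1] be a unit and that [T] or
    [g2] vanish in the residue field. *)

(* [R] is the graph of an isomorphism between a subfield of [C] and one of [D];
   [piV] is unconditional because [0^-1 = 0]. *)
Record piso (C D : fieldType) (R : set (C * D)) : Prop := Piso {
  pi1 : R (1, 1);
  piB : forall x y x' y', R (x, y) -> R (x', y') -> R (x - x', y - y');
  piM : forall x y x' y', R (x, y) -> R (x', y') -> R (x * x', y * y');
  piV : forall x y, R (x, y) -> R (x^-1, y^-1);
  pi_fun : forall y, R (0, y) -> y = 0;
  pi_inj : forall x, R (x, 0) -> x = 0 }.

Definition piso_max (C D : fieldType) (R : set (C * D)) : Prop :=
  piso R /\ forall R', piso R' -> R `<=` R' -> R' `<=` R.

Definition prel (C D : fieldType) (R : set (C * D)) (P : {poly C}) (Q : {poly D}) :=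
  forall i, R (P`_i, Q`_i).

(** Only factorizations with both factors defined over the domain of [R] are tested, so [m] may well
    split over [C]. *)
Definition prel_irr (C D : fieldType) (R : set (C * D)) (m : {poly C}) (m' : {poly D}) :=
  [/\ prel R m m', (1 < size m)%N &
   forall n n' s s', prel R n n' -> prel R s s' -> m = n * s ->
     size n = 1%N \/ size s = 1%N].

(** The inverse isomorphism; statements about [R] are read in the other direction through it. *)
Definition ptr (C D : Type) (R : set (C * D)) : set (D * C) :=
  [set z | R (z.2, z.1)].

Section PartialIso.
Variables (C D : fieldType) (R : set (C * D)).
Hypothesis pR : piso R.

Lemma pi0 : R (0, 0).
Proof. by have := piB pR (pi1 pR) (pi1 pR); rewrite !subrr. Qed.

Lemma piN x y : R (x, y) -> R (- x, - y).
Proof. by move=> h; have := piB pR pi0 h; rewrite !sub0r. Qed.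

Lemma piD x y x' y' : R (x, y) -> R (x', y') -> R (x + x', y + y').
Proof. by move=> h /piN h'; have := piB pR h h'; rewrite !opprK. Qed.

Lemma pi_sum n (f : 'I_n -> C) (g : 'I_n -> D) :
  (forall i, R (f i, g i)) -> R (\sum_i f i, \sum_i g i).
Proof.
elim: n f g => [|n IH] f g h; first by rewrite !big_ord0; apply: pi0.
by rewrite !big_ord_recr /=; apply: piD => //; apply: IH.
Qed.

Lemma piX x y n : R (x, y) -> R (x ^+ n, y ^+ n).
Proof.
move=> h; elim: n => [|n IH]; first by rewrite !expr0; apply: (pi1 pR).
by rewrite !exprS; apply: (piM pR).
Qed.

Lemma pi_uniq x y y' : R (x, y) -> R (x, y') -> y = y'.
Proof.
move=> h h'; apply/subr0_eq/(pi_fun pR).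
by have := piB pR h h'; rewrite subrr.
Qed.

Lemma pi_uniql x x' y : R (x, y) -> R (x', y) -> x = x'.
Proof.
move=> h h'; apply/subr0_eq/(pi_inj pR).
by have := piB pR h h'; rewrite subrr.
Qed.

Lemma ptr_piso : piso (ptr R).
Proof.
split; rewrite /ptr /=.
- exact: (pi1 pR).
- by move=> x y x' y'; apply: (piB pR).
- by move=> x y x' y'; apply: (piM pR).
- by move=> x y; apply: (piV pR).
- exact: (pi_inj pR).
- exact: (pi_fun pR).
Qed.

Notation rel := (prel R).

Lemma prel0 : rel 0 0.
Proof. by move=> i; rewrite !coef0; apply: pi0. Qed.

Lemma prelB P Q P' Q' : rel P Q -> rel P' Q' -> rel (P - P') (Q - Q').
Proof. by move=> h h' i; rewrite !coefB; apply: (piB pR). Qed.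

Lemma prelD P Q P' Q' : rel P Q -> rel P' Q' -> rel (P + P') (Q + Q').
Proof. by move=> h h' i; rewrite !coefD; apply: piD. Qed.

Lemma prelM P Q P' Q' : rel P Q -> rel P' Q' -> rel (P * P') (Q * Q').
Proof.
by move=> h h' i; rewrite !coefM; apply: pi_sum => j; apply: (piM pR).
Qed.

Lemma prelC x y : R (x, y) -> rel x%:P y%:P.
Proof. by move=> h i; rewrite !coefC; case: eqP => // _; apply: pi0. Qed.

Lemma prelXn n : rel 'X^n 'X^n.
Proof.
by move=> i; rewrite !coefXn; case: eqP => _; [apply: (pi1 pR)|apply: pi0].
Qed.

Lemma prel_exp P Q n : rel P Q -> rel (P ^+ n) (Q ^+ n).
Proof.
move=> h; elim: n => [|n IH]; last by rewrite !exprS; apply: prelM.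
by rewrite !expr0 -!polyC1; apply: prelC; apply: (pi1 pR).
Qed.

Lemma prel_uniq P Q Q' : rel P Q -> rel P Q' -> Q = Q'.
Proof. by move=> h h'; apply/polyP => i; apply: pi_uniq (h i) (h' i). Qed.

Lemma prel_le P Q : rel P Q -> (size Q <= size P)%N.
Proof.
move=> h; apply/leq_sizeP => j hj; apply: (pi_fun pR).
by have := h j; rewrite [P`_j]nth_default.
Qed.

End PartialIso.

Section PartialIso2.
Variables (C D : fieldType) (R : set (C * D)).
Hypothesis pR : piso R.
Notation rel := (prel R).

Lemma prel_size P Q : rel P Q -> size P = size Q.
Proof.
move=> h; apply/eqP; rewrite eqn_leq (prel_le pR) // andbT.
by apply: (@prel_le _ _ (ptr R)) => //; apply: ptr_piso.
Qed.

Lemma prel_neq0 P Q : rel P Q -> P != 0 -> Q != 0.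
Proof. by move=> h; rewrite -!size_poly_eq0 (prel_size h). Qed.

(** The domain of [R] is a mere subset of [C], so the division algorithm is run on both sides at
    once; this shows that quotient and remainder stay in the domain and correspond. *)
Lemma prel_div P Q n n' : rel P Q -> rel n n' -> n != 0 ->
  exists S S' P0 Q0, [/\ rel S S', rel P0 Q0, P = S * n + P0, Q = S' * n' + Q0
     & (size P0 < size n)%N].
Proof.
move=> + hn n0; have n0' := prel_neq0 hn n0.
have [k] := ubnP (size P); elim: k P Q => // k IH P Q ltk h.
have [lt|le] := ltnP (size P) (size n).
  exists 0, 0, P, Q; split=> //; first exact: prel0.
    by rewrite mul0r add0r.
  by rewrite mul0r add0r.
have P0 : P != 0 by rewrite -size_poly_gt0 (leq_trans _ le) // size_poly_gt0.
pose d := (size P - size n)%N.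
pose M := (lead_coef P / lead_coef n)%:P * 'X^d.
pose M' := (lead_coef Q / lead_coef n')%:P * 'X^d.
have hM : rel M M'.
  apply: prelM => //; last exact: prelXn.
  apply: prelC => //; apply: (piM pR).
    by rewrite !lead_coefE -(prel_size h).
  by apply: (piV pR); rewrite !lead_coefE -(prel_size hn).
have h2 : rel (P - M * n) (Q - M' * n') by apply: prelB => //; apply: prelM.
have sz : (size (P - M * n)%R < size P)%N.
  have ln0 : lead_coef n != 0 by rewrite lead_coef_eq0.
  have lM : lead_coef M = lead_coef P / lead_coef n.
    by rewrite lead_coefM lead_coefC lead_coefXn mulr1.
  have c0 : lead_coef P / lead_coef n != 0.
    by rewrite mulf_neq0 ?invr_eq0 ?lead_coef_eq0.
  have sM : size M = d.+1 by rewrite /M mul_polyC size_scale // size_polyXn.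
  have sMn : size (M * n) = size P.
    rewrite size_mul ?sM //; last by rewrite -size_poly_gt0 sM.
    by rewrite addSn /= /d subnK.
  rewrite -[X in (_ < X)%N]prednK ?size_poly_gt0 // ltnS.
  apply/leq_sizeP => j; rewrite leq_eqVlt => /predU1P[<-|lt].
    rewrite coefB -lead_coefE -[in (_ * n)`_ _]sMn -lead_coefE lead_coefM lM.
    by rewrite divfK // subrr.
  have lt' : (size P <= j)%N by rewrite -(prednK (n := size P)) ?size_poly_gt0.
  by rewrite coefB !nth_default ?subrr ?sMn.
have [|S [S' [P1 [Q1 [hS h1 e1 e2 l]]]]] := IH _ _ _ h2.
  by rewrite (leq_trans sz).
exists (S + M), (S' + M'), P1, Q1; split=> //; first exact: prelD.
  by rewrite mulrDl addrAC -e1 subrK.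
by rewrite mulrDl addrAC -e2 subrK.
Qed.

(** [n] is the minimal polynomial of [x] over the domain of [R]: its degree is least, so a remainder
    modulo [n] that vanishes at [x] is zero. *)
Lemma prel_min x p p' : rel p p' -> p != 0 -> root p x ->
  exists n n', [/\ rel n n', n != 0, root n x &
    forall P Q, rel P Q -> root P x ->
      exists S S', [/\ rel S S', P = S * n & Q = S' * n']].
Proof.
move=> hp p0 px.
pose S k := `[< exists n n', [/\ rel n n', n != 0, root n x & size n = k] >].
have exS : exists k, S k by exists (size p); apply/asboolP; exists p, p'.
case: (ex_minnP exS) => k /asboolP[n [n' [hn n0 nx sk]]] kmin.
exists n, n'; split=> // P Q hPQ Px.
have [S1 [S2 [P0 [Q0 [hS h0 eP eQ lt]]]]] := prel_div hPQ hn n0.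
have P00 : P0 = 0.
  apply/eqP/negP => /negP P0n.
  have : S (size P0).
    apply/asboolP; exists P0, Q0; split=> //.
    by move: Px; rewrite /root eP hornerD hornerM (rootP nx) mulr0 add0r.
  by move/kmin; rewrite -sk leqNgt lt.
have Q00 : Q0 = 0.
  apply/eqP; rewrite -size_poly_eq0 -(prel_size h0) P00 size_poly0 //.
by exists S1, S2; split; rewrite ?eP ?eQ ?P00 ?Q00 ?addr0.
Qed.

(** A factor of the minimal polynomial that vanishes at [x] is a multiple of it, hence has full
    degree and leaves a constant cofactor. *)
Lemma prel_min_irr x p p' : rel p p' -> p != 0 -> root p x ->
  exists n n', [/\ prel_irr R n n', root n x &
    forall P Q, rel P Q -> root P x ->
      exists S S', [/\ rel S S', P = S * n & Q = S' * n']].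
Proof.
move=> hp p0 px; have [n [n' [hn n0 nx div]]] := prel_min hp p0 px.
exists n, n'; split=> //; split=> //.
  rewrite ltnNge; apply/negP => /size1_polyC en.
  by move: nx n0; rewrite en rootC polyC_eq0 => ->.
move=> a a' b b' ha hb eab.
have main a1 a2 b1 : prel R a1 a2 -> n = a1 * b1 -> root a1 x -> size b1 = 1%N.
  move=> ha1 e1 a1x; have [T [T' [_ eT _]]] := div _ _ ha1 a1x.
  have [a10 b10] : a1 != 0 /\ b1 != 0.
    by apply/andP; move: n0; rewrite e1 mulf_eq0 negb_or.
  have : (size n <= size a1)%N.
    by apply: dvdp_leq => //; rewrite eT dvdp_mull.
  rewrite e1 size_mul // => le.
  have := size_poly_gt0 b1; rewrite b10.
  by case: (size b1) le => // -[|k] //; rewrite !addnS /= ltnNge leq_addr.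
have : root (a * b) x by rewrite -eab.
rewrite rootM => /orP[ax|bx].
  by right; apply: (main a a' b).
by left; apply: (main b b' a); rewrite // eab mulrC.
Qed.

(** Up to a constant [m] is the minimal polynomial of [x], so it divides [P]; the corresponding
    division of [Q] shows that [Q] vanishes at [y]. *)
Lemma prel_irr_root m m' x y P Q : prel_irr R m m' -> root m x -> root m' y ->
  rel P Q -> root P x -> root Q y.
Proof.
move=> [hm sm irr] mx my hPQ Px.
have m0 : m != 0 by rewrite -size_poly_gt0 ltnW.
have [n [n' [hn n0 nx div]]] := prel_min hm m0 mx.
have [S [S' [hS em em']]] := div _ _ hm mx.
have n'y : root n' y.
  case: (irr _ _ _ _ hS hn em) => [s1|s1]; last first.
    by move/eqP: s1 => /size_poly1P[c c0 ec]; move: nx; rewrite ec rootC (negPf c0).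
  move: s1; rewrite (prel_size hS) => /eqP/size_poly1P[c c0 ec].
  by move: my; rewrite em' ec rootM rootC (negPf c0).
have [S1 [S1' [_ _ ->]]] := div _ _ hPQ Px.
by rewrite rootM n'y orbT.
Qed.

Lemma prel_irr_tr m m' : prel_irr R m m' -> prel_irr (ptr R) m' m.
Proof.
move=> [hm sm irr]; split=> //; first by rewrite -(prel_size hm).
move=> n n' s s' hn hs e; rewrite -(prel_size hn) -(prel_size hs).
apply: (irr _ _ _ _ hn hs); apply: (prel_uniq (ptr_piso pR) hm).
by rewrite e; apply: (prelM (ptr_piso pR)).
Qed.

End PartialIso2.

(** The extension sends [P(x) / P'(x)] to [Q(y) / Q'(y)]; the equivalence [A1] makes this map and
    its inverse well defined. *)
Lemma piso_ext (C D : fieldType) (R : set (C * D)) m m' x y :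
  piso R -> prel_irr R m m' -> root m x -> root m' y ->
  exists R', [/\ piso R', R `<=` R' & R' (x, y)].
Proof.
move=> pR irr mx my.
have A1 P Q : prel R P Q -> (P.[x] == 0) = (Q.[y] == 0).
  move=> h; apply/idP/idP => h0; first exact: (prel_irr_root pR irr mx my h h0).
  by apply: (prel_irr_root (ptr_piso pR) (prel_irr_tr pR irr) my mx _ h0).
exists [set z | exists P Q P' Q', [/\ prel R P Q, prel R P' Q', P'.[x] != 0,
   z.1 = P.[x] / P'.[x] & z.2 = Q.[y] / Q'.[y]]].
have r1 : prel R 1 1 by rewrite -!polyC1; apply: prelC => //; apply: (pi1 pR).
have x1 : (1 : {poly C}).[x] != 0 by rewrite hornerC oner_eq0.
split.
- split.
  + by exists 1, 1, 1, 1; split; rewrite //= !hornerC !divr1.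
  + move=> a b a' b' [P [Q [P' [Q' [h h' n0 /= -> ->]]]]].
    move=> [S [T [S' [T' [k k' s0 /= -> ->]]]]].
    have n0' : Q'.[y] != 0 by rewrite -(A1 _ _ h').
    have s0' : T'.[y] != 0 by rewrite -(A1 _ _ k').
    exists (P * S' - S * P'), (Q * T' - T * Q'), (P' * S'), (Q' * T').
    split=> /=; rewrite ?hornerE ?mulf_neq0 //.
    * by apply: prelB => //; apply: prelM.
    * by apply: prelM.
    * by field; rewrite ?n0 ?s0.
    * by field; rewrite ?n0' ?s0'.
  + move=> a b a' b' [P [Q [P' [Q' [h h' n0 /= -> ->]]]]].
    move=> [S [T [S' [T' [k k' s0 /= -> ->]]]]].
    exists (P * S), (Q * T), (P' * S'), (Q' * T').
    split=> /=; rewrite ?hornerM ?mulf_div ?mulf_neq0 //; exact: prelM.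
  + move=> a b [P [Q [P' [Q' [h h' n0 /= -> ->]]]]].
    have [P0|P0] := eqVneq P.[x] 0.
      exists 0, 0, 1, 1; split=> //; first exact: prel0.
        by rewrite /= P0 mul0r invr0 horner0 mul0r.
      have /eqP -> : Q.[y] == 0 by rewrite -(A1 _ _ h) P0.
      by rewrite /= mul0r invr0 horner0 mul0r.
    by exists P', Q', P, Q; split; rewrite //= invf_div.
  + move=> b [P [Q [P' [Q' [h h' n0 /= e ->]]]]].
    have /eqP -> : Q.[y] == 0; last by rewrite mul0r.
    by rewrite -(A1 _ _ h); move/esym/eqP: e; rewrite mulf_eq0 invr_eq0 (negPf n0) orbF.
  + move=> a [P [Q [P' [Q' [h h' n0 /= -> e]]]]].
    have n0' : Q'.[y] != 0 by rewrite -(A1 _ _ h').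
    have /eqP -> : P.[x] == 0; last by rewrite mul0r.
    by rewrite (A1 _ _ h); move/esym/eqP: e; rewrite mulf_eq0 invr_eq0 (negPf n0') orbF.
- move=> [a b] h; exists a%:P, b%:P, 1, 1; split=> //=; first exact: prelC.
    by rewrite !hornerC divr1.
  by rewrite !hornerC divr1.
- exists 'X, 'X, 1, 1; split=> //=; first exact: (prelXn pR 1).
    by rewrite hornerX hornerC divr1.
  by rewrite hornerX hornerC divr1.
Qed.

Lemma piso_max_ex (C D : fieldType) (R0 : set (C * D)) : piso R0 ->
  exists2 R, piso_max R & R0 `<=` R.
Proof.
move=> p0.
(* Zorn's lemma is applied to the sets [A] whose union with [R0] is a partial isomorphism, so that
   the empty chain, with empty union, is covered. *)
have [F hF totF|A [pA maxA]] :=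
  @Zorn_bigcup (C * D)%type [set A | piso (R0 `|` A)].
  rewrite /=.
  set U := _ `|` _.
  have inU A z : F A -> (R0 `|` A) z -> U z.
    by move=> FA [z0|Az]; [left|right; exists A].
  have dir z z' : U z -> U z' -> exists2 V, piso V /\ V `<=` U & V z /\ V z'.
    move=> [z0|[A FA Az]] [z0'|[B FB Bz]].
    - by exists R0 => //; split => // t h; left.
    - exists (R0 `|` B); first by split; [exact: hF|move=> t; apply: inU].
      by split; [left|right].
    - exists (R0 `|` A); first by split; [exact: hF|move=> t; apply: inU].
      by split; [right|left].
    - have [AB|BA] := totF _ _ FA FB.
        exists (R0 `|` B); first by split; [exact: hF|move=> t; apply: inU].
        by split; right => //; apply: AB.
      exists (R0 `|` A); first by split; [exact: hF|move=> t; apply: inU].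
      by split; right => //; apply: BA.
  split.
  - by left; apply: (pi1 p0).
  - by move=> x y x' y' h /(dir _ _ h)[V [pV VU] [v1 v2]]; apply/VU/(piB pV).
  - by move=> x y x' y' h /(dir _ _ h)[V [pV VU] [v1 v2]]; apply/VU/(piM pV).
  - by move=> x y h; have [V [pV VU] [v1 _]] := dir _ _ h h; apply/VU/(piV pV).
  - by move=> y h; have [V [pV VU] [v1 _]] := dir _ _ h h; apply: (pi_fun pV).
  - by move=> y h; have [V [pV VU] [v1 _]] := dir _ _ h h; apply: (pi_inj pV).
exists (R0 `|` A); last by move=> z; left.
split=> // R' pR' sub z R'z; apply: contrapT => nz.
have := maxA R'; case.
  split; first by move=> t At; apply: sub; right.
  by move=> /(_ _ R'z) Az; apply: nz; right.
rewrite /= (_ : R0 `|` R' = R') //; apply/setUidPr => t h; apply: sub; by left.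
Qed.

Lemma piso_max_tr (C D : fieldType) (R : set (C * D)) :
  piso_max R -> piso_max (ptr R).
Proof.
move=> [pR mR]; split; first exact: ptr_piso.
move=> R' pR' sub [x y] h; apply: (mR (ptr R')) => //; first exact: ptr_piso.
by move=> [a b] hab; apply: sub.
Qed.

Lemma separable_dvd (K : fieldType) (p s n : {poly K}) :
  separable_poly p -> p = s * n -> separable_poly n.
Proof.
by move=> sp e; apply: (dvdp_separable _ sp); rewrite e dvdp_mull.
Qed.

(** The image of the minimal polynomial of [x] divides the separable [p'], so it has a root in [D];
    by maximality, extending [R] by this root adds nothing. *)
Lemma piso_max_dom (C D : fieldType) (R : set (C * D)) p p' x :
  separably_closed D -> piso_max R -> prel R p p' -> separable_poly p' ->
  root p x -> exists y, R (x, y).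
Proof.
move=> cl [pR mR] hp sp px.
have p'0 : p' != 0 by apply: separable_poly_neq0.
have p0 : p != 0 by rewrite -size_poly_eq0 (prel_size pR hp) size_poly_eq0.
have [n [n' [irr nx div]]] := prel_min_irr pR hp p0 px.
have [S [S' [hS e e']]] := div _ _ hp px.
have [hn sn _] := irr.
have [y ny] : exists y, root n' y.
  by apply: cl; [exact: separable_dvd e'|rewrite -(prel_size pR hn)].
have [R' [pR' sub Rxy]] := piso_ext pR irr nx ny.
by exists y; apply: (mR _ pR' sub).
Qed.

Lemma piso_max_bij (C D : fieldType) (R : set (C * D)) : piso R ->
  (forall x, exists y, R (x, y)) -> (forall y, exists x, R (x, y)) ->
  exists s : {rmorphism C -> D}, bijective s /\ forall x y, R (x, y) -> s x = y.
Proof.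
move=> pR tot1 tot2.
pose f x := projT1 (cid (tot1 x)).
pose g y := projT1 (cid (tot2 y)).
have fP x : R (x, f x) by rewrite /f; case: cid.
have gP x : R (g x, x) by rewrite /g; case: cid.
have fE x y : R (x, y) -> f x = y by apply: pi_uniq.
have fB : zmod_morphism f by move=> x y; apply: fE; apply: (piB pR).
have fM : monoid_morphism f.
  by split=> [|x y]; apply: fE; [apply: (pi1 pR)|apply: (piM pR)].
pose s : {rmorphism C -> D} := HB.pack f
  (GRing.isZmodMorphism.Build _ _ f fB) (GRing.isMonoidMorphism.Build _ _ f fM).
exists s; split=> //; exists g => x /=; last exact: fE.
exact: (pi_uniql pR (gP _) (fP _)).
Qed.


(** * Galois automorphisms from partial isomorphisms *)

Section Base.
Variables (A : idomainType) (C D : fieldType).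
Variables (jC : {rmorphism A -> C}) (jD : {rmorphism A -> D}).
Hypotheses (injC : injective jC) (injD : injective jD).

(** The identity of the fraction field of [A], seen as a relation between its copies in [C] and
    [D]. *)
Definition pbase : set (C * D) :=
  [set z | exists a b, [/\ b != 0, z.1 = jC a / jC b & z.2 = jD a / jD b]].

Lemma pbase_ring a : pbase (jC a, jD a).
Proof. by exists a, 1; rewrite oner_neq0 !rmorph1 !divr1. Qed.

Lemma pbase_piso : piso pbase.
Proof.
have C0 a : (jC a == 0) = (a == 0) by rewrite -(rmorph0 jC) (inj_eq injC).
have D0 a : (jD a == 0) = (a == 0) by rewrite -(rmorph0 jD) (inj_eq injD).
split.
- by have := pbase_ring 1; rewrite !rmorph1.
- move=> x y x' y' [a [b [b0 /= -> ->]]] [a' [b' [b0' /= -> ->]]].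
  exists (a * b' - a' * b), (b * b'); split; rewrite ?mulf_neq0 //=.
    by rewrite rmorphB !rmorphM; field; rewrite !C0 ?b0 ?b0'.
  by rewrite rmorphB !rmorphM; field; rewrite !D0 ?b0 ?b0'.
- move=> x y x' y' [a [b [b0 /= -> ->]]] [a' [b' [b0' /= -> ->]]].
  by exists (a * a'), (b * b'); rewrite mulf_neq0 //= !rmorphM !mulf_div.
- move=> x y [a [b [b0 /= -> ->]]].
  have [->|a0] := eqVneq a 0.
    by exists 0, 1; rewrite oner_neq0 !rmorph0 !mul0r !invr0.
  by exists b, a; rewrite a0 !invf_div.
- move=> y [a [b [b0 /= e ->]]].
  move/esym/eqP: e; rewrite mulf_eq0 invr_eq0 !C0 (negPf b0) orbF => /eqP ->.
  by rewrite rmorph0 mul0r.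
- move=> y [a [b [b0 /= -> e]]].
  move/esym/eqP: e; rewrite mulf_eq0 invr_eq0 !D0 (negPf b0) orbF => /eqP ->.
  by rewrite rmorph0 mul0r.
Qed.

End Base.

Lemma fraction_div (A : idomainType) (x : {fraction A}) :
  exists a b, b != 0 /\ x = tofrac a / tofrac b.
Proof.
elim/quotW: x => y; exists (frac y).1, (frac y).2.
have d0 := denom_ratioP y; split=> //.
have f0 : tofrac (frac y).2 != 0 :> {fraction A} by rewrite tofrac_eq0.
apply: (mulIf f0); rewrite divfK //; unlock tofrac.
rewrite -[LHS]FracField.pi_mul; apply/eqmodP; rewrite /= FracField.equivfE.
by rewrite /FracField.mulf !numden_Ratio ?mulf_neq0 ?oner_neq0 // !mulr1 mulrC.
Qed.

Section Galois.
Variables (A : idomainType) (L : fieldType) (iota : {rmorphism {fraction A} -> L}).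
Hypothesis scl : separable_closure iota.
Let j := iota \o @tofrac A.

Lemma jinj : injective j.
Proof. by move=> a b /fmorph_inj /eqP; rewrite tofrac_eq => /eqP. Qed.

Lemma pbase_frac x : pbase j j (iota x, iota x).
Proof.
have [a [b [b0 ->]]] := fraction_div x.
by exists a, b; rewrite b0 /j /= fmorph_div.
Qed.

(** A maximal extension of [R] is total in both directions, because every element of [L] is a root
    of a separable polynomial over the base field. *)
Lemma galois_of_piso (R : set (L * L)) : piso R -> pbase j j `<=` R ->
  exists2 s, in_galois_group iota s & forall x y, R (x, y) -> s x = y.
Proof.
move=> pR base; have [Rm mR sub] := piso_max_ex pR.
have bm x : Rm (iota x, iota x) by apply/sub/base/pbase_frac.
have dom R' x : piso_max R' -> (forall x, R' (iota x, iota x)) -> exists y, R' (x, y).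
  move=> mR' bR'; have [p sp px] := scl.1 x.
  apply: (piso_max_dom scl.2 mR' (p := map_poly iota p) (p' := map_poly iota p)) => //.
    by move=> i; rewrite !coef_map /=; apply: bR'.
  by rewrite separable_map.
have [s [bs sP]] : exists s : {rmorphism L -> L},
    bijective s /\ forall x y, Rm (x, y) -> s x = y.
  apply: piso_max_bij; first by case: mR.
    by move=> x; apply: dom.
  by move=> y; apply: (dom (ptr Rm)) => //; apply: piso_max_tr.
exists s; last by move=> x y h; apply/sP/sub.
by split=> // x; apply: sP.
Qed.

(** If the minimal polynomial over the base field had degree above one, separability would give a
    second root [y], and the partial isomorphism taking [x] to [y] would extend to a Galois element
    moving [x]. *)
Lemma galois_fixed x : (forall s, in_galois_group iota s -> s x = x) ->
  exists a b, b != 0 /\ x = j a / j b.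
Proof.
move=> fx; have pB := pbase_piso jinj jinj.
have [p sp px] := scl.1 x.
have hp : prel (pbase j j) (map_poly iota p) (map_poly iota p).
  by move=> i; rewrite !coef_map; apply: pbase_frac.
have sp' : separable_poly (map_poly iota p) by rewrite separable_map.
have [n [n' [irr nx div]]] := prel_min_irr pB hp (separable_poly_neq0 sp') px.
have [hn sn _] := irr.
have en : n' = n.
  by apply/polyP => i; have [a [b [_ /= -> ->]]] := hn i.
have [S [S' [_ e _]]] := div _ _ hp px.
have sepn := separable_dvd sp' e.
have /factor_theorem[m em] := nx.
have m0 : m != 0 by apply: contraTneq sn => m0; rewrite em m0 mul0r size_poly0.
have [sm|sm] := leqP (size m) 1.
  have n0x : n`_1 * x + n`_0 = 0.
    move/rootP: nx; rewrite (@horner_coef_wide _ 2) ?big_ord_recl ?big_ord0 /=.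
      by rewrite addr0 expr0 mulr1 expr1 addrC.
    by rewrite em size_mul ?polyXsubC_eq0 // size_XsubC addn2.
  have n1 : n`_1 != 0.
    have s1 : size m = 1%N by apply/eqP; rewrite eqn_leq sm size_poly_gt0.
    have -> : n`_1 = lead_coef n.
      by rewrite lead_coefE em size_mul ?polyXsubC_eq0 // size_XsubC s1.
    by rewrite lead_coef_eq0 em mulf_neq0 ?polyXsubC_eq0.
  have Rx : pbase j j (x, x).
    have -> : x = - n`_0 / n`_1.
      by apply: (mulIf n1); rewrite divfK // mulrC; apply/eqP; rewrite -addr_eq0 n0x.
    have hn' i : pbase j j (n`_i, n`_i) by have := hn i; rewrite en.
    by apply: (piM pB); [apply: piN|apply: (piV pB)].
  by have [a [b [b0 /= e1 _]]] := Rx; exists a, b.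
have [y my] : exists y, root m y.
  by apply: scl.2 => //; apply: (separable_dvd sepn (s := 'X - x%:P)); rewrite em mulrC.
have ny : root n' y by rewrite en em rootM my.
have xy : y != x.
  apply: contraTneq my => ->.
  by move: sepn; rewrite em separable_mul coprimep_XsubC => /and3P[].
have [R' [pR' sub Rxy]] := piso_ext pB irr nx ny.
have [s gs sP] := galois_of_piso pR' sub.
by move: xy; rewrite -(sP _ _ Rxy) fx // eqxx.
Qed.

(** Irreducibility over the completion reaches the Galois group here: a factorization of [m'] over
    the range of [R] lifts to one of [m] over [C], so [m'] is irreducible over that range. *)
Lemma galois_trans (C : fieldType) (jC : {rmorphism A -> C}) (R : set (C * L))
    m m' x y : piso R -> (forall a, R (jC a, j a)) -> irreducible_poly m ->
  prel R m m' -> root m' x -> root m' y ->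
  exists2 s, in_galois_group iota s & (forall u v, R (u, v) -> s v = v) /\ s x = y.
Proof.
move=> pR bR [sm irr] hm mx my.
(* [Dl] is the identity of the range of [R]; an extension of it fixes this subfield pointwise. *)
pose Dl : set (L * L) := [set z | z.1 = z.2 /\ exists u, R (u, z.1)].
have pD : piso Dl.
  split; rewrite /Dl /=.
  - by split=> //; exists 1; apply: (pi1 pR).
  - move=> a b a' b' [<- [u hu]] [<- [v hv]]; split=> //.
    by exists (u - v); apply: (piB pR).
  - move=> a b a' b' [<- [u hu]] [<- [v hv]]; split=> //.
    by exists (u * v); apply: (piM pR).
  - by move=> a b [<- [u hu]]; split=> //; exists u^-1; apply: (piV pR).
  - by move=> b [].
  - by move=> b [].
have lift P Q : prel Dl P Q -> exists P0, prel R P0 P.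
  move=> h; pose f i := projT1 (cid (h i).2).
  have fP i : R (f i, P`_i) by rewrite /f; case: cid.
  exists (\poly_(i < size P) f i) => i; rewrite coef_poly.
  by case: ltnP => // hi; rewrite nth_default //; apply: pi0.
have irrD : prel_irr Dl m' m'.
  split; first by move=> i; split=> //; exists m`_i.
    by rewrite -(prel_size pR hm).
  move=> n n' s s' /lift[n0 hn] /lift[s0 hs] e.
  have em : m = n0 * s0.
    apply: (prel_uniq (ptr_piso pR) (P := m')) => //.
    by rewrite e; apply: (prelM (ptr_piso pR)).
  rewrite -(prel_size pR hn) -(prel_size pR hs).
  have [->|s1] := eqVneq (size n0) 1%N; first by left.
  right; have m0 : m != 0 by rewrite -size_poly_gt0 ltnW.
  have [n00 s00] : n0 != 0 /\ s0 != 0.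
    by apply/andP; move: m0; rewrite em mulf_eq0 negb_or.
  have := irr _ s1; rewrite em dvdp_mulr // => /(_ isT) /eqp_size.
  rewrite size_mul // => es; have := size_poly_gt0 s0; rewrite s00.
  by case: (size s0) es => // k; rewrite addnS /= -[LHS]addn0 => /addnI <-.
have [R' [pR' sub Rxy]] := piso_ext pD irrD mx my.
have [|s gs sP] := galois_of_piso pR'.
  move=> [a b] [u [v [v0 /= -> ->]]]; apply: sub; split=> //=.
  by exists (jC u / jC v); apply: (piM pR) => //; apply: (piV pR).
exists s => //; split=> [u v h|]; last exact: sP.
by apply: sP; apply: sub; split=> //; exists u.
Qed.

End Galois.

(** * Power series *)

Section PseriesRing.
Variable R : comNzRingType.
Local Notation O := (pseries R).
Implicit Types a b c : O.

Definition psX : O := PSeries (fun n => (n == 1%N)%:R).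
Definition psC (x : R) : O := PSeries (fun n => if n == 0%N then x else 0).
Definition pshift a : O := PSeries (fun n => pscoef a n.+1).
Definition pscong n a b := forall i, (i < n)%N -> pscoef a i = pscoef b i.

Lemma pscoef0 n : pscoef (0 : O) n = 0. Proof. by []. Qed.
Lemma pscoefD a b n : pscoef (a + b) n = pscoef a n + pscoef b n. Proof. by []. Qed.
Lemma pscoefB a b n : pscoef (a - b) n = pscoef a n - pscoef b n. Proof. by []. Qed.
Lemma pscoefM a b n :
  pscoef (a * b) n = \sum_(i < n.+1) pscoef a i * pscoef b (n - i).
Proof. by []. Qed.

Lemma pscoefCM x a n : pscoef (psC x * a) n = x * pscoef a n.
Proof.
rewrite pscoefM big_ord_recl /= subn0 big1 ?addr0 // => i _; by rewrite mul0r.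
Qed.

Fact psC_zmod : zmod_morphism psC.
Proof. by move=> x y; apply: pseriesP => -[|n] //=; rewrite subrr. Qed.
Fact psC_monoid : monoid_morphism psC.
Proof.
split=> [|x y]; first by apply: pseriesP => -[].
by apply: pseriesP => -[|n]; rewrite pscoefCM //= mulr0.
Qed.
HB.instance Definition _ := GRing.isZmodMorphism.Build R O psC psC_zmod.
HB.instance Definition _ := GRing.isMonoidMorphism.Build R O psC psC_monoid.

Definition ps0 a := pscoef a 0.
Fact ps0_zmod : zmod_morphism ps0. Proof. by []. Qed.
Fact ps0_monoid : monoid_morphism ps0.
Proof. by split=> // x y; rewrite /ps0 pscoefM big_ord_recl big_ord0 addr0. Qed.
HB.instance Definition _ := GRing.isZmodMorphism.Build O R ps0 ps0_zmod.
HB.instance Definition _ := GRing.isMonoidMorphism.Build O R ps0 ps0_monoid.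

Lemma pscoefXM a n : pscoef (psX * a) n = if n is n'.+1 then pscoef a n' else 0.
Proof.
case: n => [|n]; rewrite pscoefM; first by rewrite big_ord_recl big_ord0 /= mul0r addr0.
rewrite big_ord_recl /= mul0r add0r big_ord_recl /= mul1r subSS subn0.
by rewrite big1 ?addr0 // => i _; rewrite mul0r.
Qed.

Lemma ps0X : ps0 psX = 0. Proof. by []. Qed.
Lemma ps0C x : ps0 (psC x) = x. Proof. by []. Qed.

Lemma pscoefXnM a m n :
  pscoef (psX ^+ m * a) n = if (n < m)%N then 0 else pscoef a (n - m).
Proof.
elim: m n => [|m IH] n; first by rewrite expr0 mul1r subn0.
by rewrite exprS -mulrA pscoefXM; case: n => // n; rewrite IH.
Qed.

Lemma pshiftE a : a = psC (ps0 a) + psX * pshift a.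
Proof.
apply: pseriesP => -[|n]; rewrite pscoefD pscoefXM /= ?addr0 //.
by rewrite add0r.
Qed.

Lemma pscongP n a b : pscong n a b <-> exists c, a = b + psX ^+ n * c.
Proof.
split=> [h|[c ->] i lt]; last by rewrite pscoefD pscoefXnM lt addr0.
exists (PSeries (fun i => pscoef a (i + n) - pscoef b (i + n))).
apply: pseriesP => i; rewrite pscoefD pscoefXnM.
by case: ltnP => [/h ->|le]; rewrite ?addr0 //= subnK // addrC subrK.
Qed.

Lemma pscongD n a b a' b' :
  pscong n a b -> pscong n a' b' -> pscong n (a + a') (b + b').
Proof. by move=> h h' i lt; rewrite !pscoefD h ?h'. Qed.

Lemma pscongB n a b a' b' :
  pscong n a b -> pscong n a' b' -> pscong n (a - a') (b - b').
Proof. by move=> h h' i lt; rewrite !pscoefB h ?h'. Qed.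

Lemma pscongM n a b a' b' :
  pscong n a b -> pscong n a' b' -> pscong n (a * a') (b * b').
Proof.
move=> /pscongP[c ->] /pscongP[d ->]; apply/pscongP.
by exists (c * b' + b * d + psX ^+ n * c * d); ring.
Qed.

Lemma pscong_refl n a : pscong n a a. Proof. by []. Qed.

Lemma pscong_sym n a b : pscong n a b -> pscong n b a.
Proof. by move=> h i /h. Qed.

Lemma pscong_trans n a b c : pscong n a b -> pscong n b c -> pscong n a c.
Proof. by move=> h h' i lt; rewrite h // h'. Qed.

Lemma pscongX n a b m : pscong n a b -> pscong n (a ^+ m) (b ^+ m).
Proof.
move=> h; elim: m => [|m IH]; first by rewrite !expr0.
by rewrite !exprS; apply: pscongM.
Qed.

Lemma pscong_le m n a b : (m <= n)%N -> pscong n a b -> pscong m a b.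
Proof. by move=> le h i lt; apply: h; apply: leq_trans le. Qed.

Lemma pscong_eq a b : (forall n, pscong n a b) -> a = b.
Proof. by move=> h; apply: pseriesP => n; apply: (h n.+1). Qed.

Lemma pscongV n a b : a \is a GRing.unit -> b \is a GRing.unit ->
  pscong n a b -> pscong n a^-1 b^-1.
Proof.
move=> ua ub /pscongP[c e]; apply/pscongP; exists (- (c * a^-1 * b^-1)).
have -> : psX ^+ n * - (c * a^-1 * b^-1) = (b - a) * a^-1 * b^-1 by rewrite e; ring.
by rewrite !mulrBl divrr // mul1r mulrAC divrr // mul1r addrC subrK.
Qed.

(** A positive power of the uniformizer gains one digit of precision: this is the contraction
    estimate needed for [ps_fixpoint]. *)
Lemma pscongMX n m a b c : (0 < m)%N ->
  pscong n a b -> pscong n.+1 (psX ^+ m * c * a) (psX ^+ m * c * b).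
Proof.
case: m => // m _ /pscongP[d ->]; apply/pscongP.
by exists (psX ^+ m * c * d); rewrite !exprS; ring.
Qed.

Lemma ps0_dvd a : ps0 a = 0 -> a = psX * pshift a.
Proof. by move=> e; rewrite [LHS]pshiftE e rmorph0 add0r. Qed.

(** Contraction principle for the adic topology: digit [n] of the iterates of [0] is constant from
    iterate [n + 1] on. Inversion of units and lifting of roots go through it. *)
Lemma ps_fixpoint (Phi : O -> O) :
  (forall n a b, pscong n a b -> pscong n.+1 (Phi a) (Phi b)) ->
  exists a, Phi a = a.
Proof.
move=> h; pose s n := iter n Phi 0.
have hs n m : pscong n (s n) (s (n + m)%N).
  elim: n m => [|n IH] m //; rewrite addSn /s !iterS; apply: h; exact: IH.
pose a : O := PSeries (fun n => pscoef (s n.+1) n).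
have ha n : pscong n a (s n).
  by move=> i lt; have := hs i.+1 (n - i.+1)%N i (ltnSn i); rewrite subnKC.
exists a; apply: pseriesP => n; rewrite (ha n.+1) //.
by apply: (h n a (s n)).
Qed.

End PseriesRing.
Arguments ps0 {R} a : simpl never.
Arguments psC {R} x : simpl never.

Section PseriesMap.
Variables (R S : comNzRingType) (f : {rmorphism R -> S}).

Definition ps_map (a : pseries R) : pseries S := PSeries (fun n => f (pscoef a n)).

Fact ps_map_zmod : zmod_morphism ps_map.
Proof. by move=> a b; apply: pseriesP => n; apply: rmorphB. Qed.
Fact ps_map_monoid : monoid_morphism ps_map.
Proof.
split=> [|a b]; apply: pseriesP => n; first by rewrite /= rmorph_nat.
by rewrite /= rmorph_sum; apply: eq_bigr => i _; rewrite rmorphM.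
Qed.
HB.instance Definition _ :=
  GRing.isZmodMorphism.Build (pseries R) (pseries S) ps_map ps_map_zmod.
HB.instance Definition _ :=
  GRing.isMonoidMorphism.Build (pseries R) (pseries S) ps_map ps_map_monoid.
End PseriesMap.

Section PseriesField.
Variable k : fieldType.
Local Notation O := (pseries k).
Local Notation r := (psX k).
Implicit Types a b c : O.

Lemma ps_unitE a : (a \is a GRing.unit) = (ps0 a != 0).
Proof.
apply/idP/idP => [/(rmorph_unit (@ps0 k))|a0]; first by rewrite unitfE.
pose y := psC (ps0 a)^-1.
have ya : y * a = 1 + r * (y * pshift a).
  rewrite {1}[a]pshiftE mulrDr -rmorphM mulVf // rmorph1; by ring.
(* The fixed point satisfies [(1 + r y a') b = y] with [a'] the shift of [a], and the first factor
   equals [y a]. *)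
have [b hb] : exists b, y - r * (y * pshift a) * b = b.
  apply: ps_fixpoint => n b c h; apply: pscongB => //.
  by have := pscongMX (m := 1) (y * pshift a) isT h; rewrite expr1.
apply/unitrPr; exists (b * (1 : O)).
have : (1 + r * (y * pshift a)) * b = y by rewrite -[in RHS](subrK (r * (y * pshift a) * b) y) hb; ring.
rewrite -ya => e; rewrite mulr1.
have yu : y \is a GRing.unit.
  by apply/unitrPr; exists (psC (ps0 a)); rewrite -rmorphM mulVf // rmorph1.
by apply: (mulrI yu); rewrite mulrA e mulr1.
Qed.

Lemma ps_order a : a != 0 -> exists n u, ps0 u != 0 /\ a = r ^+ n * u.
Proof.
move=> a0.
have ex : exists n, pscoef a n != 0.
  apply: contrapT => h; move/eqP: a0; apply; apply: pseriesP => n.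
  by apply/eqP/negPn/negP => an; apply: h; exists n.
case: (ex_minnP ex) => n an min.
exists n, (PSeries (fun i => pscoef a (i + n))); split=> //.
apply: pseriesP => i; rewrite pscoefXnM; case: ltnP => [lt|le] /=.
  by apply/eqP/negPn/negP => /min; rewrite leqNgt lt.
by rewrite subnK.
Qed.

Lemma ps_Xn_reg n a : r ^+ n * a = 0 -> a = 0.
Proof.
move=> e; apply: pseriesP => i; have := congr1 (fun x => pscoef x (i + n)) e.
by rewrite pscoefXnM ltnNge leq_addl /= addnK.
Qed.

Fact ps_integral : GRing.integral_domain_axiom O.
Proof.
move=> a b e; have [//|a0] := eqVneq a 0.
have [n [u [u0 ea]]] := ps_order a0.
move: e; rewrite ea -mulrA => /ps_Xn_reg e; apply/eqP.
by apply: (mulrI (x := u)); rewrite ?ps_unitE // e mulr0.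
Qed.
HB.instance Definition _ := GRing.ComUnitRing_isIntegral.Build O ps_integral.

Lemma psX_neq0 : r != 0.
Proof. by apply/eqP => /(congr1 (fun x => pscoef x 1))/eqP; rewrite oner_eq0. Qed.

End PseriesField.

(** * The Eisenstein criterion over power series *)

Lemma irreducible_factor (K : fieldType) (p : {poly K}) : (1 < size p)%N ->
  (forall a b, p = a * b -> size a = 1%N \/ size b = 1%N) -> irreducible_poly p.
Proof.
move=> sp h; split=> // s s1 /dvdpP[t e].
case: (h _ _ e) => [/eqP/size_poly1P[c c0 ec]|e1]; last by rewrite e1 in s1.
by rewrite e ec mul_polyC eqp_sym eqp_scale.
Qed.

Section Eisenstein.
Variable k : fieldType.
Local Notation O := (pseries k).
Local Notation C := {fraction O}.
Local Notation r := (psX k).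
Local Notation toC := (@tofrac O).
Local Notation red := (map_poly (@ps0 k)).
Local Notation inC := (map_poly toC).

Lemma inC_inj : injective inC.
Proof. by apply: map_inj_poly; [move=> a b /eqP; rewrite tofrac_eq => /eqP|rewrite rmorph0]. Qed.

Lemma toC_unit u : ps0 u != 0 -> toC u^-1 = (toC u)^-1.
Proof.
move=> u0; have u0' : toC u != 0.
  by rewrite tofrac_eq0; apply: contraNneq u0 => ->; rewrite rmorph0.
by apply: (mulIf u0'); rewrite -rmorphM mulVr ?ps_unitE // mulVf // rmorph1.
Qed.

Lemma frac_order (x : C) : exists n a, x = toC a / toC r ^+ n.
Proof.
have [a [b [b0 ->]]] := fraction_div x.
have [n [u [u0 ->]]] := ps_order b0.
exists n, (a * u^-1); rewrite !rmorphM rmorphXn /= toC_unit // invfM.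
by rewrite -!mulrA; congr (_ * _); rewrite mulrC.
Qed.

Lemma poly_clear (Q : {poly C}) : exists n Q0, toC r ^+ n *: Q = inC Q0.
Proof.
elim/poly_ind: Q => [|Q c [n [Q0 e]]].
  by exists 0%N, 0; rewrite scaler0 rmorph0.
have [m [a ->]] := frac_order c.
exists (n + m)%N, (r ^+ m *: (Q0 * 'X) + (r ^+ n * a)%:P).
have rm0 : toC r ^+ m != 0 by rewrite expf_neq0 // tofrac_eq0 psX_neq0.
have ec : toC r ^+ (n + m) * (toC a / toC r ^+ m) = toC (r ^+ n * a).
  by rewrite exprD -mulrA [_ ^+ m * _]mulrCA divff // mulr1 rmorphM rmorphXn.
rewrite rmorphD /= map_polyZ [map_poly _ (Q0 * _)]rmorphM /= map_polyX map_polyC /=.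
rewrite -ec -e (polyCM (_ ^+ (n + m))) mul_polyC scalerDr; congr (_ + _).
by rewrite -scalerAl scalerA rmorphXn -exprD addnC.
Qed.

Lemma poly_content (Q : {poly O}) : Q != 0 ->
  exists n Q1, red Q1 != 0 /\ Q = r ^+ n *: Q1.
Proof.
move=> Q0.
pose S n := `[< exists i, pscoef Q`_i n != 0 >].
have ex : exists n, S n.
  apply: contrapT => h; move/eqP: Q0; apply; apply/polyP => i; rewrite coef0.
  apply: pseriesP => n; apply/eqP/negPn/negP => h'; apply: h; exists n.
  by apply/asboolP; exists i.
case: (ex_minnP ex) => n /asboolP[i0 i0n] min.
pose f i : O := PSeries (fun j => pscoef Q`_i (j + n)).
have c0 i : (\poly_(i < size Q) f i)`_i = f i.
  rewrite coef_poly; case: ltnP => // le.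
  by apply: (@pseriesP k) => j; rewrite /= nth_default.
exists n, (\poly_(i < size Q) f i); split.
  apply/eqP => /polyP /(_ i0); rewrite coef_map c0 coef0 => /eqP e.
  by move: i0n; rewrite -[pscoef _ _]/(ps0 (f i0)) e.
apply/polyP => i; rewrite coefZ c0; apply: pseriesP => j; rewrite pscoefXnM.
case: ltnP => [lt|le] /=; last by rewrite subnK.
apply/eqP/negPn/negP => h; have : S j by apply/asboolP; exists i.
by move/min; rewrite leqNgt lt.
Qed.

Lemma poly_primitive (Q : {poly C}) : Q != 0 ->
  exists (c : C) (Q1 : {poly O}), [/\ c != 0, red Q1 != 0 & Q = c *: inC Q1].
Proof.
move=> Q0; have [n [P e]] := poly_clear Q.
have rn0 m : toC r ^+ m != 0 by rewrite expf_neq0 // tofrac_eq0 psX_neq0.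
have P0 : P != 0.
  apply: contraNneq Q0 => P0; move/eqP: e; rewrite P0 rmorph0 scaler_eq0.
  by case/orP => // h; move: (rn0 n); rewrite h.
have [m [Q1 [h1 eP]]] := poly_content P0.
exists (toC r ^+ m / toC r ^+ n), Q1; split=> //.
  by apply: mulf_neq0; rewrite ?invr_eq0; apply: rn0.
apply: (scalerI (rn0 n)); rewrite e eP map_polyZ scalerA rmorphXn.
by rewrite mulrCA divff // mulr1.
Qed.

(** Gauss's lemma: both factors are made primitive, and their product stays primitive because a
    product of nonzero polynomials over [k] is nonzero. *)
Lemma gauss_factor (P : {poly O}) (Q S : {poly C}) : red P != 0 -> inC P = Q * S ->
  exists Q1 S1, [/\ P = Q1 * S1, size Q1 = size Q & size S1 = size S].
Proof.
move=> rP e.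
have P0 : P != 0 by apply: contraNneq rP => ->; rewrite rmorph0.
have QS0 : Q * S != 0 by rewrite -e -(rmorph0 inC) (inj_eq inC_inj).
have [Q0 S0] : Q != 0 /\ S != 0 by apply/andP; rewrite -negb_or -mulf_eq0.
have [c [Q1 [c0 rQ1 eQ]]] := poly_primitive Q0.
have [d [S1 [d0 rS1 eS]]] := poly_primitive S0.
have rn0 m : r ^+ m != 0 by rewrite expf_neq0 // psX_neq0.
have scI m : injective ( *:%R (r ^+ m) : {poly O} -> {poly O}).
  by move=> x y; rewrite /= -!mul_polyC; apply: mulfI; rewrite polyC_eq0 rn0.
have [n [a ea]] := frac_order (c * d).
have a0 : a != 0.
  apply: contraTneq (mulf_neq0 c0 d0) => a0.
  by rewrite ea a0 rmorph0 mul0r negbK.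
have [m [u [u0 eu]]] := ps_order a0.
have E : r ^+ n *: P = (r ^+ m * u) *: (Q1 * S1).
  apply: inC_inj; rewrite !map_polyZ [map_poly _ (Q1 * S1)]rmorphM /= e eQ eS.
  rewrite -scalerAl -scalerAr !scalerA -mulrA ea -eu mulrCA -rmorphXn divff ?mulr1 //.
  by rewrite tofrac_eq0 rn0.
have rQS : ps0 u *: red (Q1 * S1) != 0.
  by rewrite scaler_eq0 (negPf u0) rmorphM mulf_eq0 (negPf rQ1) (negPf rS1).
(* If the exponents differed, division by the smaller power of [r] followed by reduction would make
   a nonzero polynomial over [k] vanish. *)
have enm : n = m.
  apply/eqP; rewrite eqn_leq; apply/andP; split; rewrite leqNgt; apply/negP => lt.
    have : r ^+ (n - m) *: P = u *: (Q1 * S1).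
      apply: (scI m); rewrite !scalerA -exprD subnKC //; exact: ltnW.
    move/(congr1 red); rewrite !map_polyZ rmorphXn /= ps0X expr0n subn_eq0 leqNgt lt.
    by rewrite scale0r => /esym/eqP; rewrite (negPf rQS).
  have : P = (r ^+ (m - n) * u) *: (Q1 * S1).
    apply: (scI n); rewrite E !scalerA mulrA -exprD subnKC //; exact: ltnW.
  move/(congr1 red); rewrite map_polyZ /= rmorphM rmorphXn /= ps0X expr0n subn_eq0 leqNgt lt.
  by rewrite mul0r scale0r => /eqP; rewrite (negPf rP).
exists (u *: Q1), S1; split.
- apply: (scI n); rewrite E enm -scalerAl scalerA //.
- have un : u != 0 by apply: contraNneq u0 => ->; rewrite rmorph0.
  rewrite eQ !size_scale // size_map_inj_poly ?rmorph0 //.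
  by move=> x y /eqP; rewrite tofrac_eq => /eqP.
- rewrite eS !size_scale // size_map_inj_poly ?rmorph0 //.
  by move=> x y /eqP; rewrite tofrac_eq => /eqP.
Qed.

Lemma size_inC P : size (inC P) = size P.
Proof.
by rewrite size_map_inj_poly ?rmorph0 // => x y /eqP; rewrite tofrac_eq => /eqP.
Qed.

Lemma gauss_irreducible (P : {poly O}) : red P != 0 -> (1 < size P)%N ->
  (forall Q S, P = Q * S -> (1 < size Q)%N -> (1 < size S)%N -> False) ->
  irreducible_poly (inC P).
Proof.
move=> rP sP h; apply: irreducible_factor; first by rewrite size_inC.
move=> a b e; have [Q [S [eP sQ sS]]] := gauss_factor rP e.
have P0 : P != 0 by rewrite -size_poly_gt0 ltnW.
have [Q0 S0] : Q != 0 /\ S != 0.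
  by apply/andP; rewrite -negb_or -mulf_eq0 -eP.
rewrite -sQ -sS; case: (ltngtP (size Q) 1) => [|lQ|]; last by left.
  by rewrite ltnS leqn0 size_poly_eq0 (negPf Q0).
case: (ltngtP (size S) 1) => [|lS|]; last by right.
  by rewrite ltnS leqn0 size_poly_eq0 (negPf S0).
by case: (h _ _ eP).
Qed.

Lemma ps_coef1M (a b : O) : ps0 a = 0 -> ps0 b = 0 -> pscoef (a * b) 1 = 0.
Proof.
move=> a0 b0; rewrite pscoefM big_ord_recl big_ord_recl big_ord0 /=.
by rewrite subnn -[pscoef a 0]/(ps0 a) -[pscoef b 0]/(ps0 b) a0 b0 mul0r mulr0 !addr0.
Qed.

(** The reduction of [P] is a nonzero constant, so a factor of positive degree has its leading
    coefficient in the maximal ideal; with two such factors that of [P] would be divisible by the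
    square of the uniformizer. *)
Lemma eisenstein_rev (P : {poly O}) : (1 < size P)%N -> ps0 P`_0 != 0 ->
  (forall i, ps0 P`_i.+1 = 0) -> pscoef (lead_coef P) 1 != 0 ->
  irreducible_poly (inC P).
Proof.
move=> sP P0 Pi lP.
have eP : red P = (ps0 P`_0)%:P.
  by apply/polyP => -[|i]; rewrite coef_map coefC /=.
apply: gauss_irreducible => //; first by rewrite eP polyC_eq0.
move=> Q S e sQ sS; have /eqP : size (red Q * red S) = 1%N.
  by rewrite (_ : _ * _ = (ps0 P`_0)%:P) ?size_polyC ?P0 // -eP e rmorphM.
rewrite size_mul_eq1 => /andP[/eqP rQ /eqP rS].
have l0 (U : {poly O}) : (1 < size U)%N -> size (red U) = 1%N -> ps0 (lead_coef U) = 0.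
  move=> sU rU; rewrite lead_coefE -[LHS](coef_map (@ps0 k)) nth_default // rU.
  by case: (size U) sU => // -[].
by move/eqP: lP; apply; rewrite e lead_coefM; apply: ps_coef1M; apply: l0.
Qed.

(** Both factors reduce to scalar multiples of powers of the variable, so both constant terms lie in
    the maximal ideal, against the order one of the constant term of [P]. *)
Lemma eisenstein (P : {poly O}) n : P \is monic -> size P = n.+2 ->
  red P = 'X^(n.+1) -> pscoef P`_0 1 != 0 -> irreducible_poly (inC P).
Proof.
move=> mP sP rP P0.
apply: gauss_irreducible; rewrite ?rP ?sP ?monic_neq0 ?monicXn //.
move=> Q S e sQ sS.
have rQS : red Q * red S = 'X^(n.+1) by rewrite -rP e rmorphM.
have l1 : ps0 (lead_coef Q) * ps0 (lead_coef S) = 1.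
  by rewrite -rmorphM -lead_coefM -e (monicP mP) rmorph1.
have [lQ lS] : ps0 (lead_coef Q) != 0 /\ ps0 (lead_coef S) != 0.
  by apply/andP; rewrite -negb_or -mulf_eq0 l1 oner_eq0.
have c0 (U : {poly O}) : (1 < size U)%N -> ps0 (lead_coef U) != 0 ->
    red U %| 'X^(n.+1) -> ps0 U`_0 = 0.
  move=> sU lU; rewrite -['X]subr0 -polyC0 => /dvdp_exp_XsubCP[i _ eU].
  have := eqp_size eU; rewrite size_exp_XsubC size_map_poly_id0 // => ei.
  have : root (red U) 0.
    have i0 : (0 < i)%N by rewrite -ltnS -ei.
    rewrite (eqp_root eU) /root horner_exp hornerXsubC subrr expr0n.
    by case: i i0 {eU ei}.
  by rewrite /root horner_coef0 coef_map => /eqP.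
by move/eqP: P0; apply; rewrite e coef0M; apply: ps_coef1M; apply: c0 => //;
  rewrite -rQS ?dvdp_mulIl ?dvdp_mulIr.
Qed.

End Eisenstein.

(** * Factorization of Drinfeld modules *)

Section Frobenius.
Variables (Fq : finFieldType) (R : comNzRingType) (kap : {rmorphism Fq -> R}).
Local Notation q := #|Fq|.

Lemma pchar_card : [pchar R].-nat q.
Proof.
have [p pr_p pcharFp] := finPcharP Fq.
have pR : p \in [pchar R].
  by rewrite inE pr_p -(rmorph_nat kap) pcharf0 // rmorph0 eqxx.
rewrite (eq_pnat _ (pcharf_eq pR)) -cardsT.
exact: abelem_pgroup (fin_ring_pchar_abelem pcharFp).
Qed.

Lemma frobD (x y : R) : (x + y) ^+ q = x ^+ q + y ^+ q.
Proof. by rewrite exprDn_pchar ?pchar_card. Qed.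

Lemma frobN (x : R) : (- x) ^+ q = - x ^+ q.
Proof. by rewrite exprNn_pchar ?pchar_card. Qed.

Lemma frobB (x y : R) : (x - y) ^+ q = x ^+ q - y ^+ q.
Proof. by rewrite frobD frobN. Qed.

Lemma frob_kap c : kap c ^+ q = kap c.
Proof. by rewrite -rmorphXn expf_card. Qed.

(** Thanks to it the derivative of an additive polynomial is its linear coefficient, the source of
    separability below. *)
Lemma card_natr : q%:R = 0 :> R.
Proof.
have [p pr_p pcharFp] := finPcharP Fq.
rewrite -(rmorph_nat kap).
suff /dvdnP[m ->] : (p %| q)%N by rewrite natrM (pcharf0 pcharFp) mulr0 rmorph0.
have := abelem_pgroup (fin_ring_pchar_abelem pcharFp); rewrite /pgroup cardsT.
have q1 := finNzRing_gt1 Fq.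
move/pnatP => /(_ (ltnW q1) _ (pdiv_prime q1) (pdiv_dvd _)).
by rewrite inE => /eqP <-; apply: pdiv_dvd.
Qed.
End Frobenius.

(** The elements of [Fq] already exhaust the roots of [X^q - X]. *)
Lemma frob_fixed (Fq : finFieldType) (L : fieldType) (kap : {rmorphism Fq -> L}) x :
  x ^+ #|Fq| = x -> exists c, x = kap c.
Proof.
move=> e; have := congr1 (map_poly kap) (finField_genPoly Fq).
rewrite rmorphB /= map_polyXn map_polyX rmorph_prod.
move/(congr1 (horner^~ x)); rewrite hornerD hornerN hornerXn hornerX e subrr.
rewrite horner_prod => /esym/eqP/prodf_eq0[c _].
rewrite rmorphB /= map_polyX map_polyC hornerXsubC subr_eq0 => /eqP ->.
by exists c.
Qed.

Section Operators.
Variables (Fq : finFieldType) (R : idomainType) (kap : {rmorphism Fq -> R}).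
Local Notation q := #|Fq|.

Definition opD (T g1 g2 x : R) := T * x + g1 * x ^+ q + g2 * (x ^+ q) ^+ q.
Definition opE (u x : R) := x ^+ q + u * x.
Definition opF (c g x : R) := c * x + g * x ^+ q.

(** The two composites run in opposite orders: [opEE u n] is [E_(n-1) o ... o E_0], while
    [opFF c g n] is [F_0 o ... o F_(n-1)], so that the second can follow the first. *)
Fixpoint opEE (u : nat -> R) n x := if n is n'.+1 then opE (u n') (opEE u n' x) else x.
Fixpoint opFF (c g : nat -> R) n x :=
  if n is n'.+1 then opFF c g n' (opF (c n') (g n') x) else x.

Lemma opD_B T g1 g2 x y : opD T g1 g2 (x - y) = opD T g1 g2 x - opD T g1 g2 y.
Proof. by rewrite /opD !(frobB kap); ring. Qed.
Lemma opD_Z T g1 g2 c x : opD T g1 g2 (kap c * x) = kap c * opD T g1 g2 x.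
Proof. by rewrite /opD !exprMn !frob_kap; ring. Qed.
Lemma opD0 T g1 g2 : opD T g1 g2 0 = 0.
Proof. by have := opD_B T g1 g2 0 0; rewrite !subrr. Qed.
Lemma opD_D T g1 g2 x y : opD T g1 g2 (x + y) = opD T g1 g2 x + opD T g1 g2 y.
Proof. by rewrite /opD !(frobD kap); ring. Qed.

Lemma opE_B u x y : opE u (x - y) = opE u x - opE u y.
Proof. by rewrite /opE !(frobB kap); ring. Qed.
Lemma opE_Z u c x : opE u (kap c * x) = kap c * opE u x.
Proof. by rewrite /opE !exprMn !frob_kap; ring. Qed.

Lemma opEE_B u n x y : opEE u n (x - y) = opEE u n x - opEE u n y.
Proof. by elim: n => //= n ->; rewrite opE_B. Qed.
Lemma opEE_Z u n c x : opEE u n (kap c * x) = kap c * opEE u n x.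
Proof. by elim: n => //= n ->; rewrite opE_Z. Qed.
Lemma opEE0 u n : opEE u n 0 = 0.
Proof. by have := opEE_B u n 0 0; rewrite !subrr. Qed.
Lemma opEE_D u n x y : opEE u n (x + y) = opEE u n x + opEE u n y.
Proof.
have -> : x + y = x - (0 - y) by rewrite sub0r opprK.
by rewrite !opEE_B opEE0 sub0r opprK.
Qed.

Lemma opF_B c g x y : opF c g (x - y) = opF c g x - opF c g y.
Proof. by rewrite /opF !(frobB kap); ring. Qed.
Lemma opF0 c g : opF c g 0 = 0.
Proof. by have := opF_B c g 0 0; rewrite !subrr. Qed.
Lemma opFF0 c g n : opFF c g n 0 = 0.
Proof. by elim: n => //= n IH; rewrite opF0. Qed.

(* [E_i = x^q + u_i x] and [F_i = c_i x + g2_i x^q] satisfy [F_i o E_i = D_i] and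
   [E_i o F_i = D_(i+1)]: the successive quotients by the kernels of the [E_i]. *)
Record dfact (T : R) (g1 g2 u c : nat -> R) : Prop := Dfact {
  dfT : forall i, c i * u i = T;
  dfg : forall i, c i + g2 i * u i ^+ q = g1 i;
  dfg1 : forall i, g1 i.+1 = c i ^+ q + u i * g2 i;
  dfg2 : forall i, g2 i.+1 = g2 i ^+ q }.

Section Factor.
Variables (T : R) (g1 g2 u c : nat -> R).
Hypothesis df : dfact T g1 g2 u c.
Let D i := opD T (g1 i) (g2 i).

Lemma opFE i x : opF (c i) (g2 i) (opE (u i) x) = D i x.
Proof.
rewrite /opF /opE /D /opD (frobD kap) -(dfg df) -(dfT df i) exprMn; ring.
Qed.

Lemma opEF i x : opE (u i) (opF (c i) (g2 i) x) = D i.+1 x.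
Proof.
rewrite /opF /opE /D /opD (frobD kap) (dfg1 df) (dfg2 df) -(dfT df i) !exprMn; ring.
Qed.

(** The composite of the [E_i] is an isogeny from [D_0] to [D_n], by
    [E_i D_i = E_i F_i E_i = D_(i+1) E_i]. *)
Lemma opEE_opD n x : opEE u n (D 0 x) = D n (opEE u n x).
Proof. by elim: n => //= n ->; rewrite -opFE opEF. Qed.

Lemma opEE_iter n i x : opEE u n (iter i (D 0) x) = iter i (D n) (opEE u n x).
Proof. by elim: i => //= i IH; rewrite opEE_opD IH. Qed.

(** One factor [D_0] is carried past the composite of the [E_i], becomes [D_n], and is split there
    as [F_n o E_n]. *)
Lemma iter_opD n x : iter n (D 0) x = opFF c g2 n (opEE u n x).
Proof.
elim: n x => //= n IH x; rewrite -iterS iterSr IH opEE_opD opFE //.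
Qed.
End Factor.

Fixpoint polyEE (u : nat -> R) n : {poly R} :=
  if n is n'.+1 then polyEE u n' ^+ q + u n' *: polyEE u n' else 'X.

Lemma polyEE_horner u n x : (polyEE u n).[x] = opEE u n x.
Proof.
elim: n => [|n IH] /=; first by rewrite hornerX.
by rewrite hornerD horner_exp hornerZ IH.
Qed.

Lemma polyEE_size u n : polyEE u n \is monic /\ size (polyEE u n) = (q ^ n).+1.
Proof.
have q1 : (1 < q)%N := finNzRing_gt1 Fq.
elim: n => [|n [mon sz]] /=; first by rewrite monicX size_polyX.
have mq : polyEE u n ^+ q \is monic by rewrite monic_exp.
have sq : size (polyEE u n ^+ q) = (q ^ n.+1).+1.
  rewrite -[LHS]prednK ?size_poly_gt0 ?monic_neq0 // size_exp sz /=.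
  by rewrite mulnC -expnS.
have lt : (size (u n *: polyEE u n)%R < size (polyEE u n ^+ q)%R)%N.
  rewrite sq (leq_ltn_trans (size_scale_leq _ _)) // sz ltnS ltn_exp2l //.
by split; rewrite ?monicE ?lead_coefDl ?size_polyDl // -?monicE ?sq.
Qed.

Lemma polyEE_deriv u n : deriv (polyEE u n) = (\prod_(i < n) u i)%:P.
Proof.
elim: n => [|n IH] /=; first by rewrite derivX big_ord0.
rewrite derivD derivZ IH deriv_exp -mulr_natr -polyC_natr (card_natr kap).
by rewrite polyC0 mulr0 add0r big_ord_recr /= mulrC polyCM mul_polyC.
Qed.

Lemma polyEE_coef0 u n : (polyEE u n)`_0 = 0.
Proof. by rewrite -horner_coef0 polyEE_horner opEE0. Qed.

End Operators.

Section OperatorsMap.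
Variables (Fq : finFieldType) (R S : idomainType) (f : {rmorphism R -> S}).

Lemma rmorph_opD T g1 g2 x :
  f (opD Fq T g1 g2 x) = opD Fq (f T) (f g1) (f g2) (f x).
Proof. by rewrite /opD !rmorphD !rmorphM !rmorphXn. Qed.

Lemma rmorph_opE u x : f (opE Fq u x) = opE Fq (f u) (f x).
Proof. by rewrite /opE rmorphD rmorphM rmorphXn. Qed.

Lemma rmorph_opEE u n x : f (opEE Fq u n x) = opEE Fq (f \o u) n (f x).
Proof. by elim: n => //= n IH; rewrite rmorph_opE IH. Qed.

Lemma map_polyEE u n : map_poly f (polyEE Fq u n) = polyEE Fq (f \o u) n.
Proof.
elim: n => [|n IH] /=; first by rewrite map_polyX.
by rewrite rmorphD rmorphXn /= map_polyZ IH.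
Qed.
End OperatorsMap.

Lemma separable_deriv (K : fieldType) (p : {poly K}) c :
  deriv p = c%:P -> c != 0 -> separable_poly p.
Proof.
move=> e c0; rewrite separable_poly.unlock e -[c%:P]mulr1 mul_polyC.
by rewrite (eqp_coprimepr _ (eqp_scale 1 c0)) coprimep1.
Qed.

(** * Hensel lifting and the ordinary factorization *)

Section Hensel.
Variables (Fq : finFieldType) (k : fieldType) (kap : {rmorphism Fq -> k}).
Local Notation q := #|Fq|.
Local Notation O := (pseries k).
Local Notation r := (psX k).

Definition kapO x : O := psC (kap x).
Fact kapO_zmod : zmod_morphism kapO.
Proof. by move=> a b; rewrite /kapO !rmorphB. Qed.
Fact kapO_monoid : monoid_morphism kapO.
Proof. by split=> [|a b]; rewrite /kapO ?rmorph1 // !rmorphM. Qed.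
HB.instance Definition _ := GRing.isZmodMorphism.Build Fq O kapO kapO_zmod.
HB.instance Definition _ := GRing.isMonoidMorphism.Build Fq O kapO kapO_monoid.

(** [ps0 al] is the derivative of the additive polynomial modulo [r], so every root modulo [r] is
    simple. *)
Lemma hensel (al be ga y : O) (a : k) : ps0 al != 0 ->
  opD Fq (ps0 al) (ps0 be) (ps0 ga) a = ps0 y ->
  exists2 x, ps0 x = a & opD Fq al be ga x = y.
Proof.
move=> al0 e; have q1 : (1 < q)%N := finNzRing_gt1 Fq.
pose s := psC a.
have e0 : ps0 (y - opD Fq al be ga s) = 0.
  by rewrite rmorphB /= (rmorph_opD Fq (@ps0 k)) /= /s ps0C e subrr.
have alu : al \is a GRing.unit by rewrite ps_unitE.
pose y' := pshift (y - opD Fq al be ga s).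
(* With [x = a + r b], the equation divided by [r] is linear in [b] up to terms carrying [r^(q-1)]
   and [r^(q^2-1)], hence a contraction. *)
have [b hb] : exists b, al^-1 * (y' - r ^+ q.-1 * be * b ^+ q
     - r ^+ (q * q).-1 * ga * (b ^+ q) ^+ q) = b.
  apply: ps_fixpoint => n b c h; apply: pscongM; first exact: pscong_refl.
  have q0 : (0 < q.-1)%N by case: (q) q1 => [|[]].
  have qq0 : (0 < (q * q).-1)%N by case: (q) q1 => [|[|m]].
  apply: pscongB; last by apply: (pscongMX ga qq0); do 2!apply: pscongX; exact: h.
  apply: pscongB; first exact: pscong_refl.
  by apply: (pscongMX be q0); apply: pscongX; exact: h.
exists (s + r * b); first by rewrite rmorphD rmorphM /= ps0X mul0r addr0 ps0C.
rewrite (opD_D kapO); apply/eqP; rewrite addrC eq_sym -subr_eq; apply/eqP.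
rewrite (ps0_dvd e0) -/y'.
have {}hb : al * b = y' - r ^+ q.-1 * be * b ^+ q - r ^+ (q * q).-1 * ga * (b ^+ q) ^+ q.
  by rewrite -[in LHS]hb mulVKr.
have -> : y' = al * b + r ^+ q.-1 * be * b ^+ q + r ^+ (q * q).-1 * ga * (b ^+ q) ^+ q.
  by rewrite hb; ring.
have q0 : (0 < q)%N := ltnW q1.
have e1 : r ^+ q = r * r ^+ q.-1 by rewrite -exprS prednK.
have e2 : (r ^+ q) ^+ q = r * r ^+ (q * q).-1.
  by rewrite -exprM -exprS prednK // muln_gt0 q0.
by rewrite /opD !exprMn e2 e1; ring.
Qed.

(** [v] solves [v = t / (g - h v^q)], a contraction because [r] divides [h]. *)
Lemma ordinary_fixpoint (g h t : O) : ps0 g != 0 -> ps0 h = 0 ->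
  exists v c, [/\ ps0 c != 0, c = g - h * v ^+ q & c * v = t].
Proof.
move=> g0 h0.
have un v : ps0 (g - h * v ^+ q) != 0 by rewrite rmorphB rmorphM /= h0 mul0r subr0.
have unU v : g - h * v ^+ q \is a GRing.unit by rewrite ps_unitE.
have [v hv] : exists v, t * (g - h * v ^+ q)^-1 = v.
  apply: ps_fixpoint => n a b hab; apply: pscongM; first exact: pscong_refl.
  have hc : pscong n.+1 (g - h * a ^+ q) (g - h * b ^+ q).
    apply: pscongB; first exact: pscong_refl.
    rewrite (ps0_dvd h0) -[r]expr1.
    by apply: (pscongMX (pshift h) (ltn0Sn 0)); apply: pscongX; exact: hab.
  exact: pscongV (unU a) (unU b) hc.
exists v, (g - h * v ^+ q); split=> //.
by rewrite -[in X in _ * X]hv mulrCA divrr // mulr1.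
Qed.

(** Eliminating the second unknown leaves [u (g1 - g2 u^q) = T]. When [r] divides [T] the solution
    is sought as [u = r v]; when [r] divides [g2] the equation contracts as it stands. These cases
    serve the ordinary and the degenerate place. *)
Lemma ordinary_factor (T g1 g2 : O) : ps0 g1 != 0 -> ps0 T * ps0 g2 = 0 ->
  exists uc : O * O, [/\ ps0 uc.2 != 0, uc.2 * uc.1 = T
     & uc.2 + g2 * uc.1 ^+ q = g1].
Proof.
move=> g10 /eqP; rewrite mulf_eq0 => /orP[/eqP T0|/eqP g20].
  have [||v [c [c0 ec ev]]] := @ordinary_fixpoint g1 (g2 * r ^+ q) (pshift T) => //.
    rewrite rmorphM rmorphXn /= ps0X expr0n; case: (q) (finNzRing_gt1 Fq) => // n _.
    by rewrite mulr0.
  exists (r * v, c); split=> //=; first by rewrite mulrCA ev -ps0_dvd.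
  by rewrite {1}ec exprMn; ring.
have [v [c [c0 ec ev]]] := @ordinary_fixpoint g1 g2 T g10 g20.
by exists (v, c); split=> //=; rewrite {1}ec subrK.
Qed.

(** The hypotheses persist from one index to the next: [c] is a unit and [c u g2 = T g2] vanishes
    modulo [r], so the next [g1] is congruent to [c^q]. *)
Lemma ordinary_dfact (T g1 g2 : O) : ps0 g1 != 0 -> ps0 T * ps0 g2 = 0 ->
  exists G1 G2 u c, [/\ dfact Fq T G1 G2 u c, G1 0 = g1, G2 0 = g2 &
    forall i, ps0 (c i) != 0].
Proof.
move=> g10 Tg2.
pose ok (g : O * O) := ps0 g.1 != 0 /\ ps0 T * ps0 g.2 = 0.
(* The value [(0, 0)] is a dummy for pairs violating [ok]; the orbit [G] stays inside [ok]. *)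
have ex (g : O * O) : exists uc : O * O, ok g ->
    [/\ ps0 uc.2 != 0, uc.2 * uc.1 = T & uc.2 + g.2 * uc.1 ^+ q = g.1].
  have [[h1 h2]|h] := pselect (ok g); last by exists (0, 0).
  by have [uc huc] := ordinary_factor h1 h2; exists uc.
have [f fP] := choice ex.
pose st (g : O * O) := ((f g).2 ^+ q + (f g).1 * g.2, g.2 ^+ q).
have q0 : (q == 0)%N = false by case: (q) (finNzRing_gt1 Fq).
have okS g : ok g -> ok (st g).
  move=> og; have [c0 cu _] := fP _ og; have [h1 h2] := og; split=> /=.
    have -> : ps0 ((f g).2 ^+ q + (f g).1 * g.2) = ps0 (f g).2 ^+ q.
      rewrite rmorphD rmorphXn rmorphM /=; apply/eqP; rewrite addrC -subr_eq0 addrK.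
      apply/eqP/(mulfI c0); rewrite mulr0 mulrA -rmorphM /= cu //.
    by rewrite expf_neq0.
  rewrite rmorphXn /=; move/eqP: h2; rewrite mulf_eq0 => /orP[] /eqP ->.
    by rewrite mul0r.
  by rewrite expr0n q0 mulr0.
pose G i := iter i st (g1, g2).
have okG i : ok (G i) by elim: i => [|i IH] //=; apply: okS.
exists (fun i => (G i).1), (fun i => (G i).2), (fun i => (f (G i)).1),
  (fun i => (f (G i)).2); split=> //; last by move=> i; case: (fP _ (okG i)).
by split=> i //=; case: (fP _ (okG i)).
Qed.

End Hensel.

Section ClosedRoots.
Variables (Fq : finFieldType) (k : closedFieldType) (kap : {rmorphism Fq -> k}).
Local Notation q := #|Fq|.

Lemma closed_opD (al be ga y : k) : al != 0 -> exists a : k, opD Fq al be ga a = y.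
Proof.
move=> al0; have q1 : (1 < q)%N := finNzRing_gt1 Fq.
pose p : {poly k} := al *: 'X + be *: 'X^q + ga *: 'X^(q * q) - y%:P.
have p1 : p`_1 = al.
  rewrite /p !coefB !coefD !coefZ coefX !coefXn coefC /= mulr1.
  have -> : (1 == q)%N = false by case: (q) q1 => // -[].
  have -> : (1 == q * q)%N = false by case: (q) q1 => // -[].
  by rewrite !mulr0 !addr0 subr0.
have /closed_rootP[a] : size p != 1%N.
  apply/eqP => sp; move: al0; rewrite -p1 nth_default ?eqxx //; by rewrite sp.
rewrite /root /p !hornerE subr_eq0 => /eqP e.
by exists a; rewrite /opD -exprM.
Qed.

Lemma closed_opF (al be : k) : al != 0 -> be != 0 ->
  exists2 a : k, a != 0 & opF Fq al be a = 0.
Proof.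
move=> al0 be0; have q1 : (1 < q)%N := finNzRing_gt1 Fq.
pose p : {poly k} := 'X^(q.-1) + (al / be)%:P.
have q0 : (0 < q.-1)%N by case: (q) q1 => // -[].
have /closed_rootP[a] : size p != 1%N by rewrite size_XnaddC //; case: (q.-1) q0.
rewrite /root /p hornerD hornerXn hornerC addr_eq0 => /eqP e.
exists a.
  apply/eqP => a0; move/eqP: e; rewrite a0 expr0n; case: (q.-1) q0 => // n _ /=.
  by rewrite eq_sym oppr_eq0 mulf_eq0 invr_eq0 (negPf al0) (negPf be0).
rewrite /opF -(prednK (n := q)) ?(ltnW q1) // exprS e; field.
exact: be0.
Qed.

End ClosedRoots.

(** * Comparing a completion with the separable closure *)

Lemma irreducible_scale (K : fieldType) (c : K) (p : {poly K}) : c != 0 ->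
  irreducible_poly (c *: p) -> irreducible_poly p.
Proof.
move=> c0 [sp irr]; split; first by rewrite size_scale in sp.
move=> s s1 sp'; have e := eqp_scale p c0.
by rewrite -(eqp_rtrans e) irr // dvdpZr.
Qed.

Lemma fq_linear_sum (Fq : finFieldType) (R : idomainType) (kap : {rmorphism Fq -> R})
    (f : R -> R) (b : nat -> Fq) (x : nat -> R) n :
  f 0 = 0 -> {morph f : x y / x + y} -> (forall c x, f (kap c * x) = kap c * f x) ->
  f (\sum_(i < n) kap (b i) * x i) = \sum_(i < n) kap (b i) * f (x i).
Proof. by move=> f0 fD fZ; rewrite (big_morph f fD f0); apply: eq_bigr => i _. Qed.

Section IterD.
Variables (Fq : finFieldType) (R : idomainType) (kap : {rmorphism Fq -> R}).
Variables (T g1 g2 : R).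
Local Notation D := (opD Fq T g1 g2).

Lemma iterD0 n : iter n D 0 = 0.
Proof. by elim: n => //= n ->; rewrite (opD0 kap). Qed.
Lemma iterD_D n : {morph iter n D : x y / x + y}.
Proof. by move=> x y; elim: n => //= n ->; rewrite (opD_D kap). Qed.
Lemma iterD_Z n c x : iter n D (kap c * x) = kap c * iter n D x.
Proof. by elim: n => //= n ->; rewrite (opD_Z kap). Qed.

(** Truncated subtraction is harmless: past level [0] both sides are [0]. *)
Lemma iterD_seq (e : nat -> R) : e 0 = 0 -> (forall n, D (e n.+1) = e n) ->
  forall i n, iter i D (e n) = e (n - i)%N.
Proof.
move=> e0 eS; elim=> [|i IH] n; first by rewrite subn0.
rewrite iterS IH; case: (leqP n i) => [le|lt].
  have -> : (n - i = 0)%N by apply/eqP; rewrite subn_eq0.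
  have -> : (n - i.+1 = 0)%N by apply/eqP; rewrite subn_eq0 leqW.
  by rewrite e0 (opD0 kap).
by rewrite -(subnSK lt) eS.
Qed.

Lemma iterD_comb (e : nat -> R) (b : nat -> Fq) n :
  e 0 = 0 -> (forall n, D (e n.+1) = e n) ->
  iter n D (\sum_(i < n) kap (b i) * e (n - i)%N) = 0.
Proof.
move=> e0 eS; rewrite (fq_linear_sum b (fun i => e (n - i)%N) n (iterD0 n) (iterD_D n) (iterD_Z n)).
rewrite big1 // => i _; rewrite (iterD_seq e0 eS).
have -> : (n - i - n = 0)%N by apply/eqP; rewrite subn_eq0 leq_subr.
by rewrite e0 mulr0.
Qed.
End IterD.

(** * Completions at places and transfer of solutions *)

Section Embedding.
Variables (Fq : finFieldType) (k : fieldType) (kap : {rmorphism Fq -> k}).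
Variables (c : Fq) (m : nat).
Local Notation O := (pseries k).
Local Notation r := (psX k).
Local Notation A := {poly Fq}.

(** The completion at the place [T = c] with coefficients extended to [k], ramified so that
    [r^m = T - c]. *)
Definition jO (a : A) : O := (map_poly (kapO kap) a).[kapO kap c + r ^+ m].

Fact jO_zmod : zmod_morphism jO.
Proof. by move=> a b; rewrite /jO rmorphB hornerD hornerN. Qed.
Fact jO_monoid : monoid_morphism jO.
Proof. by split=> [|a b]; rewrite /jO ?rmorph1 ?hornerC // rmorphM hornerM. Qed.
HB.instance Definition _ := GRing.isZmodMorphism.Build A O jO jO_zmod.
HB.instance Definition _ := GRing.isMonoidMorphism.Build A O jO jO_monoid.

Lemma jOX : jO 'X = kapO kap c + r ^+ m.
Proof. by rewrite /jO map_polyX hornerX. Qed.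

Lemma jOC x : jO x%:P = kapO kap x.
Proof. by rewrite /jO map_polyC hornerC. Qed.

Lemma jOXc : jO ('X - c%:P) = r ^+ m.
Proof. by rewrite rmorphB /= jOX jOC addrAC subrr add0r. Qed.

Lemma ps0_jO a : (0 < m)%N -> ps0 (jO a) = kap a.[c].
Proof.
move=> m0; rewrite /jO -(horner_map (@ps0 k)) /= -map_poly_comp /=.
rewrite (rmorphD (@ps0 k)) (rmorphXn (@ps0 k)) /= ps0X expr0n eqn0Ngt m0 addr0 ps0C.
by rewrite -(horner_map kap); congr (_.[_]); apply: eq_map_poly => x.
Qed.

Lemma jO_inj : (0 < m)%N -> injective jO.
Proof.
move=> m0; suff H a : jO a = 0 -> a = 0.
  by move=> x y e; apply/subr0_eq/H; rewrite rmorphB /= e subrr.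
apply: contra_eq => a0.
have [e [b + ->]] := multiplicity_XsubC a c; rewrite a0 /= => bc.
rewrite rmorphM rmorphXn /= jOXc mulf_neq0 //; last by rewrite !expf_neq0 // psX_neq0.
apply: contraNneq bc => jb; rewrite /root.
by have := ps0_jO b m0; rewrite jb (rmorph0 (@ps0 k)) => /esym/eqP; rewrite fmorph_eq0.
Qed.
End Embedding.

Section Transfer.
Variables (Fq : finFieldType) (C L : fieldType).
Variable kL : {rmorphism Fq -> L}.
Variable R : set (C * L).
Hypothesis mR : piso_max R.
Hypothesis cL : separably_closed L.
Let pR : piso R := mR.1.
Local Notation q := #|Fq|.

Lemma piso_opD T g1 g2 x T' g1' g2' x' : R (T, T') -> R (g1, g1') -> R (g2, g2') ->
  R (x, x') -> R (opD Fq T g1 g2 x, opD Fq T' g1' g2' x').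
Proof.
move=> hT h1 h2 hx; apply: (piD pR); first apply: (piD pR).
- exact: (piM pR).
- by apply: (piM pR) => //; apply: (piX pR).
- by apply: (piM pR) => //; do 2!apply: (piX pR).
Qed.

Lemma piso_opF c g x c' g' x' : R (c, c') -> R (g, g') ->
  R (x, x') -> R (opF Fq c g x, opF Fq c' g' x').
Proof.
move=> hT h1 hx; apply: (piD pR); first exact: (piM pR).
by apply: (piM pR) => //; apply: (piX pR).
Qed.

Lemma piso_opEE u u' n x x' : (forall i, R (u i, u' i)) -> R (x, x') ->
  R (opEE Fq u n x, opEE Fq u' n x').
Proof.
move=> hu hx; elim: n => //= n IH; apply: (piD pR); first exact: (piX pR).
exact: (piM pR).
Qed.

Lemma piso_opFF c c' g g' n x x' : (forall i, R (c i, c' i)) ->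
  (forall i, R (g i, g' i)) -> R (x, x') -> R (opFF Fq c g n x, opFF Fq c' g' n x').
Proof.
by move=> hc hg; elim: n x x' => //= n IH x x' hx; apply/IH/piso_opF.
Qed.

Lemma prel_polyEE u u' n : (forall i, R (u i, u' i)) ->
  prel R (polyEE Fq u n) (polyEE Fq u' n).
Proof.
move=> hu; elim: n => [|n IH] /=; first exact: (prelXn pR 1).
apply: (prelD pR); first exact: (prel_exp pR).
by rewrite -!mul_polyC; apply: (prelM pR) => //; apply: (prelC pR).
Qed.

(** The polynomial has constant derivative [T'], hence is separable, and its roots lie in the domain
    of the maximal [R]. *)
Lemma opD_dom T g1 g2 y x T' g1' g2' y' : R (T, T') -> R (g1, g1') -> R (g2, g2') ->
  R (y, y') -> T' != 0 -> opD Fq T g1 g2 x = y ->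
  exists2 x', R (x, x') & opD Fq T' g1' g2' x' = y'.
Proof.
move=> hT h1 h2 hy T0 e.
pose p (K : fieldType) (a b c d : K) : {poly K} :=
  a *: 'X + b *: 'X^q + c *: 'X^(q * q) - d%:P.
have hp : prel R (p _ T g1 g2 y) (p _ T' g1' g2' y').
  rewrite /p -!mul_polyC; apply: (prelB pR); last exact: (prelC pR).
  apply: (prelD pR); first apply: (prelD pR).
  - by apply: (prelM pR); [apply: (prelC pR)|apply: (prelXn pR 1)].
  - by apply: (prelM pR); [apply: (prelC pR)|apply: (prelXn pR)].
  - by apply: (prelM pR); [apply: (prelC pR)|apply: (prelXn pR)].
have [x' hx] : exists x', R (x, x').
  apply: (piso_max_dom cL mR hp).
    apply: (separable_deriv (c := T')) => //.
    rewrite /p derivB !derivD !derivZ derivX !derivXn derivC.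
    rewrite -(mulr_natr _ q) -(mulr_natr _ (q * q)) natrM -polyC_natr (card_natr kL).
    by rewrite polyC0 !(mulr0, mul0r) !scaler0 !addr0 subr0 alg_polyC.
  by rewrite /root /p !hornerE -e /opD -exprM subrr.
exists x' => //; apply: (pi_uniq pR (x := opD Fq T g1 g2 x)); first exact: piso_opD.
by rewrite e.
Qed.

(** Eliminating [c] makes [u] a root of [g2 X^(q+1) - g1 X + T]; then [c] is recovered from [u]. *)
Lemma ordinary_dom T g1 g2 u c T' g1' g2' : R (T, T') -> R (g1, g1') -> R (g2, g2') ->
  T' != 0 -> c * u = T -> c + g2 * u ^+ q = g1 ->
  exists u' c', R (u, u') /\ R (c, c').
Proof.
move=> hT h1 h2 T0 e1 e2.
pose p (K : fieldType) (a b d : K) : {poly K} := d *: 'X^(q.+1) - b *: 'X + a%:P.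
have hp : prel R (p _ T g1 g2) (p _ T' g1' g2').
  rewrite /p -!mul_polyC; apply: (prelD pR); last exact: (prelC pR).
  apply: (prelB pR).
  - by apply: (prelM pR); [apply: (prelC pR)|apply: (prelXn pR)].
  - by apply: (prelM pR); [apply: (prelC pR)|apply: (prelXn pR 1)].
have [u' hu] : exists u', R (u, u').
  apply: (piso_max_dom cL mR hp).
    rewrite separable_poly.unlock.
    have -> : deriv (p _ T' g1' g2') = g2' *: 'X^q - g1'%:P.
      rewrite /p derivD derivB !derivZ derivX derivXn derivC addr0 /=.
      rewrite -mulr_natr -natr1 -polyC_natr (card_natr kL) polyC0 add0r mulr1.
      by rewrite alg_polyC.
    (* Since [q + 1 = 1] in [L], the polynomial minus [X] times its derivative is the nonzero
       constant [T']. *)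
    apply/Bezout_coprimepP; exists (1, - 'X) => /=.
    rewrite (_ : _ + _ = T'%:P).
      by rewrite -[T'%:P]mulr1 mul_polyC eqp_scale.
    by rewrite /p exprS -!mul_polyC; ring.
  by rewrite /root /p !hornerE exprS -e1 -e2; apply/eqP; ring.
exists u', (g1' - g2' * u' ^+ q); split=> //.
have -> : c = g1 - g2 * u ^+ q by rewrite -e2 addrK.
by apply: (piB pR) => //; apply: (piM pR) => //; apply: (piX pR).
Qed.

Lemma dfact_dom T G1 G2 u c T' g1' g2' : dfact Fq T G1 G2 u c ->
  R (T, T') -> R (G1 0, g1') -> R (G2 0, g2') -> T' != 0 ->
  exists G1' G2' u' c', [/\ dfact Fq T' G1' G2' u' c', G1' 0 = g1' /\ G2' 0 = g2',
     forall i, R (u i, u' i), forall i, R (c i, c' i) & forall i, R (G2 i, G2' i)].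
Proof.
move=> df hT h1 h2 T0.
have uc i a b : R (G1 i, a) -> R (G2 i, b) -> exists u' c', R (u i, u') /\ R (c i, c').
  by move=> ha hb; apply: (ordinary_dom hT ha hb T0 (dfT df i) (dfg df i)).
have dom i : exists G : (L * L), R (G1 i, G.1) /\ R (G2 i, G.2).
  elim: i => [|i [[a b] /= [ha hb]]]; first by exists (g1', g2').
  have [u' [c' [hu hc]]] := uc _ _ _ ha hb.
  exists (c' ^+ q + u' * b, b ^+ q); rewrite (dfg1 df) (dfg2 df); split.
    by apply: (piD pR); [apply: (piX pR)|apply: (piM pR)].
  exact: (piX pR).
have [G hG] := choice dom.
have duc i : exists U : L * L, R (u i, U.1) /\ R (c i, U.2).
  by have [u' [c' h]] := uc _ _ _ (hG i).1 (hG i).2; exists (u', c').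
have [U hU] := choice duc.
have hU1 i := (hU i).1; have hU2 i := (hU i).2.
have hG1 i := (hG i).1; have hG2 i := (hG i).2.
exists (fun i => (G i).1), (fun i => (G i).2), (fun i => (U i).1), (fun i => (U i).2).
split=> //; last first.
  by split; [apply: (pi_uniq pR (hG1 0%N))|apply: (pi_uniq pR (hG2 0%N))].
split=> i.
- by apply: (pi_uniq pR (x := T)) => //; rewrite -(dfT df i); apply: (piM pR).
- apply: (pi_uniq pR (x := G1 i)) => //; rewrite -(dfg df i).
  by apply: (piD pR) => //; apply: (piM pR) => //; apply: (piX pR).
- apply: (pi_uniq pR (hG1 i.+1)); rewrite (dfg1 df i).
  by apply: (piD pR); [apply: (piX pR)|apply: (piM pR)].
- by apply: (pi_uniq pR (hG2 i.+1)); rewrite (dfg2 df i); apply: (piX pR).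
Qed.

End Transfer.

(** * Unipotent inertia *)

Section DivideByUniformizer.
Variables (Fq : finFieldType) (R : idomainType) (K : fieldType) (f : {rmorphism R -> K}).
Local Notation q := #|Fq|.

(** The factor [r^(q-1)] of the top coefficient compensates the pole: the equation for [a / r]
    becomes one of the same shape for [a]. *)
Lemma opF_div d h a (r : R) : f r != 0 ->
  opF Fq (f d) (f (r ^+ q.-1 * h)) (f a / f r) = f (opF Fq d h a) / f r.
Proof.
move=> r0; have q1 := finNzRing_gt1 Fq.
rewrite /opF rmorphM rmorphXn rmorphD !rmorphM !rmorphXn expr_div_n.
have -> : f r ^+ q = f r * f r ^+ q.-1 by rewrite -exprS prednK // ltnW.
have s0 : f r ^+ q.-1 != 0 by rewrite expf_neq0.
by field; rewrite r0.
Qed.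

Lemma polyEE_div u a (r : R) n : f r != 0 ->
  f r *: (polyEE Fq (f \o u) n - (f a / f r)%:P)
  = map_poly f (r *: polyEE Fq u n - a%:P).
Proof.
move=> r0; rewrite rmorphB /= map_polyZ map_polyC map_polyEE scalerBr.
by rewrite -(mul_polyC _ (f a / f r)%:P) -polyCM mulrC divfK.
Qed.
End DivideByUniformizer.

(** After multiplication by the uniformizer the constant term is the unit [- a], the leading
    coefficient is the uniformizer, and the coefficients in between are divisible by it. *)
Lemma polyEE_irreducible (Fq : finFieldType) (k : fieldType) (kap : {rmorphism Fq -> k})
    (u : nat -> pseries k) (a : pseries k) n : ps0 a != 0 ->
  irreducible_poly (polyEE Fq (@tofrac (pseries k) \o u) n
    - (tofrac a / tofrac (psX k))%:P).
Proof.
move=> a0; have rC0 : tofrac (psX k) != 0 :> {fraction pseries k}.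
  by rewrite tofrac_eq0 psX_neq0.
apply: (irreducible_scale rC0).
rewrite (polyEE_div Fq (f := @tofrac (pseries k))) //.
have [mon sz] := polyEE_size Fq u n.
have szr : size (psX k *: polyEE Fq u n) = (#|Fq| ^ n).+1.
  by rewrite size_scale ?psX_neq0.
have q0 : (0 < #|Fq| ^ n)%N by rewrite expn_gt0 (ltnW (finNzRing_gt1 Fq)).
have lt : (size (- a%:P)%R < size (psX k *: polyEE Fq u n)%R)%N.
  by rewrite size_polyN szr (leq_ltn_trans (size_polyC_leq1 _)).
apply: eisenstein_rev.
- by rewrite size_polyDl // szr.
- by rewrite coefB coefZ (polyEE_coef0 (kapO kap)) mulr0 coefC sub0r rmorphN oppr_eq0.
- by move=> i; rewrite coefB coefZ coefC subr0 rmorphM /= ps0X mul0r.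
- by rewrite lead_coefDl // lead_coefZ (monicP mon) mulr1 /= oner_eq0.
Qed.

Section Places.
Variables (Fq : finFieldType) (L : fieldType).
Local Notation A := {poly Fq}.
Variable iota : {rmorphism {fraction A} -> L}.
Hypothesis scl : separable_closure iota.
Local Notation q := #|Fq|.

Definition jL : {rmorphism A -> L} := iota \o @tofrac A.
Definition kL : {rmorphism Fq -> L} := jL \o polyC.

Variable (g1 g2 : A).
Definition DL (x : L) := opD Fq (jL 'X) (jL g1) (jL g2) x.

Lemma jL_inj : injective jL. Proof. exact: jinj. Qed.
Lemma jLX_neq0 : jL 'X != 0.
Proof. by rewrite -(rmorph0 jL) (inj_eq jL_inj) polyX_eq0. Qed.

Let q1 : (1 < q)%N := finNzRing_gt1 Fq.

Lemma sep_closed_opEE (u : nat -> L) n y : (forall i, u i != 0) -> exists x : L, opEE Fq u n x = y.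
Proof.
move=> u0; have [mon sz] := polyEE_size Fq u n.
have lt : (size (- y%:P)%R < size (polyEE Fq u n))%N.
  rewrite size_polyN sz (leq_ltn_trans (size_polyC_leq1 _)) // ltnS expn_gt0.
  by rewrite (ltnW q1).
have [x] : exists x, root (polyEE Fq u n - y%:P) x.
  apply: scl.2; last first.
    by rewrite size_polyDl // sz ltnS expn_gt0 (ltnW q1).
  apply: (separable_deriv (c := \prod_(i < n) u i)).
    by rewrite derivB derivC subr0 (polyEE_deriv kL).
  by apply/prodf_neq0 => i _.
rewrite /root hornerD hornerN hornerC polyEE_horner subr_eq0 => /eqP e.
by exists x.
Qed.

Section Completion.
Variables (k : closedFieldType) (kap : {rmorphism Fq -> k}) (c : Fq) (m : nat).
Hypothesis m0 : (0 < m)%N.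
Local Notation O := (pseries k).
Local Notation C := {fraction O}.
Local Notation r := (psX k).
Local Notation toC := (@tofrac O).
Local Notation j := (jO kap c m).

Definition jC : {rmorphism A -> C} := toC \o j.

Lemma jC_inj : injective jC.
Proof.
move=> a b /eqP; rewrite /jC /= tofrac_eq => /eqP; exact: jO_inj.
Qed.

Lemma place_piso : exists2 R : set (C * L), piso_max R &
  forall a, R (toC (j a), jL a).
Proof.
have [R mR sub] := piso_max_ex (pbase_piso jC_inj jL_inj).
by exists R => // a; apply/sub/(pbase_ring jC jL).
Qed.

Lemma place_dfact (R : set (C * L)) : piso_max R -> (forall a, R (toC (j a), jL a)) ->
  ps0 (j g1) != 0 -> ps0 (j 'X) * ps0 (j g2) = 0 ->
  exists G1 G2 u d G1' G2' u' d',
  [/\ dfact Fq (j 'X) G1 G2 u d, G1 0 = j g1, G2 0 = j g2 & forall i, ps0 (d i) != 0] /\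
  [/\ dfact Fq (jL 'X) G1' G2' u' d', G1' 0 = jL g1, G2' 0 = jL g2,
      forall i, u' i != 0 & forall i, d' i != 0] /\
  [/\ forall i, R (toC (u i), u' i), forall i, R (toC (d i), d' i)
    & forall i, R (toC (G2 i), G2' i)].
Proof.
move=> mR bR g10 Tg2.
have [G1 [G2 [u [d [df eG1 eG2 dn0]]]]] := ordinary_dfact Fq g10 Tg2.
have dfC : dfact Fq (toC (j 'X)) (toC \o G1) (toC \o G2) (toC \o u) (toC \o d).
  by case: df => h1 h2 h3 h4; split=> i /=; rewrite -?(h1 i) -?(h2 i) ?h3 ?h4
    !(rmorphD, rmorphM, rmorphXn).
have [|||G1' [G2' [u' [d' [df' [eg1' eg2'] hu hd hG2]]]]] :=
  dfact_dom kL mR scl.2 dfC (bR 'X) (g1' := jL g1) (g2' := jL g2).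
- by rewrite /= eG1.
- by rewrite /= eG2.
- exact: jLX_neq0.
have ud0 i : u' i != 0 /\ d' i != 0.
  by apply/andP; rewrite andbC -negb_or -mulf_eq0 (dfT df') jLX_neq0.
exists G1, G2, u, d, G1', G2', u', d'; split=> //; split=> //.
by split=> // i; case: (ud0 i).
Qed.
End Completion.

Section Transvection.
Variables (k : closedFieldType) (kap : {rmorphism Fq -> k}) (c : Fq) (g : A).
Local Notation O := (pseries k).
Local Notation r := (psX k).
Local Notation toC := (@tofrac O).
Local Notation j := (jO kap c q.-1).
Local Notation DO := (opD Fq (j 'X) (j g1) (j g2)).
Local Notation kO := (kapO kap).

(* [r^(q-1) = T - c]: this tame ramification is what makes the lattice point [z],
   of order [-1 / (q - 1)] at [c], rational over the completed base field. *)
Lemma place_transvection :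
  c != 0 -> g1.[c] != 0 -> g2 = ('X - c%:P) * g -> g.[c] != 0 ->
  exists f1 : nat -> L, [/\ f1 0 = 0, forall n, DL (f1 n.+1) = f1 n, f1 1%N != 0 &
    forall n, exists2 x, iter n.+1 DL x = 0 & forall b : nat -> Fq,
      exists2 s, in_galois_group iota s &
        (forall i, s (f1 i) = f1 i) /\
        s x = x + \sum_(i < n.+1) kL (b i) * f1 (n.+1 - i)%N].
Proof.
move=> c0 g1c eg2 gc.
have m0 : (0 < q.-1)%N by case: (q) q1 => [|[]].
have [R mR bR] := place_piso kap c m0.
have pR := mR.1.
have kc : kap c != 0 by rewrite fmorph_eq0.
have T0 : ps0 (j 'X) != 0 by rewrite ps0_jO // hornerX.
have g10 : ps0 (j g1) != 0 by rewrite ps0_jO // fmorph_eq0.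
have eG2 : j g2 = r ^+ q.-1 * j g by rewrite eg2 rmorphM /= jOXc.
have g0 : ps0 (j g) != 0 by rewrite ps0_jO // fmorph_eq0.
have g20 : ps0 (j g2) = 0.
  by rewrite eG2 rmorphM rmorphXn /= ps0X expr0n eqn0Ngt m0 mul0r.
have surj y : exists x, DO x = y.
  have [a ea] := @closed_opD Fq k (ps0 (j 'X)) (ps0 (j g1)) (ps0 (j g2)) (ps0 y) T0.
  by have [x _ hx] := hensel kap T0 ea; exists x.
have [e1 e10 De1] : exists2 e1, e1 != 0 & DO e1 = 0.
  have [a a0 ea] := @closed_opF Fq k _ _ T0 g10.
  have [|x hx Dx] := hensel kap (be := j g1) (ga := j g2) (y := 0) (a := a) T0.
    by rewrite /opD g20 mul0r addr0 rmorph0 -[RHS]ea.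
  exists x => //; apply: contraNneq a0 => x0.
  by rewrite -hx x0 rmorph0.
have [lft lftP] := choice surj.
(* An integral Tate vector: [e1] is a nonzero integral point of [ker D], and each further term is an
   integral preimage of the previous one. *)
pose ep n := if n is n'.+1 then iter n' lft e1 else 0.
have epS n : DO (ep n.+1) = ep n by case: n => [|n] //=; rewrite lftP.
have Tn0 := jLX_neq0.
have dom n : exists y, R (toC (ep n), y).
  elim: n => [|n [y hy]]; first by exists 0; rewrite rmorph0; apply: pi0.
  have [|y' hy' _] := opD_dom kL mR scl.2 (bR 'X) (bR g1) (bR g2) hy Tn0 (x := toC (ep n.+1)).
    by rewrite -(rmorph_opD Fq toC) epS.
  by exists y'.
have [f1 f1P] := choice dom.
have f10 : f1 0 = 0 by apply: (pi_fun pR); have := f1P 0%N; rewrite /ep rmorph0.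
have f1S n : DL (f1 n.+1) = f1 n.
  apply: (pi_uniq pR (x := toC (ep n))) => //; rewrite -epS (rmorph_opD Fq toC).
  exact: (piso_opD Fq mR (bR 'X) (bR g1) (bR g2) (f1P n.+1)).
exists f1; split=> //.
  apply: contraNneq e10 => f0; have := f1P 1%N; rewrite f0 => /(pi_inj pR) /eqP.
  by rewrite tofrac_eq0.
have [|G1 [G2 [u [d [G1' [G2' [u' [d' [[df eG1' eG2' dn0]
  [[df' eg1' eg2' un0 d'n0] [hu hd hG2]]]]]]]]]]] := place_dfact mR bR g10.
  by rewrite g20 mulr0.
have G20 i : ps0 (G2 i) = 0.
  elim: i => [|i IH]; first by rewrite eG2'.
  by rewrite (dfg2 df) rmorphXn /= IH expr0n; case: (q) q1.
(* On [k[[r]]] each [F_i] is injective, since [F_i(x) = (d_i + g2_i x^(q-1)) x] with a unit as first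
   factor; integral torsion is therefore killed by the [E_i] alone. *)
have FFinj n x : opFF Fq d G2 n x = 0 -> x = 0.
  elim: n x => //= n IH x /IH /eqP; rewrite /opF -(prednK (n := q)) ?(ltnW q1) //.
  rewrite exprS mulrCA mulrC -mulrDr mulf_eq0 => /orP[/eqP //|/eqP e].
  move: (dn0 n); rewrite -[d n](addrK (G2 n * x ^+ q.-1)) e sub0r.
  by rewrite rmorphN rmorphM /= G20 mul0r oppr0 eqxx.
have tors n x : iter n DO x = 0 -> opEE Fq u n x = 0.
  move=> h; apply: (FFinj n); rewrite -(iter_opD kO df) -h.
  by rewrite eG1' eG2'.
have rC0 : toC r != 0 by rewrite tofrac_eq0 psX_neq0.
have eqr : r ^+ q = r * r ^+ q.-1 by rewrite -exprS prednK // ltnW.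
have Fdiv i h (a : O) : G2 i = r ^+ q.-1 * h ->
   opF Fq (toC (d i)) (toC (G2 i)) (toC a / toC r) = toC (opF Fq (d i) h a) / toC r.
  by move=> ->; apply: (opF_div Fq (f := toC)).
(* [z = a / r] solves [F_0 o ... o F_n = 0]: for [n = 0] it is a nonzero point of
   [ker F_0], and [F_n z = z'] has a unique solution of order [-1] since [r^q]
   divides [g2_n] for [n > 0]. *)
have zP n : exists2 a, ps0 a != 0 & opFF Fq (toC \o d) (toC \o G2) n.+1 (toC a / toC r) = 0
   /\ exists z', R (toC a / toC r, z').
  elim: n => [|n [a a0 [ea [z' hz']]]].
    have [a a0 ea] := @closed_opF Fq k _ _ (dn0 0%N) g0.
    have [|x hx Dx] := hensel kap (be := j g) (ga := 0) (y := 0) (a := a) (dn0 0%N).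
      by rewrite /opD !rmorph0 mul0r addr0 -[RHS]ea.
    have Fx : opF Fq (d 0%N) (j g) x = 0.
      by move: Dx; rewrite /opD mul0r addr0.
    have Fz : opF Fq (toC (d 0%N)) (toC (G2 0%N)) (toC x / toC r) = 0.
      by rewrite (Fdiv _ (j g)) ?eG2' // Fx rmorph0 mul0r.
    exists x; first by rewrite hx.
    split; first by rewrite /= Fz.
    have [|z' hz' _] := opD_dom kL mR scl.2 (hd 0%N) (hG2 0%N) (pi0 pR) (pi0 pR) (d'n0 0%N)
       (x := toC x / toC r); last by exists z'.
    by rewrite /opD mul0r addr0 -[RHS]Fz.
  have [h eh] : exists h, G2 n.+1 = r ^+ q.-1 * (r * h).
    have [h eh] : exists h, G2 n = r * h by exists (pshift (G2 n)); apply: ps0_dvd.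
    exists (h ^+ q); rewrite (dfg2 df) eh exprMn eqr; by ring.
  have b0 : ps0 a / ps0 (d n.+1) != 0 by rewrite mulf_neq0 ?invr_eq0 ?dn0.
  have [|x hx Dx] := hensel kap (be := r * h) (ga := 0) (y := a)
      (a := ps0 a / ps0 (d n.+1)) (dn0 n.+1).
    by rewrite /opD rmorphM /= ps0X !rmorph0 !mul0r !addr0 mulrC divfK ?dn0.
  have Fx : opF Fq (d n.+1) (r * h) x = a.
    by move: Dx; rewrite /opD mul0r addr0.
  have Fz : opF Fq (toC (d n.+1)) (toC (G2 n.+1)) (toC x / toC r) = toC a / toC r.
    by rewrite (Fdiv _ (r * h)) // Fx.
  exists x; first by rewrite hx.
  split; first by rewrite -[LHS]/(opFF Fq _ _ n.+1 (opF Fq _ _ _)) /= Fz.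
  have [|z hz _] := opD_dom kL mR scl.2 (hd n.+1) (hG2 n.+1) (pi0 pR) hz' (d'n0 n.+1)
       (x := toC x / toC r); last by exists z.
  by rewrite /opD mul0r addr0 -[RHS]Fz.
move=> n.
have [a a0 [Fz [z' hz']]] := zP n.
pose z := toC a / toC r.
(* The point defined by [E x = z'] is killed by [D^(n+1)] because [F z' = 0]. *)
have [x ex] := sep_closed_opEE n.+1 z' un0.
have Fz' : opFF Fq d' G2' n.+1 z' = 0.
  by apply: (pi_fun pR); rewrite -Fz; apply: (piso_opFF Fq mR _ hd hG2 hz').
exists x; first by rewrite -[LHS]/(iter n.+1 (opD Fq _ _ _) x) -eg1' -eg2' (iter_opD kL df') ex.
move=> b.
pose y := \sum_(i < n.+1) kO (b i) * ep (n.+1 - i)%N.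
pose y' := \sum_(i < n.+1) kL (b i) * f1 (n.+1 - i)%N.
have hy : R (toC y, y').
  rewrite rmorph_sum; apply: (pi_sum pR) => i; rewrite rmorphM.
  apply: (piM pR); last exact: f1P.
  by have := bR (b i)%:P; rewrite jOC.
have Ey : opEE Fq u n.+1 y = 0 by apply: tors; apply: (iterD_comb kO).
have Ey' : opEE Fq u' n.+1 y' = 0.
  apply: (pi_fun pR); rewrite -(rmorph0 toC) -Ey (rmorph_opEE Fq toC).
  exact: (piso_opEE Fq mR _ hu hy).
have irr : irreducible_poly (polyEE Fq (toC \o u) n.+1 - z%:P).
  exact: (polyEE_irreducible kap).
have hm : prel R (polyEE Fq (toC \o u) n.+1 - z%:P) (polyEE Fq u' n.+1 - z'%:P).
  by apply: (prelB pR); [apply: (prel_polyEE Fq mR _ hu)|apply: (prelC pR)].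
have bR' a' : R (jC kap c q.-1 a', (iota \o @tofrac A) a') := bR a'.
(* The range of [R] contains every level of [f1], so the conjugation from [x] to [x + y'] fixes all
   of them at once. *)
have [||s gs [sR sx]] := galois_trans scl pR bR' irr hm (x := x) (y := x + y').
- by rewrite /root hornerD hornerN hornerC polyEE_horner ex subrr.
- by rewrite /root hornerD hornerN hornerC polyEE_horner (opEE_D kL) ex Ey' addr0 subrr.
exists s => //; split=> // i; exact: sR (f1P i).
Qed.
End Transvection.

End Places.

(** * The determinant *)

(** The roots are the elements of the kernel of [opEE u n.+1] outside that of [opEE u n]. Modulo the
    uniformizer the polynomial is a power of the variable, and its constant term [u n] has order
    one. *)
Lemma polyEE_eisenstein (Fq : finFieldType) (k : fieldType) (kap : {rmorphism Fq -> k})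
    (u : nat -> pseries k) n : (2 < #|Fq|)%N -> (forall i, ps0 (u i) = 0) ->
  pscoef (u n) 1 != 0 ->
  irreducible_poly (polyEE Fq (@tofrac (pseries k) \o u) n ^+ #|Fq|.-1
    + (tofrac (u n))%:P).
Proof.
move=> q2 u0 un; set q := #|Fq| in q2 *.
have -> : polyEE Fq (@tofrac (pseries k) \o u) n ^+ q.-1 + (tofrac (u n))%:P
    = map_poly (@tofrac _) (polyEE Fq u n ^+ q.-1 + (u n)%:P).
  by rewrite rmorphD rmorphXn /= map_polyEE map_polyC.
have [mon sz] := polyEE_size Fq u n.
have q0 : (0 < q ^ n)%N by rewrite expn_gt0 ltnW // ltnW.
pose N := ((q ^ n) * q.-1).-1.
have N0 : ((q ^ n) * q.-1 = N.+1)%N.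
  by rewrite /N prednK // muln_gt0 q0 /=; case: (q) q2 => [|[]].
have sP : size (polyEE Fq u n ^+ q.-1) = N.+2.
  rewrite -[LHS]prednK ?size_poly_gt0 ?monic_neq0 ?monic_exp // size_exp sz /=.
  by rewrite N0.
have lt : (size ((u n)%:P) < size (polyEE Fq u n ^+ q.-1)%R)%N.
  by rewrite sP (leq_ltn_trans (size_polyC_leq1 _)).
have red : map_poly (@ps0 k) (polyEE Fq u n) = 'X^(q ^ n).
  rewrite map_polyEE; elim: (n) => [|i IH] /=; first by rewrite expr1.
  by rewrite u0 scale0r addr0 IH -exprM -expnSr.
apply: (eisenstein (n := N)).
- by rewrite monicE lead_coefDl // -monicE monic_exp.
- by rewrite size_polyDl.
- rewrite rmorphD rmorphXn /= map_polyC /= u0 polyC0 addr0 red -exprM.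
  by rewrite N0.
- rewrite coefD coefC /= -horner_coef0 horner_exp horner_coef0 (polyEE_coef0 (kapO kap)).
  by rewrite expr0n; case: (q) q2 => [|[]] // m _; rewrite add0r.
Qed.

(** Since [q - 1 = -1] in [K], the polynomial plus [X] times its derivative is the constant [u]. *)
Lemma separable_Xn_addC (Fq : finFieldType) (K : fieldType) (kap : {rmorphism Fq -> K})
    (u : K) : (2 < #|Fq|)%N -> u != 0 -> separable_poly ('X^(#|Fq|.-1) + u%:P).
Proof.
move=> q2 u0; rewrite separable_poly.unlock; apply/Bezout_coprimepP.
exists (1, 'X) => /=; rewrite derivD derivC addr0 derivXn.
set q := #|Fq| in q2 *.
have -> : 1 * ('X^(q.-1) + u%:P) + 'X * ('X^(q.-2) *+ q.-1) = u%:P.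
  rewrite mul1r mulrnAr -exprS prednK; last by case: (q) q2 => [|[|[]]].
  rewrite addrAC -mulrS prednK ?(ltnW (ltnW q2)) //.
  by rewrite -mulr_natr -polyC_natr (card_natr kap) mulr0 add0r.
by rewrite -[u%:P]mulr1 mul_polyC eqp_scale.
Qed.

Lemma exists_neq01 (Fq : finFieldType) : (2 < #|Fq|)%N -> exists a : Fq, (a != 0) && (a != 1).
Proof.
move=> q2; apply/existsP; apply: contraLR q2 => /existsPn h.
rewrite -leqNgt; apply: leq_trans (card_size [:: 0; 1]).
apply: subset_leq_card; apply/fintype.subsetP => x _.
by have := h x; rewrite negb_and !negbK !inE.
Qed.

(** * Torsion generated by one point *)

Section Torsion.
Variables (Fq : finFieldType) (L : fieldType) (kap : {rmorphism Fq -> L}).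
Variables (T g1 g2 : L).
Local Notation D := (opD Fq T g1 g2).

(** Applying [D^(n-i)] kills the terms of index above [i], and those below vanish by induction; what
    remains is [b i] times [D^n e]. *)
Lemma torsion_indep e n (b : nat -> Fq) : iter n.+1 D e = 0 -> iter n D e != 0 ->
  \sum_(i < n.+1) kap (b i) * iter i D e = 0 -> forall i, (i < n.+1)%N -> b i = 0.
Proof.
move=> e0 en s0 i; have [m] := ubnP i; elim: m i => // m IH i lm li.
have := congr1 (iter (n - i) D) s0.
rewrite (fq_linear_sum b (fun i => iter i D e) _ (iterD0 kap _ _ _ _) (iterD_D kap _ _ _ _)
  (iterD_Z kap _ _ _ _)) (iterD0 kap).
rewrite (bigD1 (Ordinal li)) //= -iterD subnK // big1 ?addr0.
  by move/eqP; rewrite mulf_eq0 (negPf en) orbF fmorph_eq0 => /eqP.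
move=> [h lh]; rewrite -val_eqE /= => hi.
case: (ltngtP h i) hi => // hi _; first by rewrite IH ?rmorph0 ?mul0r // (leq_trans hi).
have -> : (iter (n - i) D (iter h D e)) = iter (n - i + h - n.+1) D (iter n.+1 D e).
  by rewrite -!iterD subnK // -{1}(subnK li) subSS leq_add2l.
by rewrite e0 (iterD0 kap) mulr0.
Qed.

(** By independence the combinations are [q^(n+1)] distinct roots, as many as the degree of [p]
    allows. *)
Lemma torsion_span e n (p : {poly L}) v : iter n.+1 D e = 0 -> iter n D e != 0 ->
  (size p <= (#|Fq| ^ n.+1).+1)%N -> p != 0 ->
  (forall b : nat -> Fq, root p (\sum_(i < n.+1) kap (b i) * iter i D e)) ->
  root p v -> exists b : nat -> Fq, v = \sum_(i < n.+1) kap (b i) * iter i D e.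
Proof.
move=> e0 en sp p0 rp pv.
pose F (b : {ffun 'I_n.+1 -> Fq}) := \sum_(i < n.+1) kap (b (inord i)) * iter i D e.
have Finj : injective F.
  move=> b b' eF; apply/ffunP => i.
  have H := @torsion_indep e n (fun i => b (inord i) - b' (inord i)) e0 en.
  have {}H := H _ i (ltn_ord i); rewrite inord_val in H; apply/subr0_eq/H.
  rewrite -[RHS](subrr (F b)) {2}eF /F -sumrB; apply: eq_bigr => h _.
  by rewrite rmorphB mulrBl.
pose rs := [seq F b | b <- enum {ffun 'I_n.+1 -> Fq}].
have [/mapP[b _ ->]|nv] := boolP (v \in rs).
  by exists (fun i => b (inord i)).
have : (size (v :: rs) < size p)%N.
  apply: max_poly_roots => //=.
    by rewrite pv; apply/allP => x /mapP[b _ ->]; exact: (rp (fun i => b (inord i))).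
  by rewrite nv map_inj_uniq ?enum_uniq.
rewrite /= size_map -cardE card_ffun card_ord => lt.
by have := leq_trans lt sp; rewrite ltnS ltnn.
Qed.
End Torsion.

Section PlaceT.
Variables (Fq : finFieldType) (L : fieldType).
Local Notation A := {poly Fq}.
Variable iota : {rmorphism {fraction A} -> L}.
Hypothesis scl : separable_closure iota.
Local Notation q := #|Fq|.
Variables (g1 g2 : A) (k : closedFieldType) (kap : {rmorphism Fq -> k}).
Local Notation O := (pseries k).
Local Notation r := (psX k).
Local Notation toC := (@tofrac O).
Local Notation j := (jO kap 0 1).
Local Notation kO := (kapO kap).
Local Notation jL := (jL iota).
Local Notation kL := (kL iota).
Local Notation DL := (DL iota g1 g2).

(** [F X = eta] has one solution in [k[[r]]], and the kernel of [F] is an [F_q]-line containing a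
    nonzero point of [k[[r]]]; hence every solution comes from there. *)
Lemma opF_range (R : set ({fraction O} * L)) d G d' G' x eta : piso_max R ->
  (forall a, R (toC (j a), jL a)) ->
  ps0 d != 0 -> ps0 G != 0 -> R (toC d, d') -> R (toC G, G') -> d' != 0 -> G' != 0 ->
  R (toC eta, opF Fq d' G' x) -> exists xi, R (toC xi, x).
Proof.
move=> mR bR d0 G0 hd hG d'0 G'0 heta; have pR := mR.1.
have opFD (K : idomainType) (a b y : K) : opD Fq a b 0 y = opF Fq a b y.
  by rewrite /opD mul0r addr0.
have R00 : R (toC 0, 0) by rewrite rmorph0; apply: pi0.
have [a ea] := @closed_opD Fq k (ps0 d) (ps0 G) (ps0 0) (ps0 eta) d0.
have [x0 _ ex0] := hensel kap d0 ea.
have [|x0' hx0 ex0'] := opD_dom kL mR scl.2 hd hG R00 heta d'0 (x := toC x0).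
  by rewrite -(rmorph_opD Fq toC) ex0.
have [a1 a10 ea1] := @closed_opF Fq k _ _ d0 G0.
have [|ze hze eze] := hensel kap (be := G) (ga := 0) (y := 0) (a := a1) d0.
  by rewrite !rmorph0 opFD.
have [|ze' hze' eze'] := opD_dom kL mR scl.2 hd hG R00 R00 d'0 (x := toC ze).
  by rewrite -(rmorph_opD Fq toC) eze.
have ze0 : ze' != 0.
  apply: contraNneq a10 => z0; move: hze'; rewrite z0 => /(pi_inj pR)/eqP.
  by rewrite tofrac_eq0 -hze => /eqP ->; rewrite rmorph0.
have ev : opF Fq d' G' (x - x0') = 0.
  by rewrite (opF_B kL) -[opF _ _ _ x0']opFD ex0' subrr.
move: eze'; rewrite opFD => eze'.
(* Two points of [ker F] obey the same rule for [y^q], so their ratio is fixed by the [q]-power map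
   and lies in [F_q]. *)
have key y : opF Fq d' G' y = 0 -> y ^+ q = - (d' / G') * y.
  rewrite /opF => /eqP; rewrite addrC addr_eq0 => /eqP e.
  by apply: (mulfI G'0); rewrite e; field.
have [|c ec] := frob_fixed kL (x := (x - x0') / ze').
  rewrite expr_div_n !key //; field.
  by rewrite ze0 oppr_eq0 d'0 G'0.
exists (x0 + kO c * ze); have -> : x = x0' + kL c * ze'.
  by rewrite -ec divfK // addrC subrK.
rewrite rmorphD rmorphM; apply: (piD pR) => //; apply: (piM pR) => //.
by have := bR c%:P; rewrite jOC.
Qed.

(** [e] generates the kernel of [E], on which any unit [a] is realized, while [s] acts trivially on
    the torsion modulo this kernel, because the image of the torsion under [E] comes from [k[[T]]].
    The determinant of [s] is thus [a] at this level. *)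
Lemma place_determinant : (2 < q)%N -> g1.[0] != 0 -> g2.[0] != 0 ->
  forall n, exists e, [/\ iter n.+1 DL e = 0, iter n DL e != 0 &
    forall a : nat -> Fq, a 0%N != 0 -> exists2 s, in_galois_group iota s &
      s e = \sum_(i < n.+1) kL (a i) * iter i DL e /\
      forall z, iter n.+1 DL z = 0 ->
        exists b : nat -> Fq, s z - z = \sum_(i < n.+1) kL (b i) * iter i DL e].
Proof.
move=> q2 g1c g2c n.
have [R mR bR] := place_piso iota kap 0 (ltn0Sn 0).
have pR := mR.1.
have g10 : ps0 (j g1) != 0 by rewrite ps0_jO // fmorph_eq0.
have g20 : ps0 (j g2) != 0 by rewrite ps0_jO // fmorph_eq0.
have jX : j 'X = r by rewrite jOX rmorph0 add0r expr1.
have [|G1 [G2 [u [d [G1' [G2' [u' [d' [[df eG1 eG2 dn0]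
  [[df' eg1' eg2' un0 d'n0] [hu hd hG2]]]]]]]]]]] := place_dfact scl mR bR g10 (g2 := g2).
  by rewrite jX ps0X mul0r.
have u0 i : ps0 (u i) = 0.
  have := congr1 (@ps0 k) (dfT df i); rewrite jX rmorphM /= ps0X => /eqP.
  by rewrite mulf_eq0 (negPf (dn0 i)) => /eqP.
have u1 i : pscoef (u i) 1 != 0.
  have := congr1 (fun x => pscoef x 1) (dfT df i).
  rewrite jX pscoefM big_ord_recl big_ord_recl big_ord0 /= subn0 subnn.
  rewrite -[pscoef (u i) 0]/(ps0 (u i)) u0 mulr0 !addr0 => e.
  by apply/eqP => z; move/eqP: e; rewrite z mulr0 eq_sym oner_eq0.
have G2n0 i : ps0 (G2 i) != 0.
  elim: i => [|i IH]; first by rewrite eG2.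
  by rewrite (dfg2 df) rmorphXn expf_neq0.
have G2'n0 i : G2' i != 0.
  apply: contraNneq (G2n0 i) => z; have := hG2 i; rewrite z => /(pi_inj pR)/eqP.
  by rewrite tofrac_eq0 => /eqP ->; rewrite rmorph0.
have FFran m x : opFF Fq d' G2' m x = 0 -> exists xi, R (toC xi, x).
  elim: m x => [|m IH] x /=; first by move=> ->; exists 0; rewrite rmorph0; apply: pi0.
  by move/IH => [eta heta]; apply: (opF_range mR bR (dn0 m) (G2n0 m) (hd m) (hG2 m)
     (d'n0 m) (G2'n0 m) heta).
have eDL m x : iter m DL x = opFF Fq d' G2' m (opEE Fq u' m x).
  by rewrite -(iter_opD kL df') eg1' eg2'.
(* [z1] is a nonzero point of the kernel of the last factor [E_n]. *)
have [z1 ez1] : exists z1, z1 ^+ q.-1 = - u' n.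
  have [|x] := scl.2 _ (separable_Xn_addC kL q2 (un0 n)).
    by rewrite size_XnaddC //; case: (q) q2 => [|[|[]]].
  by rewrite /root hornerD hornerXn hornerC addr_eq0 => /eqP e; exists x.
have q0 : (0 < q)%N by rewrite ltnW // ltnW.
have Ez1 : opE Fq (u' n) z1 = 0.
  by rewrite /opE -(prednK q0) exprS ez1 mulrN mulrC addNr.
have z10 : z1 != 0.
  apply: contraNneq (un0 n) => z0; have qm : (q.-1 == 0)%N = false by case: (q) q2 => [|[|[]]].
  by move/eqP: ez1; rewrite z0 expr0n qm eq_sym oppr_eq0.
have [e ee] := sep_closed_opEE scl n z1 un0.
have EEe : opEE Fq u' n.+1 e = 0 by rewrite /= ee.
have De : iter n.+1 DL e = 0 by rewrite eDL EEe (opFF0 kL).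
have EEi m i x : opEE Fq u' m (iter i DL x)
    = iter i (opD Fq (jL 'X) (G1' m) (G2' m)) (opEE Fq u' m x).
  by rewrite -(opEE_iter kL df') eg1' eg2'.
have EElin m (b : nat -> Fq) (x : nat -> L) l :
    opEE Fq u' m (\sum_(i < l) kL (b i) * x i) = \sum_(i < l) kL (b i) * opEE Fq u' m (x i).
  apply: (fq_linear_sum b x l); first exact: (opEE0 kL).
    by move=> x1 x2; apply: (opEE_D kL).
  by move=> c1 x1; apply: (opEE_Z kL).
(* For [i > 0] the image of [D^i e] is [D_n^i z1 = 0], so only the coefficient [a 0] survives. *)
have EEy (a : nat -> Fq) :
    opEE Fq u' n (\sum_(i < n.+1) kL (a i) * iter i DL e) = kL (a 0%N) * z1.
  rewrite (EElin _ a (fun i => iter i DL e)) big_ord_recl big1 ?addr0 /= ?ee //.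
  move=> i _; rewrite -iterS EEi ee iterSr -(opFE kL df') Ez1 (opF0 kL).
  by rewrite (iterD0 kL) mulr0.
have hP : prel R (polyEE Fq (toC \o u) n ^+ q.-1 + (toC (u n))%:P)
   (polyEE Fq u' n ^+ q.-1 + (u' n)%:P).
  apply: (prelD pR); last exact: (prelC pR (hu n)).
  by apply: (prel_exp pR); apply: (prel_polyEE Fq mR _ hu).
have P'E x : (polyEE Fq u' n ^+ q.-1 + (u' n)%:P).[x] = opEE Fq u' n x ^+ q.-1 + u' n.
  by rewrite hornerD horner_exp hornerC polyEE_horner.
have bR' a' : R (jC kap 0 1 a', (iota \o @tofrac A) a') := bR a'.
have gal (a : nat -> Fq) : a 0%N != 0 -> exists2 s, in_galois_group iota s &
    s e = \sum_(i < n.+1) kL (a i) * iter i DL e /\ forall x y, R (x, y) -> s y = y.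
  move=> a0.
  have [||s gs [sR sx]] := galois_trans scl pR bR' (polyEE_eisenstein kap q2 u0 (u1 n)) hP
    (x := e) (y := \sum_(i < n.+1) kL (a i) * iter i DL e).
  - by rewrite /root P'E ee ez1 addNr.
  - rewrite /root P'E EEy exprMn ez1 -rmorphXn.
    have -> : a 0%N ^+ q.-1 = 1.
      by apply: (mulfI a0); rewrite -exprS prednK // expf_card mulr1.
    by rewrite rmorph1 mul1r addNr.
  by exists s.
have sEE (s : {rmorphism L -> L}) m x : (forall x y, R (x, y) -> s y = y) ->
    s (opEE Fq u' m x) = opEE Fq u' m (s x).
  move=> sR; rewrite rmorph_opEE; congr (opEE Fq _ m (s x)).
  by apply: funext => i /=; apply: sR (hu i).
(* If [D^n e] vanished, [z1] would come from [k[[r]]] and be fixed by [s], whereas [s] multiplies it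
   by an [a0] different from [0] and [1]. *)
have en : iter n DL e != 0.
  apply/eqP; rewrite eDL ee => /FFran[xi hxi].
  have [a0 /andP[a00 a01]] := exists_neq01 q2.
  have [s gs [se sR]] := gal (fun=> a0) a00.
  have := sEE s n e sR; rewrite se (EEy (fun=> a0)) ee (sR _ _ hxi) -[LHS]mul1r.
  move/(mulIf z10)/eqP; rewrite -(rmorph1 kL) (inj_eq (fmorph_inj kL)) eq_sym.
  by rewrite (negPf a01).
exists e; split=> // a /gal[s gs [se sR]]; exists s => //; split=> // z Dz.
have [xi hxi] : exists xi, R (toC xi, opEE Fq u' n.+1 z).
  by apply: (FFran n.+1); rewrite -eDL.
have Esz : opEE Fq u' n.+1 (s z - z) = 0.
  by rewrite (opEE_B kL) -sEE // (sR _ _ hxi) subrr.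
have [mon sz] := polyEE_size Fq u' n.+1.
have := @torsion_span Fq L kL (jL 'X) (jL g1) (jL g2) e n (polyEE Fq u' n.+1) (s z - z) De en.
apply.
- by rewrite sz.
- exact: monic_neq0.
- move=> b; rewrite /root polyEE_horner (EElin _ b (fun i => iter i DL e)) big1 // => i _.
  by rewrite EEi EEe (iterD0 kL) mulr0.
- by rewrite /root polyEE_horner Esz.
Qed.

End PlaceT.

(** * The Tate module *)

Section Tate.
Variables (Fq : finFieldType) (L : fieldType).
Local Notation A := {poly Fq}.
Variable iota : {rmorphism {fraction A} -> L}.
Hypothesis scl : separable_closure iota.
Local Notation q := #|Fq|.
Variables (g1 g2 : A).
Hypothesis g2n0 : g2 != 0.
Local Notation jL := (jL iota).
Local Notation kL := (kL iota).
Local Notation D := (DL iota g1 g2).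
Local Notation P := (pseries Fq).
Local Notation K := (ps_map kL).
Local Notation G := (in_galois_group iota).

(* The Tate vector [(x_n)] is encoded as the power series [\sum_n x_n r^n]; the
   action of [F_q[[T]]] then becomes multiplication of power series. *)
Definition istate (x : pseries L) := pscoef x 0 = 0 /\ forall n, D (pscoef x n.+1) = pscoef x n.

Let DB x y : D (x - y) = D x - D y. Proof. exact: (opD_B kL). Qed.
Let D0 : D 0 = 0. Proof. exact: (opD0 kL). Qed.
Let DD x y : D (x + y) = D x + D y. Proof. exact: (opD_D kL). Qed.
Let DZ c x : D (kL c * x) = kL c * D x. Proof. exact: (opD_Z kL). Qed.

Lemma istateB x y : istate x -> istate y -> istate (x - y).
Proof.
move=> [x0 xS] [y0 yS]; split=> [|n]; first by rewrite pscoefB x0 y0 subrr.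
by rewrite !pscoefB DB xS yS.
Qed.

Lemma istateD x y : istate x -> istate y -> istate (x + y).
Proof.
move=> [x0 xS] [y0 yS]; split=> [|n]; first by rewrite pscoefD x0 y0 addr0.
by rewrite !pscoefD DD xS yS.
Qed.

Lemma istateZ (a : P) x : istate x -> istate (K a * x).
Proof.
move=> [x0 xS]; split=> [|n].
  by rewrite pscoefM big_ord_recl big_ord0 /= subnn x0 mulr0 addr0.
rewrite !pscoefM (fq_linear_sum (pscoef a) (fun i => pscoef x (n.+1 - i)) n.+2 D0 DD DZ).
rewrite big_ord_recr /= subnn x0 D0 mulr0 addr0; apply: eq_bigr => i _.
have le : (i <= n)%N by rewrite -ltnS ltn_ord.
by rewrite [LHS]/= (subSn le) xS.
Qed.

Lemma galois_kL s c : G s -> s (kL c) = kL c.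
Proof. by move=> [_ h]; rewrite /kL /=; apply: h. Qed.

Lemma galois_D s x : G s -> s (D x) = D (s x).
Proof. by move=> [_ h]; rewrite /DL rmorph_opD /jL /= !h. Qed.

Lemma istate_galois s x : G s -> istate x -> istate (ps_map s x).
Proof.
move=> gs [x0 xS]; split=> [|n] /=; first by rewrite x0 rmorph0.
by rewrite -galois_D // xS.
Qed.

Lemma galois_K s (a : P) : G s -> ps_map s (K a) = K a.
Proof. by move=> gs; apply: pseriesP => n /=; apply: galois_kL. Qed.

Lemma galois_comp s t : G s -> G t -> G (s \o t).
Proof.
move=> [bs fs] [bt ft]; split; first exact: bij_comp.
by move=> x /=; rewrite ft fs.
Qed.

Lemma galois_inv s : G s -> exists2 t, G t & cancel s t /\ cancel t s.
Proof.
move=> [[t st ts] fs].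
have tB := can2_zmod_morphism st ts; have tM := can2_monoid_morphism st ts.
pose t' : {rmorphism L -> L} := HB.pack t
  (GRing.isZmodMorphism.Build _ _ t tB) (GRing.isMonoidMorphism.Build _ _ t tM).
exists t' => //; split; first by exists s.
by move=> x; rewrite /= -[in LHS](fs x) st.
Qed.

Lemma istate_iter x n i : istate x -> iter i D (pscoef x n) = pscoef x (n - i).
Proof. by move=> [x0 xS]; apply: (iterD_seq kL x0 xS). Qed.

(** The lower levels are recovered from level [n] by applying [D]. *)
Lemma istate_cong x y n : istate x -> istate y -> pscoef x n = pscoef y n -> pscong n.+1 x y.
Proof.
move=> tx ty e i; rewrite ltnS => le.
by rewrite -(subKn le) -!istate_iter // e.
Qed.

Lemma D_surj y : exists x, D x = y.
Proof.
have q1 : (1 < q)%N := finNzRing_gt1 Fq.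
pose p : {poly L} := jL 'X *: 'X + jL g1 *: 'X^q + jL g2 *: 'X^(q * q) - y%:P.
have p1 : p`_1 = jL 'X.
  rewrite /p !coefB !coefD !coefZ coefX !coefXn coefC /= mulr1.
  have -> : (1 == q)%N = false by case: (q) q1 => // -[].
  have -> : (1 == q * q)%N = false by case: (q) q1 => // -[].
  by rewrite !mulr0 !addr0 subr0.
have [||x] := scl.2 p.
- apply: (separable_deriv (c := jL 'X)); last exact: jLX_neq0.
  rewrite /p derivB !derivD !derivZ derivX !derivXn derivC.
  rewrite -(mulr_natr _ q) -(mulr_natr _ (q * q)) natrM -polyC_natr (card_natr kL).
  by rewrite polyC0 !(mulr0, mul0r) !scaler0 !addr0 subr0 alg_polyC.
- rewrite ltnNge; apply/negP => sp; have := jLX_neq0 iota.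
  by rewrite -p1 nth_default ?eqxx.
rewrite /root /p !hornerE subr_eq0 => /eqP e.
by exists x; rewrite /DL /opD -exprM.
Qed.

(** Below level [n] the vector consists of the images of [x] under [D], above it of chosen
    preimages. *)
Lemma istate_extend x n : iter n D x = 0 -> exists2 y, istate y & pscoef y n = x.
Proof.
move=> xn; have [lft lftP] := choice D_surj.
exists (PSeries (fun m => if (m <= n)%N then iter (n - m) D x else iter (m - n) lft x)) => /=.
  split=> [|m] /=; first by rewrite subn0.
  case: (ltngtP m n) => [lt|lt|->].
  - by rewrite -iterS subnSK.
  - by rewrite subSn ?(ltnW lt) //= lftP.
  - by rewrite subSn // subnn /= lftP.
by rewrite leqnn subnn.
Qed.

(** By its degree the polynomial of [D] has at most [q^2] roots, and the combinations of [x] and [y]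
    are already that many. *)
Lemma ker_D_bound x y v : (forall c d, kL c * x + kL d * y = 0 -> c = 0 /\ d = 0) ->
  D x = 0 -> D y = 0 -> D v = 0 -> exists c d, v = kL c * x + kL d * y.
Proof.
move=> ind Dx Dy Dv.
have q1 : (1 < q)%N := finNzRing_gt1 Fq.
pose p : {poly L} := jL 'X *: 'X + jL g1 *: 'X^q + jL g2 *: 'X^(q * q).
have pE z : p.[z] = D z by rewrite /p !hornerE /DL /opD -exprM.
have jg2 : jL g2 != 0 by rewrite -(rmorph0 jL) (inj_eq (jL_inj (iota := iota))).
have lt : (size (jL 'X *: 'X + jL g1 *: 'X^q : {poly L})%R < size (jL g2 *: 'X^(q * q) : {poly L})%R)%N.
  rewrite [X in (_ < X)%N]size_scale // size_polyXn ltnS.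
  apply: leq_trans (size_polyD _ _) _; rewrite geq_max; apply/andP; split.
    apply: leq_trans (size_scale_leq _ _) _; rewrite size_polyX.
    by case: (q) q1 => // -[].
  apply: leq_trans (size_scale_leq _ _) _; rewrite size_polyXn.
  by rewrite -[X in (X < _)%N]muln1 ltn_mul2l q1 ltnW.
have sp : size p = (q * q).+1.
  by rewrite /p addrC size_polyDl // size_scale // size_polyXn.
pose F (cd : Fq * Fq) := kL cd.1 * x + kL cd.2 * y.
have Finj : injective F.
  move=> [c d] [c' d'] /eqP; rewrite -subr_eq0 => /eqP e.
  have [|/subr0_eq -> /subr0_eq ->] // := ind (c - c') (d - d').
  by rewrite -[RHS]e /F /= !rmorphB; ring.
have rF cd : root p (F cd) by rewrite /root pE DD !DZ Dx Dy !mulr0 addr0.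
have rv : root p v by rewrite /root pE Dv.
pose rs := [seq F b | b <- enum {: Fq * Fq}].
have [/mapP[[c d] _ ->]|nv] := boolP (v \in rs); first by exists c, d.
have : (size (v :: rs) < size p)%N.
  apply: max_poly_roots => //=.
  - by rewrite -size_poly_gt0 sp.
  - by rewrite rv; apply/allP => z /mapP[b _ ->]; apply: rF.
  - by rewrite nv map_inj_uniq ?enum_uniq.
by rewrite /= size_map -cardE card_prod sp ltnn.
Qed.

Section Basis.
Variables (f1 f2 : pseries L).
Hypotheses (t1 : istate f1) (t2 : istate f2).
Hypothesis ind : forall c d, kL c * pscoef f1 1 + kL d * pscoef f2 1 = 0 -> c = 0 /\ d = 0.

Definition comb (a b : P) := K a * f1 + K b * f2.

Lemma istate_comb a b : istate (comb a b).
Proof. by apply: istateD; apply: istateZ. Qed.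

Lemma combB a b a' b' : comb a b - comb a' b' = comb (a - a') (b - b').
Proof. by rewrite /comb !rmorphB; ring. Qed.

(** Level [n + 1] is the first to see the digit [n] of [a], because level [0] of a Tate vector is
    zero. *)
Lemma coef_low (a : P) x n : istate x -> pscong n a 0 ->
  pscoef (K a * x) n.+1 = kL (pscoef a n) * pscoef x 1.
Proof.
move=> [x0 _] h; rewrite pscoefM big_ord_recr big_ord_recr /= subnn x0 mulr0 addr0.
rewrite subSn // subnn big1 ?add0r // => i _; rewrite h //.
by rewrite pscoef0 rmorph0 mul0r.
Qed.

Lemma comb_cong0 a b n : pscong n.+1 (comb a b) 0 -> pscong n a 0 /\ pscong n b 0.
Proof.
elim: n => [|n IH] h; first by split.
have [ha hb] := IH (pscong_le (leqnSn _) h).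
have : pscoef (comb a b) n.+1 = 0 by rewrite h.
rewrite /comb pscoefD !coef_low // => /ind[ea eb].
by split=> i; rewrite ltnS leq_eqVlt => /predU1P[->|]; rewrite ?ea ?eb //; [apply: ha|apply: hb].
Qed.

Lemma pscong_sub (R : comNzRingType) n (a b : pseries R) : pscong n a b <-> pscong n (a - b) 0.
Proof.
split=> h i /h; first by rewrite pscoefB => ->; rewrite subrr.
by rewrite pscoefB => /subr0_eq.
Qed.

(** Level [n] depends on the coefficients modulo [T^n] and determines them; agreement up to that
    level is precision [n.+1], whence the shift by one. *)
Lemma comb_cong a b a' b' n :
  pscong n.+1 (comb a b) (comb a' b') <-> pscong n a a' /\ pscong n b b'.
Proof.
split.
  move/pscong_sub; rewrite combB => /comb_cong0[ha hb].
  by split; apply/pscong_sub.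
move=> [ha hb]; have aux (c c' : P) x : istate x -> pscong n c c' -> pscong n.+1 (K c * x) (K c' * x).
  move=> [x0 _] h i; rewrite ltnS => le; rewrite !pscoefM; apply: eq_bigr => l _.
  have := ltn_ord l; rewrite ltnS leq_eqVlt => /predU1P[->|lt].
    by rewrite subnn x0 !mulr0.
  by rewrite /= h // (leq_trans lt).
by apply: pscongD; apply: aux.
Qed.

Lemma comb_inj a b a' b' : comb a b = comb a' b' -> a = a' /\ b = b'.
Proof.
move=> e; split; apply: pscong_eq => n.
  by have /comb_cong[] : pscong n.+1 (comb a b) (comb a' b') by rewrite e; apply: pscong_refl.
by have /comb_cong[] : pscong n.+1 (comb a b) (comb a' b') by rewrite e; apply: pscong_refl.
Qed.

(** Digit by digit: level [1] determines the constants to subtract, the difference is divisible by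
    [T], division by [T] is a shift, and the process repeats. *)
Lemma istate_basis x : istate x -> exists a b, x = comb a b.
Proof.
move=> tx.
have D1 y : istate y -> D (pscoef y 1) = 0 by move=> [y0 ->].
(* The subtype carries along the property of being a Tate vector, so that the choice function can be
   iterated. *)
have step (y : {y | istate y}) : exists z : {y | istate y} * (Fq * Fq),
    sval y = comb (psC z.2.1) (psC z.2.2) + psX L * sval z.1.
  case: y => y ty /=.
  have [c [d e]] := ker_D_bound ind (D1 _ t1) (D1 _ t2) (D1 _ ty).
  have ts : istate (pshift (y - comb (psC c) (psC d))).
    have [y0 yS] := istateB ty (istate_comb (psC c) (psC d)).
    split=> [|n]; last exact: yS.
    have cC (c' : Fq) (z : pseries L) : pscoef (K (psC c') * z) 1 = kL c' * pscoef z 1.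
      have -> : K (psC c') = psC (kL c').
        by apply: pseriesP => -[|n] //=; rewrite rmorph0.
      by rewrite pscoefCM.
    by rewrite -[LHS]/(pscoef (y - _) 1) pscoefB pscoefD !cC e subrr.
  exists (exist _ _ ts, (c, d)) => /=.
  rewrite -ps0_dvd; first by rewrite addrC subrK.
  by have [] := istateB ty (istate_comb (psC c) (psC d)).
have [F FP] := choice step.
pose ys n := iter n (fun y => (F y).1) (exist _ x tx).
pose a : P := PSeries (fun n => (F (ys n)).2.1).
pose b : P := PSeries (fun n => (F (ys n)).2.2).
pose tr n (c : P) : P := PSeries (fun i => if (i < n)%N then pscoef c i else 0).
have trS n (c : P) : tr n.+1 c = tr n c + psX Fq ^+ n * psC (pscoef c n).
  apply: pseriesP => i; rewrite pscoefD pscoefXnM /= ltnS leq_eqVlt.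
  case: ltngtP => [lt|gt|->] /=; rewrite ?addr0 ?add0r ?ltnn //.
    by rewrite -subn_gt0 in gt; case: (i - n)%N gt.
  by rewrite subnn.
have KX n : K (psX Fq ^+ n) = psX L ^+ n.
  rewrite rmorphXn; congr (_ ^+ n); apply: pseriesP => i; exact: (rmorph_nat kL).
have KtrS n (c : P) : K (tr n.+1 c) = K (tr n c) + psX L ^+ n * K (psC (pscoef c n)).
  by rewrite trS rmorphD rmorphM /= KX.
have E n : x = comb (tr n a) (tr n b) + psX L ^+ n * sval (ys n).
  elim: n => [|n IH].
    rewrite expr0 mul1r /= /comb.
    have -> : tr 0%N a = 0 by apply: pseriesP.
    have -> : tr 0%N b = 0 by apply: pseriesP.
    by rewrite rmorph0 !mul0r !add0r.
  by rewrite {1}IH (FP (ys n)) -[(F (ys n)).1]/(ys n.+1) /comb !KtrS exprS; ring.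
exists a, b; apply: pscong_eq => n.
have h : pscong n x (comb (tr n a) (tr n b)) by apply/pscongP; exists (sval (ys n)); apply: E.
apply: pscong_trans h _; apply: pscong_le (leqnSn n) _; apply/comb_cong.
by split=> i lt /=; rewrite lt.
Qed.

(* Some Galois element has matrix [a b; c d] in the basis [f1], [f2]. *)
Definition real (a b c d : P) := exists2 s, G s &
  ps_map s f1 = comb a c /\ ps_map s f2 = comb b d.

Lemma galois_comb s (a b : P) : G s -> ps_map s (comb a b) = K a * ps_map s f1 + K b * ps_map s f2.
Proof. by move=> gs; rewrite /comb rmorphD !rmorphM /= !galois_K. Qed.

Lemma real_galois s : G s -> exists a b c d,
  ps_map s f1 = comb a c /\ ps_map s f2 = comb b d.
Proof.
move=> gs; have [a [c e]] := istate_basis (istate_galois gs t1).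
by have [b [d e']] := istate_basis (istate_galois gs t2); exists a, b, c, d.
Qed.

Lemma ps_map_comp (s t : {rmorphism L -> L}) x : ps_map (s \o t) x = ps_map s (ps_map t x).
Proof. by apply: pseriesP. Qed.

Lemma real_mul a b c d a' b' c' d' : real a b c d -> real a' b' c' d' ->
  real (a * a' + b * c') (a * b' + b * d') (c * a' + d * c') (c * b' + d * d').
Proof.
move=> [s gs [s1 s2]] [t gt [u1 u2]]; exists (s \o t); first exact: galois_comp.
rewrite !ps_map_comp u1 u2 !galois_comb // s1 s2 /comb.
by split; rewrite !rmorphD !rmorphM; ring.
Qed.

Lemma comb10 : comb 1 0 = f1. Proof. by rewrite /comb rmorph1 rmorph0; ring. Qed.
Lemma comb01 : comb 0 1 = f2. Proof. by rewrite /comb rmorph1 rmorph0; ring. Qed.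

(* The approximating [s n] need not be compatible, but they agree on the fixed
   field [Ln n] of the stabilizer of the level [n] torsion, and so glue on the union. *)
Lemma real_closed a b c d :
  (forall n, exists a' b' c' d', real a' b' c' d' /\
     [/\ pscong n a' a, pscong n b' b, pscong n c' c & pscong n d' d]) -> real a b c d.
Proof.
move=> h.
have h1 n : exists s, G s /\ (pscong n.+1 (ps_map s f1) (comb a c) /\
                         pscong n.+1 (ps_map s f2) (comb b d)).
  have [a' [b' [c' [d' [[s gs [e1 e2]] [ca cb cc cd]]]]]] := h n.
  by exists s; split=> //; rewrite e1 e2; split; apply/comb_cong.
have [s sP] := choice h1.
pose fixes n (t : {rmorphism L -> L}) := forall i, (i < n.+1)%N ->
  t (pscoef f1 i) = pscoef f1 i /\ t (pscoef f2 i) = pscoef f2 i.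
pose Ln n x := forall t, G t -> fixes n t -> t x = x.
have Lle n m x : (n <= m)%N -> Ln n x -> Ln m x.
  move=> le hx t gt ft; apply: hx => // i lt; apply: ft; exact: leq_trans lt _.
(* [s m] and [s n] agree on the basis vectors up to level [n], so the inverse of [s n] composed with
   [s m] fixes these points and hence [Ln n]. *)
have sle n m x : (n <= m)%N -> Ln n x -> s m x = s n x.
  move=> le hx; have [gn [n1 n2]] := sP n; have [gm [m1 m2]] := sP m.
  have [t gt [nt tn]] := galois_inv gn.
  have : (t \o s m) x = x.
    apply: hx; first exact: galois_comp.
    move=> i lt; have lt' : (i < m.+1)%N by apply: leq_trans lt _.
    have e1 : s m (pscoef f1 i) = s n (pscoef f1 i) := etrans (m1 i lt') (esym (n1 i lt)).
    have e2 : s m (pscoef f2 i) = s n (pscoef f2 i) := etrans (m2 i lt') (esym (n2 i lt)).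
    by rewrite /= e1 e2 !nt.
  by move=> /= e; rewrite -[LHS]tn e.
pose R : set (L * L) := [set z | exists n, Ln n z.1 /\ z.2 = s n z.1].
have R2 x y x' y' : R (x, y) -> R (x', y') ->
    exists n, [/\ Ln n x, Ln n x', y = s n x & y' = s n x'].
  move=> [n [/= hx ->]] [m [/= hx' ->]]; exists (maxn n m); split.
  - exact: Lle (leq_maxl _ _) hx.
  - exact: Lle (leq_maxr _ _) hx'.
  - by rewrite (sle _ _ _ (leq_maxl n m) hx).
  - by rewrite (sle _ _ _ (leq_maxr n m) hx').
have pR : piso R.
  split.
  - by exists 0%N; split=> /=; [move=> t _ _|]; rewrite rmorph1.
  - move=> x y x' y' u v; have [n [hx hx' -> ->]] := R2 _ _ _ _ u v.
    by exists n; split=> /=; [move=> t gt ft; rewrite rmorphB hx ?hx'|rewrite rmorphB].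
  - move=> x y x' y' u v; have [n [hx hx' -> ->]] := R2 _ _ _ _ u v.
    by exists n; split=> /=; [move=> t gt ft; rewrite rmorphM hx ?hx'|rewrite rmorphM].
  - move=> x y [n [/= hx ->]].
    by exists n; split=> /=; [move=> t gt ft; rewrite fmorphV hx|rewrite fmorphV].
  - by move=> y [n [/= _ ->]]; rewrite rmorph0.
  - by move=> x [n [/= _ /esym/eqP]]; rewrite fmorph_eq0 => /eqP.
have [|t gt tP] := galois_of_piso scl pR.
  move=> [x y] [u [v [v0 /= -> ->]]]; exists 0%N => /=.
  have fixj t : G t -> t (jL u / jL v) = jL u / jL v.
    by move=> [_ ft]; rewrite fmorph_div /jL /= !ft.
  by split=> [t gt _|]; rewrite fixj //; case: (sP 0%N).
exists t => //.
have Lf n : Ln n (pscoef f1 n) /\ Ln n (pscoef f2 n).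
  by split=> t' _ ft; case: (ft n (ltnSn n)).
split; apply: pseriesP => n /=.
  have -> := tP (pscoef f1 n) (s n (pscoef f1 n)); first by have [_ [e _]] := sP n; apply: e.
  by exists n; split=> //; case: (Lf n).
have -> := tP (pscoef f2 n) (s n (pscoef f2 n)); first by have [_ [_ e]] := sP n; apply: e.
by exists n; split=> //; case: (Lf n).
Qed.

End Basis.
End Tate.

(** * Generation of GL2 *)

Section GL2.
Variables (F : fieldType) (H : pseries F -> pseries F -> pseries F -> pseries F -> Prop).
Local Notation P := (pseries F).
Hypothesis Hmul : forall a b c d a' b' c' d', H a b c d -> H a' b' c' d' ->
  H (a * a' + b * c') (a * b' + b * d') (c * a' + d * c') (c * b' + d * d').
Hypothesis Hclosed : forall a b c d,
  (forall n, exists a' b' c' d', H a' b' c' d' /\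
     [/\ pscong n a' a, pscong n b' b, pscong n c' c & pscong n d' d]) -> H a b c d.
Hypothesis Hup : forall t, H 1 t 0 1.
Hypothesis Hlow : forall t, H 1 0 t 1.
Hypothesis Hdet : forall n a, ps0 a != 0 -> exists a1 b1 c1 d1, H a1 b1 c1 d1 /\
  pscong n (a1 * d1 - b1 * c1) a.

Let HmulE a b c d a' b' c' d' x y z w : H a b c d -> H a' b' c' d' ->
  a * a' + b * c' = x -> a * b' + b * d' = y -> c * a' + d * c' = z ->
  c * b' + d * d' = w -> H x y z w.
Proof. by move=> h h' <- <- <- <-; apply: Hmul. Qed.

(** If [c] is a unit, the matrix is the product of the upper transvection by [(a - 1) / c], the
    lower one by [c] and the upper one by [(d - 1) / c]. Otherwise [a] is a unit, and adding the
    first row to the second reduces to that case. *)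
Lemma SL2_generated a b c d : a * d - b * c = 1 -> H a b c d.
Proof.
have unitc a' b' c' d' : ps0 c' != 0 -> a' * d' - b' * c' = 1 -> H a' b' c' d'.
  move=> c0 e; have cu : c' \is a GRing.unit by rewrite ps_unitE.
  pose v := c'^-1; have vc : v * c' = 1 by rewrite mulVr.
  have {}cu : c' * v = 1 by rewrite mulrC.
  have h1 := Hmul (Hup ((a' - 1) * v)) (Hlow c').
  apply: (HmulE h1 (Hup ((d' - 1) * v))).
  - have -> : (1 * 1 + (a' - 1) * v * c') * 1 + (1 * 0 + (a' - 1) * v * 1) * 0
       = 1 + (a' - 1) * (v * c') by ring.
    by rewrite vc; ring.
  - have -> : (1 * 1 + (a' - 1) * v * c') * ((d' - 1) * v) + (1 * 0 + (a' - 1) * v * 1) * 1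
      = (1 + (a' - 1) * (v * c')) * (d' - 1) * v + (a' - 1) * v by ring.
    rewrite vc; have -> : (1 + (a' - 1) * 1) * (d' - 1) * v + (a' - 1) * v
      = (a' * d' - b' * c' - 1) * v + b' * (c' * v) by ring.
    by rewrite e cu; ring.
  - by ring.
  - have -> : (0 * 1 + 1 * c') * ((d' - 1) * v) + (0 * 0 + 1 * 1) * 1
      = c' * v * (d' - 1) + 1 by ring.
    by rewrite cu; ring.
move=> e; have [c0|] := eqVneq (ps0 c) 0; last by move=> c0; apply: unitc.
have a0 : ps0 a != 0.
  apply/eqP => a0; have := congr1 (@ps0 F) e.
  rewrite rmorphB !rmorphM /= a0 c0 mul0r mulr0 subrr rmorph1 => /esym/eqP.
  by rewrite oner_eq0.
have h1 : H a b (c + a) (d + b).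
  apply: unitc; first by rewrite rmorphD /= c0 add0r.
  by rewrite -e; ring.
by apply: (HmulE (Hlow (-1)) h1); ring.
Qed.

(** Take an element of determinant [dN] close to [de] and scale the second row of the target by
    [dN / de], which is close to one. The scaled matrix differs from the chosen element by a factor
    in [SL_2], and closedness removes the approximation. *)
Lemma GL2_generated a b c d : ps0 (a * d - b * c) != 0 -> H a b c d.
Proof.
set de := a * d - b * c => de0; apply: Hclosed => n.
(* Precision [n.+1] ensures that [dN] is a unit even for [n = 0]. *)
have [a1 [b1 [c1 [d1 [h1 cong1]]]]] := Hdet n.+1 de0.
set dN := a1 * d1 - b1 * c1 in cong1.
have dN0 : ps0 dN != 0 by rewrite /ps0 cong1.
have deu : de \is a GRing.unit by rewrite ps_unitE.
have dNu : dN \is a GRing.unit by rewrite ps_unitE.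
pose ep := dN * de^-1; pose v := dN^-1.
have vd : v * dN = 1 by rewrite mulVr.
have ede : ep * de = dN by rewrite /ep -mulrA mulVr // mulr1.
have epc : pscong n ep 1.
  apply: (@pscong_trans _ _ _ (de * de^-1)); last by rewrite divrr //; apply: pscong_refl.
  by apply: pscongM; [apply: pscong_le (leqnSn n) cong1|apply: pscong_refl].
exists a, b, (c * ep), (d * ep); split; last first.
  split; try exact: pscong_refl.
    by rewrite -[X in pscong _ _ X]mulr1; apply: pscongM => //; apply: pscong_refl.
  by rewrite -[X in pscong _ _ X]mulr1; apply: pscongM => //; apply: pscong_refl.
have SL : H ((a * d1 - b * c1) * v) ((b * a1 - a * b1) * v)
            ((c * d1 - d * c1) * (ep * v)) ((d * a1 - c * b1) * (ep * v)).
  apply: SL2_generated.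
  have -> : (a * d1 - b * c1) * v * ((d * a1 - c * b1) * (ep * v)) -
     (b * a1 - a * b1) * v * ((c * d1 - d * c1) * (ep * v))
     = (ep * de) * (v * dN) * v by rewrite /de /dN; ring.
  by rewrite ede vd mulr1 mulrC.
apply: (HmulE SL h1).
- have -> : (a * d1 - b * c1) * v * a1 + (b * a1 - a * b1) * v * c1 = a * (v * dN)
    by rewrite /dN; ring.
  by rewrite vd mulr1.
- have -> : (a * d1 - b * c1) * v * b1 + (b * a1 - a * b1) * v * d1 = b * (v * dN)
    by rewrite /dN; ring.
  by rewrite vd mulr1.
- have -> : (c * d1 - d * c1) * (ep * v) * a1 + (d * a1 - c * b1) * (ep * v) * c1
    = c * ep * (v * dN) by rewrite /dN; ring.
  by rewrite vd mulr1.
- have -> : (c * d1 - d * c1) * (ep * v) * b1 + (d * a1 - c * b1) * (ep * v) * d1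
    = d * ep * (v * dN) by rewrite /dN; ring.
  by rewrite vd mulr1.
Qed.
End GL2.

(** * Absence of rational roots at the third place *)

Section NoRationalRoot.
Variables (Fq : finFieldType) (c : Fq) (m1 m2 : {poly Fq}).
Local Notation q := #|Fq|.
Local Notation pi := ('X - c%:P).
Hypotheses (c0 : c != 0) (m2c : m2.[c] != 0).

(** A root [a / b] would have order [- 1 / (q + 1)] at [T = c]. The argument is a descent: [b]
    vanishes at [c], then so does [a], and after cancellation the equation is the same with smaller
    [b]. *)
Lemma no_rational_root (a b : {poly Fq}) : b != 0 ->
  'X * b ^+ q.+1 + pi * m1 * a * b ^+ q + pi * m2 * a ^+ q.+1 = 0 -> False.
Proof.
have [n] := ubnP (size b); elim: n a b => // n IH a b lt b0 e.
have q0 : (0 < q)%N := ltnW (finNzRing_gt1 Fq).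
have pi0 : pi != 0 by rewrite polyXsubC_eq0.
have pic : pi.[c] = 0 by rewrite hornerXsubC subrr.
have /factor_theorem[b1 eb] : root b c.
  have := congr1 (horner^~ c) e; rewrite /= !hornerE /= subrr !mul0r !addr0.
  by move/eqP; rewrite mulf_eq0 (negPf c0) expf_eq0 /= => h.
have e2 : 'X * b1 ^+ q.+1 * pi ^+ q + m1 * a * b1 ^+ q * pi ^+ q + m2 * a ^+ q.+1 = 0.
  apply: (mulfI pi0); rewrite mulr0 -[RHS]e eb !exprMn !exprS; ring.
have /factor_theorem[a1 ea] : root a c.
  have := congr1 (horner^~ c) e2; rewrite /= !hornerE /= subrr expr0n.
  rewrite eqn0Ngt q0 !mulr0 !add0r.
  by move/eqP; rewrite mulf_eq0 (negPf m2c) expf_eq0 /= => h.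
have b10 : b1 != 0 by apply: contraNneq b0 => b10; rewrite eb b10 mul0r.
apply: (IH a1 b1) => //.
  rewrite -ltnS; apply: leq_trans lt; rewrite eb size_mul // size_XsubC addn2.
  by rewrite ltnS.
apply: (mulfI (expf_neq0 q.+1 pi0)); rewrite mulr0 -[RHS]e eb ea !exprMn !exprS; ring.
Qed.
End NoRationalRoot.

(** * Surjectivity *)

Section Surjective.
Variables (Fq : finFieldType) (L : fieldType).
Local Notation A := {poly Fq}.
Variable iota : {rmorphism {fraction A} -> L}.
Hypothesis scl : separable_closure iota.
Local Notation q := #|Fq|.
Variables (g1 g2 m1 m2 g : A) (c c' : Fq).
Hypotheses (q2 : (2 < q)%N) (c0 : c != 0) (c'0 : c' != 0).
Hypotheses (g10 : g1.[0] != 0) (g20 : g2.[0] != 0).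
Hypotheses (g1c : g1.[c] != 0) (eg : g2 = ('X - c%:P) * g) (gc : g.[c] != 0).
Hypotheses (em1 : g1 = ('X - c'%:P) * m1) (em2 : g2 = ('X - c'%:P) * m2) (m2c : m2.[c'] != 0).
Local Notation jL := (jL iota).
Local Notation kL := (kL iota).
Local Notation D := (DL iota g1 g2).
Local Notation P := (pseries Fq).
Local Notation K := (ps_map kL).
Local Notation G := (in_galois_group iota).
Local Notation istate := (istate iota g1 g2).

Lemma g2_neq0 : g2 != 0.
Proof. by apply: contraNneq g20 => ->; rewrite horner0. Qed.

Lemma coef_scale (x : pseries L) (b : nat -> Fq) n : pscoef x 0 = 0 ->
  \sum_(i < n) kL (b i) * pscoef x (n - i)%N = pscoef (K (PSeries b) * x) n.
Proof. by move=> x0; rewrite pscoefM big_ord_recr /= subnn x0 mulr0 addr0. Qed.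

(** If the line were stable, every Galois element would scale [v] by a nonzero constant of [F_q], so
    [v^(q-1)] would be rational; but it is a root of the equation excluded by [no_rational_root]. *)
Lemma line_moved v : v != 0 -> D v = 0 -> exists2 s, G s & forall d, s v != kL d * v.
Proof.
move=> v0 Dv; apply: contrapT => h.
have q1 : (1 < q)%N := finNzRing_gt1 Fq.
have stab s : G s -> exists d, s v = kL d * v.
  move=> gs; apply: contrapT => h'; apply: h; exists s => // d.
  by apply/eqP => e; apply: h'; exists d.
pose X := v ^+ q.-1.
have vq : v ^+ q = v * X by rewrite -exprS prednK // ltnW.
have fX s : G s -> s X = X.
  move=> gs; have [d ed] := stab _ gs; rewrite rmorphXn ed exprMn -rmorphXn.
  have d0 : d != 0.
    apply: contraNneq v0 => d0; move/eqP: ed; rewrite d0 rmorph0 mul0r.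
    by rewrite fmorph_eq0.
  have -> : d ^+ q.-1 = 1.
    by apply: (mulfI d0); rewrite -exprS prednK ?(ltnW q1) // expf_card mulr1.
  by rewrite rmorph1 mul1r.
have [a [b [b0 eX]]] := galois_fixed scl fX.
have jb0 : jL b != 0 by rewrite -(rmorph0 jL) (inj_eq (jL_inj (iota := iota))).
have eqX : jL 'X + jL g1 * X + jL g2 * X ^+ q.+1 = 0.
  apply: (mulfI v0); rewrite mulr0 -Dv /DL /opD vq exprMn vq exprS; ring.
have e : 'X * b ^+ q.+1 + g1 * a * b ^+ q + g2 * a ^+ q.+1 = 0.
  apply: (jL_inj (iota := iota)); rewrite rmorph0 !(rmorphD jL) !(rmorphM jL) !(rmorphXn jL).
  have -> : jL a = X * jL b by rewrite eX divfK.
  rewrite exprMn; have -> : jL 'X * jL b ^+ q.+1 + jL g1 * (X * jL b) * jL b ^+ q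
    + jL g2 * (X ^+ q.+1 * jL b ^+ q.+1)
    = (jL 'X + jL g1 * X + jL g2 * X ^+ q.+1) * jL b ^+ q.+1 by rewrite !exprS; ring.
  by rewrite eqX mul0r.
by apply: (no_rational_root c'0 m2c b0 (a := a) (m1 := m1)); rewrite -em1 -em2.
Qed.

Lemma tate_surjective : exists f1 f2 : pseries L, [/\ istate f1, istate f2,
  forall c d, kL c * pscoef f1 1 + kL d * pscoef f2 1 = 0 -> c = 0 /\ d = 0 &
  forall a b c d, ps0 (a * d - b * c) != 0 -> real iota f1 f2 a b c d].
Proof.
have [k [kap _]] := countable_algebraic_closure Fq.
have [f [f0 fS fn0 fT]] := place_transvection scl kap c0 g1c eg gc.
pose f1 : pseries L := PSeries f.
have t1 : istate f1 by [].
have Df1 : D (f 1%N) = 0 by rewrite fS.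
have [h gh hP] := line_moved fn0 Df1.
pose f2 := ps_map h f1.
have t2 : istate f2 by apply: istate_galois.
have ind c1 d1 : kL c1 * pscoef f1 1 + kL d1 * pscoef f2 1 = 0 -> c1 = 0 /\ d1 = 0.
  move=> e0; have e : kL c1 * f 1%N + kL d1 * h (f 1%N) = 0 := e0; have d0 : d1 = 0.
    apply/eqP/negPn/negP => dn0; have kd0 : kL d1 != 0 by rewrite fmorph_eq0.
    move/eqP: (hP (- c1 / d1)); apply; apply: (mulfI kd0).
    rewrite mulrA -rmorphM mulrCA divff // mulr1 rmorphN mulNr.
    by apply/eqP; rewrite eq_sym -subr_eq0 -opprD oppr_eq0 e.
  move: e; rewrite d0 rmorph0 mul0r addr0 => /eqP.
  by rewrite mulf_eq0 (negPf fn0) orbF fmorph_eq0 => /eqP ->.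
exists f1, f2; split=> //.
have g2n := g2_neq0.
have bas := istate_basis g2n t1 t2 ind.
have cgP := comb_cong t1 t2 ind.
have closed := real_closed scl t1 t2 ind.
have mul := @real_mul _ _ iota f1 f2.
have up t : real iota f1 f2 1 t 0 1.
  apply: closed => n; have [x Dx xP] := fT n.
  have [X tX eX] := istate_extend scl Dx.
  have [al [be eab]] := bas _ tX.
  (* In coordinates [X = al f1 + be f2]. Comparing [s X = X + b f1] with [s f2 = b1 f1 + d1 f2]
     gives [be b1 = b] and [be (d1 - 1) = 0] modulo [T^(n+1)]. *)
  have key (b : P) : exists b1 d1, real iota f1 f2 1 b1 0 d1 /\
      (pscong n.+1 (be * b1) b /\ pscong n.+1 (be * (d1 - 1)) 0).
    have [s gs [sf sx]] := xP (pscoef b).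
    have [a1 [b1 [c1 [d1 [e1 e2]]]]] := real_galois g2n t1 t2 ind gs.
    have sf1 : ps_map s f1 = comb iota f1 f2 1 0.
      by rewrite comb10; apply: pseriesP => i; apply: sf.
    exists b1, d1; split; first by exists s.
    have cg : pscong n.+2 (ps_map s X) (X + K b * f1).
      apply: (istate_cong (n := n.+1) (istate_galois gs tX)).
        by apply: istateD => //; apply: istateZ.
      rewrite pscoefD -[LHS]/(s (pscoef X n.+1)) eX sx; congr (_ + _).
      exact: (@coef_scale f1 (pscoef b) n.+1).
    move: cg; rewrite eab galois_comb // sf1 e2.
    have -> : K al * comb iota f1 f2 1 0 + K be * comb iota f1 f2 b1 d1
       = comb iota f1 f2 (al + be * b1) (be * d1).
      by rewrite /comb !rmorphD !rmorphM rmorph1 rmorph0; ring.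
    have -> : comb iota f1 f2 al be + K b * f1 = comb iota f1 f2 (al + b) be.
      by rewrite /comb !rmorphD; ring.
    move/cgP => [h1 h2]; split; apply/pscong_sub.
      have -> : be * b1 - b = (al + be * b1) - (al + b) by ring.
      by apply: (proj1 (pscong_sub _ _ _)).
    have -> : be * (d1 - 1) - 0 = be * d1 - be by ring.
    by apply: (proj1 (pscong_sub _ _ _)).
  (* The case [b = 1] forces [be] to be a unit; afterwards [b = be t] makes [b1] congruent to [t]
     and [d1] to [1]. *)
  have be0 : ps0 be != 0.
    have [b1 [d1 [_ [h1 _]]]] := key 1; apply/eqP => z.
    have : ps0 (be * b1) = 1 by apply: h1.
    by rewrite rmorphM /= z mul0r => /esym/eqP; rewrite oner_eq0.
  have beu : be \is a GRing.unit by rewrite ps_unitE.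
  have vb : be^-1 * be = 1 by rewrite mulVr.
  have [b1 [d1 [hr [h1 h2]]]] := key (be * t).
  exists 1, b1, 0, d1; split=> //; split; try exact: pscong_refl.
    apply: pscong_le (leqnSn n) _.
    have -> : b1 = be^-1 * (be * b1) by rewrite mulrA vb mul1r.
    have -> : t = be^-1 * (be * t) by rewrite mulrA vb mul1r.
    by apply: pscongM; [apply: pscong_refl|].
  apply: pscong_le (leqnSn n) _; apply/pscong_sub.
  have -> : d1 - 1 = be^-1 * (be * (d1 - 1)) by rewrite mulrA vb mul1r.
  by rewrite -(mulr0 be^-1); apply: pscongM; [apply: pscong_refl|].
(* As [h] takes [f1] to [f2], conjugation by [h] turns the transvections fixing [f1] into those
   fixing [f2]. The parameter [be t] yields exactly [t] because [be c2 = 1]. *)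
have low t : real iota f1 f2 1 0 t 1.
  have [a1 [be [c1 [de [e1 e2]]]]] := real_galois g2n t1 t2 ind gh.
  have rh : real iota f1 f2 0 be 1 de by exists h => //; rewrite comb01.
  have [h' gh' [hh' h'h]] := galois_inv gh.
  have [a' [b' [c2 [d' [e1' e2']]]]] := real_galois g2n t1 t2 ind gh'.
  have rh' : real iota f1 f2 a' b' c2 d' by exists h'.
  have hf1 : ps_map h f1 = comb iota f1 f2 0 1 by rewrite comb01.
  have id1 : comb iota f1 f2 1 0 = comb iota f1 f2 (be * c2) (a' + de * c2).
    rewrite comb10 -[LHS](_ : ps_map h (ps_map h' f1) = f1); last first.
      by apply: pseriesP => i; apply: h'h.
    rewrite e1' galois_comb // hf1 e2 /comb !rmorphD !rmorphM rmorph1 rmorph0; ring.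
  have id2 : comb iota f1 f2 0 1 = comb iota f1 f2 (be * d') (b' + de * d').
    rewrite comb01 -[LHS](_ : ps_map h (ps_map h' f2) = f2); last first.
      by apply: pseriesP => i; apply: h'h.
    rewrite e2' galois_comb // hf1 e2 /comb !rmorphD !rmorphM rmorph1 rmorph0; ring.
  have [i1 i2] := comb_inj t1 t2 ind id1; have [i3 i4] := comb_inj t1 t2 ind id2.
  have d'0 : d' = 0.
    by rewrite -[d']mul1r i1 mulrAC -i3 mul0r.
  have := mul _ _ _ _ _ _ _ _ (mul _ _ _ _ _ _ _ _ rh (up (be * t))) rh'.
  rewrite d'0 mulr0 addr0 in i4; rewrite d'0 -i4.
  set x1 := (X in real _ _ _ X _ _ _ -> _); set x2 := (X in real _ _ _ _ X _ _ -> _).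
  set x3 := (X in real _ _ _ _ _ X _ -> _); set x4 := (X in real _ _ _ _ _ _ X -> _).
  have -> : x1 = be * c2 by rewrite /x1; ring.
  have -> : x2 = 0 by rewrite /x2; ring.
  have -> : x3 = (a' + de * c2) + be * c2 * t by rewrite /x3; ring.
  have -> : x4 = 1 by rewrite /x4; ring.
  by rewrite -i1 -i2 add0r mul1r.
(* Modulo [T^(n+1)], [s] is the identity plus a map into the span of [E]: [s f_i = f_i + be_i E]
   with [E = al f1 + ga f2]. Its determinant is [1 + be1 al + be2 ga], which is also its eigenvalue
   on [E], known to be [a]. *)
have det n a : ps0 a != 0 -> exists a1 b1 c1 d1, real iota f1 f2 a1 b1 c1 d1 /\
  pscong n (a1 * d1 - b1 * c1) a.
  move=> a0; have [e [De en eP]] := place_determinant scl kap q2 g10 g20 n.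
  have [s gs [se sz]] := eP (pscoef a) a0.
  have [E tE eE] := istate_extend scl De.
  have [al [ga eag]] := bas _ tE.
  have [a1 [b1 [c1 [d1 [e1 e2]]]]] := real_galois g2n t1 t2 ind gs.
  exists a1, b1, c1, d1; split; first by exists s.
  have sumE (b : nat -> Fq) : \sum_(i < n.+1) kL (b i) * iter i D e
      = pscoef (K (PSeries b) * E) n.+1.
    rewrite -coef_scale; last by case: tE.
    by apply: eq_bigr => i _; rewrite -eE (istate_iter _ _ tE).
  have sE : pscong n.+2 (ps_map s E) (K a * E).
    apply: istate_cong (istate_galois gs tE) (istateZ a tE) _.
    by rewrite -[LHS]/(s (pscoef E n.+1)) eE se (sumE (pscoef a)); case: (a).
  have sf x : istate x -> exists b : P, pscong n.+2 (ps_map s x) (x + K b * E).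
    move=> tx; have [|b eb] := sz (pscoef x n.+1).
      by rewrite (istate_iter _ _ tx) subnn; case: tx.
    exists (PSeries b); apply: istate_cong (istate_galois gs tx) _ _.
      by apply: istateD => //; apply: istateZ.
    by rewrite pscoefD -[LHS]/(s (pscoef x n.+1)) -sumE -eb addrC subrK.
  have [be1 h1] := sf _ t1; have [be2 h2] := sf _ t2.
  have KE b : K b * E = comb iota f1 f2 (b * al) (b * ga).
    by rewrite eag /comb !rmorphM; ring.
  move: h1; rewrite e1 KE -{2}(comb10 iota f1 f2).
  have -> : comb iota f1 f2 1 0 + comb iota f1 f2 (be1 * al) (be1 * ga)
     = comb iota f1 f2 (1 + be1 * al) (be1 * ga).
    by rewrite /comb !rmorphD rmorph1 rmorph0; ring.
  move/cgP => [ha1 hc1].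
  move: h2; rewrite e2 KE -{2}(comb01 iota f1 f2).
  have -> : comb iota f1 f2 0 1 + comb iota f1 f2 (be2 * al) (be2 * ga)
     = comb iota f1 f2 (be2 * al) (1 + be2 * ga).
    by rewrite /comb !rmorphD rmorph1 rmorph0; ring.
  move/cgP => [hb1 hd1].
  move: sE; rewrite KE eag galois_comb // e1 e2.
  have -> : K al * comb iota f1 f2 a1 c1 + K ga * comb iota f1 f2 b1 d1
     = comb iota f1 f2 (al * a1 + ga * b1) (al * c1 + ga * d1).
    by rewrite /comb !rmorphD !rmorphM; ring.
  move/cgP => [hal hga].
  pose de := 1 + be1 * al + be2 * ga.
  have cal : pscong n.+1 (al * de) (a * al).
    apply: pscong_trans hal; apply: pscong_sym.
    have -> : al * de = al * (1 + be1 * al) + ga * (be2 * al) by rewrite /de; ring.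
    by apply: pscongD; apply: pscongM => //; apply: pscong_refl.
  have cga : pscong n.+1 (ga * de) (a * ga).
    apply: pscong_trans hga; apply: pscong_sym.
    have -> : ga * de = al * (be1 * ga) + ga * (1 + be2 * ga) by rewrite /de; ring.
    by apply: pscongD; apply: pscongM => //; apply: pscong_refl.
  have cancel (x : P) : ps0 x != 0 -> pscong n.+1 (x * de) (a * x) -> pscong n.+1 de a.
    move=> x0 hx; have xu : x \is a GRing.unit by rewrite ps_unitE.
    have -> : de = x^-1 * (x * de) by rewrite mulrA mulVr // mul1r.
    have -> : a = x^-1 * (a * x) by rewrite mulrCA mulVr // mulr1.
    by apply: pscongM => //; apply: pscong_refl.
  (* [E] is primitive: if [al] and [ga] both vanished modulo [T], so would level [1] of [E], which
     is [D^n e]. One of the two coordinates can therefore be cancelled. *)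
  have cde : pscong n.+1 de a.
    have [al0|] := eqVneq (ps0 al) 0; last by move/cancel; apply.
    have [ga0|] := eqVneq (ps0 ga) 0; last by move/cancel; apply.
    case/eqP: en; rewrite -eE (istate_iter _ _ tE) subSn // subnn eag.
    have z (x : P) y : istate y -> ps0 x = 0 -> pscoef (K x * y) 1 = 0.
      move=> ty x0; rewrite (coef_low ty); last by [].
      by rewrite -[pscoef x 0]/(ps0 x) x0 rmorph0 mul0r.
    by rewrite pscoefD !z // addr0.
  apply: pscong_le (leqnSn n) _; apply: pscong_trans cde.
  have -> : de = (1 + be1 * al) * (1 + be2 * ga) - (be2 * al) * (be1 * ga).
    by rewrite /de; ring.
  by apply: pscongB; apply: pscongM.
by move=> a b c1 d1; apply: GL2_generated.
Qed.
End Surjective.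

(** * Evaluation of twisted polynomials *)

Section Evaluation.
Variables (Fq : finFieldType) (F L : fieldType).
Local Notation A := {poly Fq}.
Variables (gam : {rmorphism A -> F}) (iota : {rmorphism F -> L}).
Local Notation q := #|Fq|.
Local Notation frob := (frobq gam).
Local Notation kF := (iota \o gam \o polyC).

Definition skew_eval (p : {poly F}) (x : L) := \sum_(i < size p) iota p`_i * x ^+ (q ^ i).

Lemma skew_eval_wide n (p : {poly F}) x : (size p <= n)%N ->
  skew_eval p x = \sum_(i < n) iota p`_i * x ^+ (q ^ i).
Proof.
move=> le; rewrite /skew_eval (big_ord_widen n (fun i => iota p`_i * x ^+ (q ^ i))) //.
rewrite big_mkcond; apply: eq_bigr => i _ /=.
by case: ltnP => // h; rewrite nth_default // rmorph0 mul0r.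
Qed.

Lemma linearized_eval (f : twisted gam) x :
  (map_poly iota (linearized f)).[x] = skew_eval (skew_poly f) x.
Proof.
rewrite /linearized rmorph_sum horner_sum; apply: eq_bigr => i _.
by rewrite /= map_polyZ map_polyXn hornerZ hornerXn.
Qed.

Lemma skew_evalD (p p' : {poly F}) x : skew_eval (p + p') x = skew_eval p x + skew_eval p' x.
Proof.
pose n := maxn (size p) (size p').
rewrite (@skew_eval_wide n (p + p')) ?size_polyD //.
rewrite (@skew_eval_wide n p) ?leq_maxl // (@skew_eval_wide n p') ?leq_maxr //.
by rewrite -big_split; apply: eq_bigr => i _; rewrite coefD rmorphD mulrDl.
Qed.

Lemma skew_eval0 x : skew_eval 0 x = 0.
Proof. by rewrite /skew_eval size_poly0 big_ord0. Qed.

Lemma skew_evalZ c p x : skew_eval (c *: p) x = iota c * skew_eval p x.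
Proof.
rewrite (@skew_eval_wide (size p)) ?size_scale_leq // mulr_sumr.
by apply: eq_bigr => i _; rewrite coefZ rmorphM mulrA.
Qed.

Lemma skew_evalXn (p : {poly F}) n x : skew_eval (p * 'X^n) x = skew_eval p (x ^+ (q ^ n)).
Proof.
rewrite (@skew_eval_wide (n + size p)).
  rewrite big_split_ord /= big1 ?add0r; last first.
    by move=> i _; rewrite coefMXn ltn_ord rmorph0 mul0r.
  apply: eq_bigr => i _; rewrite coefMXn /= ltnNge leq_addr /= addKn.
  by rewrite -exprM -expnD.
have [->|p0] := eqVneq p 0; first by rewrite mul0r size_poly0.
by rewrite size_mulXn.
Qed.

Lemma iter_frobD n (x y : L) : (x + y) ^+ (q ^ n) = x ^+ (q ^ n) + y ^+ (q ^ n).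
Proof. by elim: n => [|n IH]; rewrite ?expr1 // expnSr !exprM IH (frobD kF). Qed.

Lemma skew_eval_shift n p x :
  skew_eval (iter n (map_poly frob) p) (x ^+ (q ^ n)) = skew_eval p x ^+ (q ^ n).
Proof.
have pw (m : nat) (f : nat -> L) :
    (\sum_(i < m) f i) ^+ (q ^ n) = \sum_(i < m) f i ^+ (q ^ n).
  elim: m => [|m IH]; last by rewrite !big_ord_recr /= iter_frobD IH.
  by rewrite !big_ord0 expr0n expn_eq0 -leqn0 leqNgt (ltnW (finNzRing_gt1 Fq)).
have sz : size (iter n (map_poly frob) p) = size p.
  by elim: (n) => //= m IH; rewrite size_map_poly IH.
have cf i : (iter n (map_poly frob) p)`_i = p`_i ^+ (q ^ n).
  by elim: (n) => [|m IH] /=; rewrite ?expr1 // coef_map IH /= /frobq expnSr exprM.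
rewrite /skew_eval (pw _ (fun i => iota p`_i * x ^+ (q ^ i))) sz.
apply: eq_bigr => i _; rewrite cf rmorphXn exprMn -!exprM; congr (_ * x ^+ _).
by rewrite mulnC.
Qed.

(** Evaluation turns the twisted product into composition, because [tau] acts as the [q]-power
    map. *)
Lemma skew_evalM p p' x : skew_eval (skew_mul frob p p') x = skew_eval p (skew_eval p' x).
Proof.
rewrite /skew_mul.
rewrite (big_morph (skew_eval^~ x) (fun p p' => skew_evalD p p' x) (skew_eval0 x)).
by apply: eq_bigr => i _; rewrite skew_evalZ skew_evalXn skew_eval_shift.
Qed.

Variable w : A * A.
Local Notation D := (opD Fq (iota (gam 'X)) (iota (gam w.1)) (iota (gam w.2))).

Definition tw_eval (f : twisted gam) x := skew_eval (skew_poly f) x.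

Lemma tw_evalD f g x : tw_eval (f + g) x = tw_eval f x + tw_eval g x.
Proof.
have -> : tw_eval (f + g) x = skew_eval (skew_poly f + skew_poly g) x by [].
exact: skew_evalD.
Qed.
Lemma tw_evalM f g x : tw_eval (f * g) x = tw_eval f (tw_eval g x).
Proof.
have e : skew_poly (f * g) = skew_mul frob (skew_poly f) (skew_poly g) by [].
by rewrite /tw_eval e skew_evalM.
Qed.
Lemma tw_evalC c x : tw_eval (skewC frob c) x = iota c * x.
Proof.
rewrite /tw_eval /= (@skew_eval_wide 1) ?size_polyC_leq1 //.
by rewrite big_ord_recl big_ord0 addr0 coefC expr1.
Qed.
Lemma tw_eval_tau x : tw_eval (tau frob) x = x ^+ q.
Proof.
rewrite /tw_eval /= (@skew_eval_wide 2) ?size_polyX //.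
by rewrite !big_ord_recl big_ord0 !coefX /= rmorph0 mul0r add0r rmorph1 mul1r addr0 expn1.
Qed.

Lemma tw_eval_phi_T x : tw_eval (phi_T gam w) x = D x.
Proof. by rewrite /phi_T expr2 !tw_evalD !tw_evalM !tw_evalC !tw_eval_tau. Qed.

(** Horner induction on [a]. Any bound [n] on the size is allowed, which suits truncated power
    series, whose exact size is unknown. *)
Lemma phi_evalE (a : A) n x : (size a <= n)%N ->
  phi_eval gam iota w a x = \sum_(i < n) iota (gam (a`_i)%:P) * iter i D x.
Proof.
rewrite /phi_eval linearized_eval -/(tw_eval _ _).
elim/poly_ind: a n x => [|a c IH] n x.
  by move=> _; rewrite rmorph0 big1 => [|i _]; rewrite ?coef0 ?polyC0 ?rmorph0 ?mul0r ?skew_eval0 // /tw_eval skew_eval0.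
case: n => [|n] le.
  move: le; rewrite leqn0 size_poly_eq0 => /eqP ->.
  by rewrite rmorph0 big_ord0 /tw_eval skew_eval0.
have sa : (size a <= n)%N.
  move: le; rewrite size_MXaddC; case: ifP => [/andP[/eqP -> _]|_ //].
  by rewrite size_poly0.
rewrite rmorphD rmorphM tw_evalD tw_evalM.
have -> : drinfeld gam w 'X = phi_T gam w by rewrite /drinfeld /= horner_morphX.
have -> : drinfeld gam w c%:P = skewC frob (gam c%:P) by rewrite /drinfeld /= horner_morphC.
rewrite tw_eval_phi_T (IH n) // tw_evalC big_ord_recl /= addrC; congr (_ + _).
  by rewrite coefD coefMX coefC /= add0r.
apply: eq_bigr => i _; rewrite /= coefD coefMX coefC /= addr0; congr (_ * _).
by rewrite -iterSr.
Qed.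

Lemma phi_eval_X x : phi_eval gam iota w 'X x = D x.
Proof.
rewrite (@phi_evalE _ 2) ?size_polyX // !big_ord_recl big_ord0 !coefX /=.
by rewrite polyC0 polyC1 !rmorph0 !rmorph1 mul0r add0r mul1r addr0.
Qed.

Lemma phi_eval_Xn n x : phi_eval gam iota w 'X^n x = iter n D x.
Proof.
rewrite (@phi_evalE _ n.+1) ?size_polyXn // big_ord_recr /= coefXn eqxx.
rewrite big1 ?add0r ?polyC1 ?rmorph1 ?mul1r // => i _; rewrite coefXn ltn_eqF ?ltn_ord //.
by rewrite polyC0 !rmorph0 mul0r.
Qed.

End Evaluation.

Lemma det_mx2 (R : comNzRingType) (M : 'M[R]_2) :
  \det M = M 0 0 * M 1 1 - M 0 1 * M 1 0.
Proof.
rewrite (expand_det_row _ 0) !big_ord_recl big_ord0 addr0 /cofactor !det_mx11 !mxE.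
rewrite /= expr0 expr1 mul1r mulN1r mulrN.
by congr (_ * M _ _ - M _ _ * M _ _); apply: val_inj.
Qed.

(** * The Tate module and the representation of the statement *)

Section TateModule.
Variables (Fq : finFieldType) (L : fieldType).
Local Notation A := {poly Fq}.
Variable iota : {rmorphism {fraction A} -> L}.
Local Notation gam := (@tofrac A).
Variable w : A * A.
Local Notation D := (DL iota w.1 w.2).

Lemma phi_eval_DL x : phi_eval gam iota w 'X x = D x.
Proof. exact: phi_eval_X. Qed.

Lemma phi_eval_DLn n x : phi_eval gam iota w 'X^n x = iter n D x.
Proof. exact: phi_eval_Xn. Qed.

Lemma phi_eval_kL (a : A) n x : (size a <= n)%N ->
  phi_eval gam iota w a x = \sum_(i < n) kL iota a`_i * iter i D x.
Proof. exact: phi_evalE. Qed.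

(** Level [0] is [phi[1] = 0], and applying [D] to level [n] as many as [n] times leads back to
    level [0]. *)
Lemma tateE x : tate gam iota w x <-> istate iota w.1 w.2 (PSeries x).
Proof.
have torE n y : torsion gam iota w 'X^n y <-> iter n D y = 0.
  rewrite -phi_eval_DLn; split; first by move/eqP.
  by move=> e; apply/eqP.
split=> [[h1 h2]|[h1 h2]].
  split=> [|n]; first exact/(torE 0%N)/h1.
  by rewrite -phi_eval_DL; apply: h2.
split=> n; last by rewrite phi_eval_DL; apply: h2.
by apply/torE; rewrite (iterD_seq (kL iota) h1 h2) subnn; apply: h1.
Qed.

(** The action on level [n] uses the digits of [a] below [n]; the one further term of the product at
    that level is a multiple of level [0], which is zero. *)
Lemma tate_scaleE a x : istate iota w.1 w.2 (PSeries x) ->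
  tate_scale gam iota w a x = pscoef (ps_map (kL iota) a * PSeries x).
Proof.
move=> [x0 xS]; apply: funext => n.
rewrite /tate_scale (@phi_eval_kL _ n) ?size_poly // pscoefM big_ord_recr.
rewrite [X in _ = _ + X](_ : _ = 0); last by rewrite subnn x0 mulr0.
rewrite addr0; apply: eq_bigr => i _; rewrite coef_poly ltn_ord; congr (_ * _).
exact: (iterD_seq (kL iota) x0 xS).
Qed.

Lemma tate_combE (a : 'cV[pseries Fq]_2) (e : 'I_2 -> nat -> L) :
  (forall i, istate iota w.1 w.2 (PSeries (e i))) ->
  tate_comb gam iota w a e
  = pscoef (comb iota (PSeries (e 0)) (PSeries (e 1)) (a 0 0) (a 1 0)).
Proof.
move=> te; apply: funext => n; rewrite /tate_comb !big_ord_recl big_ord0 addr0.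
by rewrite !tate_scaleE // /comb pscoefD; congr (_ + pscoef (ps_map _ (a _ 0) * PSeries (e _)) _); apply: val_inj.
Qed.

Lemma rho_surjective_of_real f1 f2 : w.2 != 0 ->
  istate iota w.1 w.2 f1 -> istate iota w.1 w.2 f2 ->
  (forall c d, kL iota c * pscoef f1 1 + kL iota d * pscoef f2 1 = 0 -> c = 0 /\ d = 0) ->
  (forall a b c d, ps0 (a * d - b * c) != 0 -> real iota f1 f2 a b c d) ->
  rho_surjective gam iota w.
Proof.
move=> w20 t1 t2 ind re.
pose e (i : 'I_2) := if i == 0 then pscoef f1 else pscoef f2.
have E0 : PSeries (e 0) = f1 by rewrite /e /=; case: (f1).
have E1 : PSeries (e 1) = f2 by rewrite /e /=; case: (f2).
have te i : istate iota w.1 w.2 (PSeries (e i)).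
  by rewrite /e; case: eqP => _; [case: (f1) t1|case: (f2) t2].
have cE a : tate_comb gam iota w a e = pscoef (comb iota f1 f2 (a 0 0) (a 1 0)).
  by rewrite tate_combE // E0 E1.
exists e.
  split=> [i|x /tateE tx]; first exact/tateE.
  have [a [b eab]] := istate_basis w20 t1 t2 ind tx.
  exists (\col_i (if i == 0 then a else b)); split.
    have -> : x = pscoef (comb iota f1 f2 a b) by rewrite -eab.
    by rewrite cE !mxE.
  move=> y ey; have : comb iota f1 f2 a b = comb iota f1 f2 (y 0 0) (y 1 0).
    by rewrite -eab; apply: pseriesP => n; rewrite -cE -ey.
  move/(comb_inj t1 t2 ind) => [-> ->]; apply/matrixP => i j.
  rewrite !mxE !ord1; case: eqP => [->//|].
  case: i => [[|[|//]] hi] ne; first by case: ne; apply: val_inj.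
  by congr (y _ _); apply: val_inj.
move=> M; rewrite unitmxE det_mx2 ps_unitE => /re[s gs [s1 s2]].
exists s => // j.
rewrite cE !mxE; case: j => [[|[|//]] hj].
  rewrite (_ : Ordinal hj = 0); last exact: val_inj.
  by rewrite -s1.
rewrite (_ : Ordinal hj = 1); last exact: val_inj.
by rewrite -s2.
Qed.

End TateModule.

(** * Density *)

Lemma limn_einf_gt0 (R : realType) (u : nat -> R) (de : R) N : 0 < de ->
  (forall n, (N <= n)%N -> de <= u n) -> (0 < limn_einf (fun n => (u n)%:E))%E.
Proof.
move=> de0 h; apply: (@lt_le_trans _ _ (de%:E)); first by rewrite lte_fin.
rewrite limn_einf_lim; apply: lime_ge; first exact: is_cvg_einfs.
exists N => // n /= le; apply: le_ereal_inf_tmp => x [m /= lm <-].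
by rewrite lee_fin h // (leq_trans le).
Qed.

Section Density.
Variable Fq : finFieldType.
Local Notation A := {poly Fq}.
Local Notation q := #|Fq|.

Lemma size_affine (Q K h : A) d N : size K = d.+1 -> (d <= N)%N -> (size Q <= N)%N ->
  (size h <= N - d)%N -> (size (Q + K * h)%R <= N)%N.
Proof.
move=> sK dN sQ sh; apply: leq_trans (size_polyD _ _) _; rewrite geq_max sQ.
apply: leq_trans (size_polyMleq _ _) _; rewrite sK addSn /=.
by rewrite -(subnKC dN) leq_add2l.
Qed.

Variables (c1 c2 : nat) (S : set (A * A)).
Hypotheses (c1_gt0 : (0 < c1)%N) (c2_gt0 : (0 < c2)%N).
Variables (Q1 K1 Q2 K2 : A).
Hypotheses (sK1 : size K1 = 4) (sK2 : size K2 = 6).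
Hypotheses (sQ1 : (size Q1 <= 5)%N) (sQ2 : (size Q2 <= 5)%N).
Hypothesis famS : forall h1 h2, S (Q1 + K1 * h1, Q2 + K2 * h2).
Hypothesis Spairs : S `<=` @pairs Fq.

(** [K1] has degree 3 and [K2] degree 5, so [h1] and [h2] range freely over polynomials of size at
    most [c1 X - 3] and [c2 X - 5]. The bound on [X] keeps these subtractions exact and leaves room
    for [Q1] and [Q2]. *)
Lemma count_family X : (5 <= X)%N ->
  (q ^ (c1 * X - 3) * q ^ (c2 * X - 5)
   <= #|` fset_set (S `&` pairs_below Fq c1 c2 X)|)%N.
Proof.
move=> X5.
have N1 : (5 <= c1 * X)%N by apply: leq_trans X5 _; rewrite leq_pmull.
have N2 : (5 <= c2 * X)%N by apply: leq_trans X5 _; rewrite leq_pmull.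
have fin : finite_set (S `&` pairs_below Fq c1 c2 X).
  by apply: sub_finite_set (finite_pairs_below Fq c1 c2 X); apply: subIsetr.
pose f (v : 'rV[Fq]_(c1 * X - 3) * 'rV[Fq]_(c2 * X - 5)) : A * A :=
  (Q1 + K1 * rVpoly v.1, Q2 + K2 * rVpoly v.2).
have finj : injective f.
  have K10 : K1 != 0 by rewrite -size_poly_gt0 sK1.
  have K20 : K2 != 0 by rewrite -size_poly_gt0 sK2.
  move=> [x y] [x' y'] [/addrI/(mulfI K10) ex /addrI/(mulfI K20) ey].
  by congr (_, _); rewrite -[LHS]rVpolyK -[RHS]rVpolyK ?ex ?ey.
have -> : (q ^ (c1 * X - 3) * q ^ (c2 * X - 5))%N
    = size [seq f v | v <- enum {: 'rV[Fq]_(c1 * X - 3) * 'rV[Fq]_(c2 * X - 5)}].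
  by rewrite size_map -cardE card_prod !card_mx !mul1n.
apply: uniq_leq_size; first by rewrite map_inj_uniq ?enum_uniq.
move=> w /mapP[v _ ->]; rewrite -[_ \in _]/(f v \in fset_set _) in_fset_set // inE.
have Sf : S (f v) by apply: famS.
split=> //; split; first exact: Spairs.
split; rewrite /=.
  apply: (size_affine sK1); rewrite ?size_poly //; last by apply: leq_trans N1.
  by apply: leq_trans N1.
by apply: (size_affine sK2); rewrite ?size_poly //; apply: leq_trans N2.
Qed.

Lemma count_pairs X :
  (#|` fset_set (pairs_below Fq c1 c2 X)| <= q ^ (c1 * X) * q ^ (c2 * X))%N.
Proof.
pose f (v : 'rV[Fq]_(c1 * X) * 'rV[Fq]_(c2 * X)) : A * A := (rVpoly v.1, rVpoly v.2).
have -> : (q ^ (c1 * X) * q ^ (c2 * X))%N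
    = size [seq f v | v <- enum {: 'rV[Fq]_(c1 * X) * 'rV[Fq]_(c2 * X)}].
  by rewrite size_map -cardE card_prod !card_mx !mul1n.
apply: uniq_leq_size; first exact: fset_uniq.
move=> w; rewrite -[_ \in _]/(w \in fset_set _) in_fset_set ?inE; last exact: finite_pairs_below.
move=> [_ [w1 w2]]; apply/mapP; exists (poly_rV w.1, poly_rV w.2); first by rewrite mem_enum.
by rewrite /f /= !poly_rV_K //; case: (w).
Qed.

(** The lower bound [q^(-8)] comes from the degrees 3 and 5 of the moduli [K1] and [K2]. *)
Lemma density_family (R : realType) :
  (0 < limn_einf (fun X : nat =>
     ((#|` fset_set (S `&` pairs_below Fq c1 c2 X)|)%fset%:R
      / (#|` fset_set (pairs_below Fq c1 c2 X)|)%fset%:R : R)%:E))%E.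
Proof.
have q0 : (0 < q)%N := ltnW (finNzRing_gt1 Fq).
have q8 : (0 : R) < (q ^ 8)%:R by rewrite ltr0n expn_gt0 q0.
apply: (@limn_einf_gt0 _ _ ((q ^ 8)%:R^-1) 5); first by rewrite invr_gt0.
move=> X X5; set a := #|` _|; set b := #|` _|.
have N1 : (5 <= c1 * X)%N by apply: leq_trans X5 _; rewrite leq_pmull.
have N2 : (5 <= c2 * X)%N by apply: leq_trans X5 _; rewrite leq_pmull.
have ba : (b <= q ^ 8 * a)%N.
  apply: leq_trans (count_pairs X) _.
  apply: (@leq_trans (q ^ 8 * (q ^ (c1 * X - 3) * q ^ (c2 * X - 5)))).
    rewrite -!expnD leq_pexp2l //.
    move: N1 N2; case: (c1 * X)%N => [|[|[|[|[|x]]]]] // _.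
    case: (c2 * X)%N => [|[|[|[|[|y]]]]] // _.
    by rewrite !subSS !subn0 !addSn !addnS.
  by rewrite leq_mul2l count_family // orbT.
have a0 : (0 < a)%N.
  by apply: leq_trans (count_family X5); rewrite muln_gt0 !expn_gt0 q0.
have b0 : (0 < b)%N.
  apply: leq_trans a0 _; apply: uniq_leq_size; first exact: fset_uniq.
  move=> w; rewrite -![_ \in _]/(_ \in fset_set _) !in_fset_set ?inE.
  - by case.
  - exact: finite_pairs_below.
  - by apply: sub_finite_set (finite_pairs_below Fq c1 c2 X); apply: subIsetr.
rewrite ler_pdivlMr ?ltr0n // mulrC ler_pdivrMr // -natrM ler_nat.
by rewrite mulnC.
Qed.

End Density.

Theorem theorem1p1 (R : realType) (Fq : finFieldType)
    (Fsep : fieldType) (iota : {rmorphism {fraction {poly Fq}} -> Fsep})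
    (c1 c2 : nat) :
  (5 <= #|Fq|)%N -> odd #|Fq| -> (0 < c1)%N -> (0 < c2)%N ->
  separable_closure iota ->
  (0 < limn_einf (fun X : nat =>
         ((#|` fset_set (surjective_pairs iota `&` pairs_below Fq c1 c2 X)|)%fset%:R
          / (#|` fset_set (pairs_below Fq c1 c2 X)|)%fset%:R : R)%:E))%E.
Proof.
move=> q5 _ c10 c20 scl.
have q2 : (2 < #|Fq|)%N by apply: leq_trans q5.
have [c /andP[c0 c_neq1]] := exists_neq01 q2.
pose l1 : {poly Fq} := 'X - 1%:P; pose lc := 'X - c%:P.
have l10 : l1 != 0 by rewrite polyXsubC_eq0.
have lc0 : lc != 0 by rewrite polyXsubC_eq0.
have sl1 : size l1 = 2 by rewrite size_XsubC.
have slc : size lc = 2 by rewrite size_XsubC.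
have X0 : ('X : {poly Fq}) != 0 by rewrite polyX_eq0.
(* In the moduli, beyond the prescribed zeros, the factor ['X] freezes the values at [0], [l1]
   freezes [g1] at [1] and the cofactor of [l1] in [g2] there, and the second [lc] keeps the zero of
   [g2] at [c] simple. *)
apply: (@density_family Fq c1 c2 _ c10 c20 lc (lc * ('X * l1)) (l1 * lc)
  (l1 * lc * ('X * l1 * lc))).
- by rewrite !size_mul ?mulf_neq0 // size_polyX sl1 slc.
- by rewrite !size_mul ?mulf_neq0 // size_polyX sl1 slc.
- by rewrite slc.
- by rewrite size_mul // sl1 slc.
- move=> h1 h2; pose g1 := lc + lc * ('X * l1) * h1.
  pose g2 := l1 * lc + l1 * lc * ('X * l1 * lc) * h2; rewrite -/g1 -/g2.
  have hE := (hornerD, hornerN, hornerM, hornerX, hornerC).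
  have e10 : g1.[0] = - c by rewrite /g1 /l1 /lc !hE; ring.
  have e20 : g2.[0] = c by rewrite /g2 /l1 /lc !hE; ring.
  have e11 : g1.[1] = 1 - c by rewrite /g1 /l1 /lc !hE; ring.
  have nc1 : 1 - c != 0 by rewrite subr_eq0 eq_sym.
  pose g := lc * (1 + 'X * l1 * lc * h2).
  pose m1 := 1 + 'X * l1 * h1.
  pose m2 := l1 * (1 + 'X * l1 * lc * h2).
  (* The degenerate place is [1] and the place moving the line is [c]; they are passed in this order
     for [c] and [c'] of [tate_surjective]. *)
  have [||||||||||f1 [f2 [t1 t2 ind re]]] := @tate_surjective Fq Fsep iota scl g1 g2 m1 m2 g 1 c q2.
  + exact: oner_neq0.
  + exact: c0.
  + by rewrite e10 oppr_eq0.
  + by rewrite e20.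
  + by rewrite e11.
  + by rewrite /g2 /g -/l1; ring.
  + by rewrite /g /l1 /lc !hE subrr !(mulr0, mul0r) addr0 mulr1.
  + by rewrite /g1 /m1 -/lc; ring.
  + by rewrite /g2 /m2 -/lc; ring.
  + by rewrite /m2 /l1 /lc !hE subrr !(mulr0, mul0r) addr0 mulr1 subr_eq0.
  have g2n : g2 != 0 by apply: contraNneq c0 => z; rewrite -e20 z horner0.
  by split=> //=; apply: (@rho_surjective_of_real Fq Fsep iota (g1, g2) f1 f2).
- by move=> w [].
Qed.
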